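(* Let $M$ be a standard $m\times n$ matrix with row and column index sets $R$, $C$ and weights $w_R,w_C$, and let $k$ be a positive integer with $k\le\min(m,n)$. Then $$\mathbb{E}\big[{\min}_k(M)\big]=\mathbb{E}\big[T_{R\times C}(J_k(M))\big].$$
   Context: $R=\{1,\dots,m\}$ and $C=\{1,\dots,n\}$ carry positive weight functions $w_R,w_C$. A random variable is exponential of rate $\alpha$ if $\Pr(x>t)=e^{-\alpha t}$ for $t\ge0$. A standard matrix is a random $m\times n$ matrix $M$ for which there is a fixed set $Z\subseteq R\times C$ with $M(i,j)=0$ for $(i,j)\in Z$, while the entries $M(i,j)$, $(i,j)\notin Z$, are independent with $M(i,j)$ exponential of rate $w_R(i)w_C(j)$. A $k$-assignment is a set of $k$ positions no two in the same row or column; its cost is the sum of the corresponding entries; ${\min}_k(M)$ is the minimum cost of a $k$-assignment. A file is a row or column; a set of files covers the zeros of $M$ if every position of $Z$ lies in one of its files; a $(k-1)$-cover is a cover with exactly $k-1$ files and a partial $(k-1)$-cover is a subset of a $(k-1)$-cover. Writing a set of files as $(X,Y)$ with $X\subseteq R$, $Y\subseteq C$, $J_k(M)\subseteq 2^R\times 2^C$ is the family of partial $(k-1)$-covers of the zeros of $M$. Urn process: independently of $M$, to each $i\in R$ attach an independent time $\tau_i$ exponential of rate $w_R(i)$, and let $u_R(x)=\{i\in R:\tau_i\le x\}$ for $x\ge0$; independently, define $u_C(y)$ for $y\ge 0$ in the same way using $w_C$. For a family $J\subseteq 2^R\times 2^C$, $T_{R\times C}(J)$ is the Lebesgue measure (area)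 of $\{(x,y)\in[0,\infty)^2:(u_R(x),u_C(y))\in J\}$. *)

(* Defs.v *)
From HB Require Import structures.
From mathcomp Require Import all_boot all_order all_algebra.
From mathcomp Require Import all_classical all_reals all_analysis.

Set Implicit Arguments.
Unset Strict Implicit.
Unset Printing Implicit Defensive.

Import Order.TTheory GRing.Theory Num.Theory.
Import numFieldNormedType.Exports.

Local Open Scope ring_scope.

Definition exponential_rv d (T : measurableType d) (R : realType)
    (P : probability T R) (alpha : R) (X : {RV P >-> R}) : Prop :=
  forall t : R, 0 <= t ->
    P [set w | t < X w]%classic = (expR (- (alpha * t)))%:E.

(* Mutual independence of the subfamily (X i)_{i \in D}. *)
Definition mutually_independent d (T : measurableType d) (R : realType)
    (P : probability T R) (I : finType) (D : {set I})
    (X : I -> {RV P >-> R}) : Prop :=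
  forall (S : {set I}) (A : I -> set R),
    S \subset D -> (forall i, measurable (A i)) ->
    P [set w | forall i, i \in S -> A i (X i w)]%classic =
    (\prod_(i in S) P (X i @^-1` A i)%classic)%E.

(* Independence of the random vectors (X i)_i and (Y j)_j, tested on measurable
   boxes; these form pi-systems generating the sigma-algebras of the vectors. *)
Definition independent_vectors d (T : measurableType d) (R : realType)
    (P : probability T R) (I J : finType)
    (X : I -> {RV P >-> R}) (Y : J -> {RV P >-> R}) : Prop :=
  forall (A : I -> set R) (B : J -> set R),
    (forall i, measurable (A i)) -> (forall j, measurable (B j)) ->
    let EX := [set w | forall i, A i (X i w)]%classic in
    let EY := [set w | forall j, B j (Y j w)]%classic in
    P (EX `&` EY)%classic = (P EX * P EY)%E.

(* The positions outside Z have almost surely positive entries, so that Z is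
   the set of zeros of M up to a null event. *)
Definition standard_matrix d (T : measurableType d) (R : realType)
    (P : probability T R) (m n : nat) (wR : 'I_m -> R) (wC : 'I_n -> R)
    (Z : {set 'I_m * 'I_n}) (M : 'I_m * 'I_n -> {RV P >-> R}) : Prop :=
  [/\ forall p, p \in Z -> forall w, M p w = 0,
      mutually_independent (~: Z)%SET M
    & forall p, p \notin Z -> exponential_rv (wR p.1 * wC p.2) (M p)].

Definition assignment (m n k : nat) (S : {set 'I_m * 'I_n}) : bool :=
  (#|S| == k) &&
  [forall p in S, forall q in S,
     (p != q) ==> (p.1 != q.1) && (p.2 != q.2)].

Definition cost (R : realType) (m n : nat) (A : 'I_m * 'I_n -> R)
    (S : {set 'I_m * 'I_n}) : R := \sum_(p in S) A p.

(* The infimum of a finite set of reals, nonempty as soon as k <= minn m n,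
   hence a minimum. *)
Definition min_assignment (R : realType) (m n k : nat)
    (A : 'I_m * 'I_n -> R) : R :=
  inf [set cost A S | S in [set S | assignment k S]]%classic.

(* A set of files is a pair (X, Y) of a set of rows and a set of columns. *)
Definition covers (m n : nat) (Z : {set 'I_m * 'I_n})
    (F : {set 'I_m} * {set 'I_n}) : bool :=
  [forall p in Z, (p.1 \in F.1) || (p.2 \in F.2)].

Definition is_cover (m n l : nat) (Z : {set 'I_m * 'I_n})
    (F : {set 'I_m} * {set 'I_n}) : bool :=
  covers Z F && (#|F.1| + #|F.2| == l)%N.

Definition partial_covers (m n l : nat) (Z : {set 'I_m * 'I_n}) :
    {set {set 'I_m} * {set 'I_n}} :=
  [set F : {set 'I_m} * {set 'I_n} |
    [exists G, [&& is_cover l Z G, F.1 \subset G.1 & F.2 \subset G.2]]]%SET.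

Definition urn_times d (T : measurableType d) (R : realType)
    (P : probability T R) (m : nat) (wt : 'I_m -> R)
    (tau : 'I_m -> {RV P >-> R}) : Prop :=
  (forall i, exponential_rv (wt i) (tau i)) /\
  mutually_independent [set: 'I_m]%SET tau.

Definition sum_family (I J U : Type) (X : I -> U) (Y : J -> U) (s : I + J) : U :=
  match s with inl i => X i | inr j => Y j end.

Definition urn (R : realType) (m : nat) (t : 'I_m -> R) (x : R) : {set 'I_m} :=
  [set i | t i <= x]%SET.

Definition urn_area (R : realType) (m n : nat) (uR : R -> {set 'I_m})
    (uC : R -> {set 'I_n}) (J : {set {set 'I_m} * {set 'I_n}}) : \bar R :=
  (@lebesgue_measure R \x @lebesgue_measure R)%E
    [set xy : R * R | [/\ 0 <= xy.1, 0 <= xy.2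
                        & (uR xy.1, uC xy.2) \in J]]%classic.

(* Main.v *)
(* For a set Q of rows let V_k(Q) be the minimal cost of a k-assignment in the rows Q, and let
   thr_k(i) = V_k(Q) - V_(k-1)(Q \ i).  Summing over i in Q gives
     w(Q) E V_k(Q) = E S_k(Q) + sum_i w_i E V_(k-1)(Q \ i),   S_k(Q) = sum_i w_i thr_k(i),
   and unrolling this recursion on Q reproduces the row urn: E V_k(R) is the sum over |X| < k of
   g_R(X) E S_(k-|X|)(R \ X), where g_R(X) is the expected time that u_R spends at X.

   For the columns, let rk_Q(Y) be the least number of files, including the columns Y, covering
   the zeros in the rows Q.  It is a matroid rank function, and E S_k(Q) is the sum of g_C(Y) over
   rk_Q(Y) < k: almost surely, at each level r there is exactly one flat B of rank r whose columns
   belong to every optimal r-assignment.  The next optimal assignment enters through a unique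
   entry (i, d) with d outside B, and then the flat becomes cl(B + d).  As a function of that
   single entry, the event that it enters is an interval whose length is thr_(r+1)(i) - thr_r(i);
   by the Stein identity of the exponential law, the event therefore has probability
   w_i w_d E[(thr_(r+1)(i) - thr_r(i)) 1_B].  So the flat moves like the closure of the column
   urn, and both satisfy the same recursion along flats.

   The pairs (X, Y) with |X| + rk_(R \ X)(Y) < k are the partial (k-1)-covers. *)
From HB Require Import structures.
From mathcomp Require Import all_boot all_order all_algebra.
From mathcomp Require Import zify ring lra.

Set Implicit Arguments.
Unset Strict Implicit.
Unset Printing Implicit Defensive.

Import Order.TTheory GRing.Theory Num.Theory.

Local Open Scope ring_scope.

(** * Matchings and augmenting paths *)

Section Matchings.
Variables I J : finType.
Implicit Types (S P : {set I * J}) (p q : I * J).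

(** The obstacle is that an optimal assignment is a global function of the matrix, while the Stein
    identity moves a single entry. It is overcome by a reduction attached to a flat [B]. The rows
    with a zero outside [B] (the outer rows) can be matched at cost zero, off [B] and off one
    further column, so that only the remaining rows [L] of [Q] carry a cost. Apart from the optimal
    cost of the next size, the costs needed at this stage are minima over [L] and the columns [B],
    and they do not read an entry [(i, d)] with [d] outside [B]. Hence the fiber in that entry is an
    explicit interval, and the formula for its length does not mention [d]. The column enters
    through the factor [w_d] alone, which is all that a comparison with the urn requires: no Markov
    property of the chain of flats is proved, only two balance equations for the probabilities of
    the flats, one for the exits from a flat and one for the entries into it. The closure of the
    column urn satisfies the same equations because its moves inside a flat cancel. *)

Definition rws S : {set I} := [set p.1 | p in S].
Definition cls S : {set J} := [set p.2 | p in S].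

Definition matching S : bool :=
  [forall p in S, forall q in S,
     (p != q) ==> (p.1 != q.1) && (p.2 != q.2)].

Lemma matchingP S : reflect
  (forall p q, p \in S -> q \in S -> (p.1 = q.1 \/ p.2 = q.2) -> p = q)
  (matching S).
Proof.
apply: (iffP forall_inP) => [mS p q pS qS pq|mS p pS].
  move/forall_inP : (mS _ pS) => /(_ _ qS); case: (eqVneq p q) => //= _.
  by case: pq => ->; rewrite eqxx ?andbF.
apply/forall_inP => q qS; apply/implyP; case: (eqVneq p q) => //= npq _.
by apply/andP; split; apply: contra_neq npq => e; apply: mS => //; [left|right].
Qed.

Lemma rwsP S i : reflect (exists j, (i, j) \in S) (i \in rws S).
Proof.
apply: (iffP imsetP) => [[[i' j] pS /= ->]|[j pS]]; first by exists j.
by exists (i, j).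
Qed.

Lemma clsP S j : reflect (exists i, (i, j) \in S) (j \in cls S).
Proof.
apply: (iffP imsetP) => [[[i j'] pS /= ->]|[i pS]]; first by exists i.
by exists (i, j).
Qed.

Lemma mem_rws S p : p \in S -> p.1 \in rws S.
Proof. by move=> pS; apply/imsetP; exists p. Qed.

Lemma mem_cls S p : p \in S -> p.2 \in cls S.
Proof. by move=> pS; apply/imsetP; exists p. Qed.

Lemma rws_sub S P : S \subset P -> rws S \subset rws P.
Proof. exact: imsetS. Qed.

Lemma cls_sub S P : S \subset P -> cls S \subset cls P.
Proof. exact: imsetS. Qed.

Lemma rwsU S P : rws (S :|: P) = (rws S :|: rws P).
Proof. exact: imsetU. Qed.

Lemma clsU S P : cls (S :|: P) = (cls S :|: cls P).
Proof. exact: imsetU. Qed.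

Lemma rws1 p : rws [set p] = [set p.1].
Proof. exact: imset_set1. Qed.

Lemma cls1 p : cls [set p] = [set p.2].
Proof. exact: imset_set1. Qed.

Lemma rws0 : rws set0 = set0.
Proof. exact: imset0. Qed.

Lemma cls0 : cls set0 = set0.
Proof. exact: imset0. Qed.

Lemma matching0 : matching set0.
Proof. by apply/matchingP => p q; rewrite in_set0. Qed.

Lemma matching1 p : matching [set p].
Proof. by apply/matchingP => q r /set1P-> /set1P->. Qed.

Lemma matching_sub S P : P \subset S -> matching S -> matching P.
Proof.
move=> /subsetP PS /matchingP mS; apply/matchingP => p q pP qP.
by apply: mS; apply: PS.
Qed.

Lemma card_rws S : matching S -> #|rws S| = #|S|.
Proof.
by move=> /matchingP mS; apply: card_in_imset => p q pS qS e; apply: mS => //; left.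
Qed.

Lemma card_cls S : matching S -> #|cls S| = #|S|.
Proof.
by move=> /matchingP mS; apply: card_in_imset => p q pS qS e; apply: mS => //; right.
Qed.

Definition sep S P : bool :=
  [disjoint rws S & rws P] && [disjoint cls S & cls P].

Lemma sep_sym S P : sep S P = sep P S.
Proof. by rewrite /sep disjoint_sym; congr andb; exact: disjoint_sym. Qed.

Lemma sepUl S P T : sep (S :|: P) T = sep S T && sep P T.
Proof.
rewrite /sep rwsU clsU -!setI_eq0 !setIUl !setU_eq0.
by rewrite -!andbA; congr andb; rewrite andbCA.
Qed.

Lemma sep1 p S : sep [set p] S = (p.1 \notin rws S) && (p.2 \notin cls S).
Proof. by rewrite /sep rws1 cls1 !disjoints1. Qed.

Lemma sep_disj S P : sep S P -> [disjoint S & P].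
Proof.
move=> /andP[d1 _]; apply/pred0P => p /=; apply/negP => /andP[/mem_rws h1 /mem_rws h2].
by move/pred0P/(_ p.1): d1 => /=; rewrite h1 h2.
Qed.

Lemma matchingU S P :
  sep S P -> matching S -> matching P -> matching (S :|: P).
Proof.
move=> sSP /matchingP mS /matchingP mP.
have key p q : p \in S -> q \in P -> (p.1 = q.1 \/ p.2 = q.2) -> False.
  move=> pS qP; case/andP: sSP => /pred0P h1 /pred0P h2 [e|e].
    by move: (h1 p.1) => /=; rewrite mem_rws // e mem_rws.
  by move: (h2 p.2) => /=; rewrite mem_cls // e mem_cls.
apply/matchingP => p q /setUP[pS|pP] /setUP[qS|qP] e; [exact: mS| | |exact: mP].
  by case: (key _ _ pS qP).
by case: (key _ _ qS pP); case: e => ->; [left|right].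
Qed.

Lemma cardsU_sep S P : sep S P -> #|S :|: P| = (#|S| + #|P|)%N.
Proof.
by move=> /sep_disj d; rewrite cardsU disjoint_setI0 ?cards0 ?subn0.
Qed.

Lemma matching_sepD S P : matching S -> P \subset S -> sep P (S :\: P).
Proof.
move=> /matchingP mS /subsetP PS; apply/andP; split; apply/pred0P => x /=;
  apply/negP => /andP[].
  move=> /rwsP[j h] /rwsP[j'] /setDP[h' nh]; move: nh.
  by rewrite -(mS _ _ (PS _ h) h') ?h //; left.
move=> /clsP[j h] /clsP[j'] /setDP[h' nh]; move: nh.
by rewrite -(mS _ _ (PS _ h) h') ?h //; right.
Qed.

End Matchings.

Lemma setDUK (T : finType) (s P : {set T}) : P \subset s -> s = s :\: P :|: P.
Proof.
move=> Ps; apply/setP => x; rewrite !inE.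
by case: (boolP (x \in P)) => [/(subsetP Ps)->|]//=; rewrite ?andbT ?orbF.
Qed.

Lemma cardsUD (T : finType) (A B : {set T}) :
  #|A :|: B| = (#|A :\: B| + #|B|)%N.
Proof.
rewrite cardsU cardsD; have := subset_leq_card (subsetIl A B).
by move=> h; rewrite addnC -addnBA // addnC.
Qed.

(** * Hall's marriage theorem *)

Section Hall.
Variables I J : finType.
Implicit Types (G : {set I * J}) (U W : {set I}).

Definition nbr G W : {set J} := [set d | [exists i in W, (i, d) \in G]].

Lemma nbrP G W d : reflect (exists2 i, i \in W & (i, d) \in G) (d \in nbr G W).
Proof. by rewrite inE; exact: exists_inP. Qed.

Lemma nbrU G W W' : nbr G (W :|: W') = nbr G W :|: nbr G W'.
Proof.
apply/setP => d; rewrite in_setU; apply/nbrP/orP => [[i]|].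
  by rewrite inE => /orP[iW|iW] h; [left|right]; apply/nbrP; exists i.
by case=> /nbrP[i iW h]; exists i => //; rewrite inE iW ?orbT.
Qed.

Lemma nbrS G W W' : W \subset W' -> nbr G W \subset nbr G W'.
Proof. by move=> h; rewrite -(setUidPr h) nbrU subsetUl. Qed.

Definition del_cols G (Y : {set J}) : {set I * J} := [set p in G | p.2 \notin Y].

Lemma nbr_del_cols G Y W : nbr (del_cols G Y) W = nbr G W :\: Y.
Proof.
apply/setP => d; rewrite in_setD andbC; apply/nbrP/andP => [[i iW]|[/nbrP[i iW h] dY]].
  by rewrite inE /= => /andP[h ->]; split=> //; apply/nbrP; exists i.
by exists i => //; rewrite inE h.
Qed.

Lemma matching_del_cols G Y (s : {set I * J}) : s \subset del_cols G Y ->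
  s \subset G /\ [disjoint Y & cls s].
Proof.
move=> /subsetP sG; split.
  by apply/subsetP => p /sG; rewrite inE => /andP[].
apply/pred0P => d /=; apply/negP => /andP[dY /clsP[i /sG]].
by rewrite inE /= dY andbF.
Qed.

(** Halmos-Vaughan induction on [#|U|]. If a nonempty proper subset [W0] is tight, it is matched
    first and its neighbours are deleted. Otherwise every nonempty proper subset has a neighbour to
    spare, and any edge at any row [u] may be chosen. *)
Lemma hall_marriage G U :
  (forall W, W \subset U -> (#|W| <= #|nbr G W|)%N) ->
  exists s, [/\ matching s, s \subset G & rws s = U].
Proof.
have [n] := ubnP #|U|; elim: n G U => // n IH G U; rewrite ltnS => Un hall.
have [U0|[u uU]] := set_0Vmem U.
  by exists set0; rewrite matching0 sub0set rws0 U0.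
case: (boolP [exists W : {set I}, [&& W \proper U, W != set0 & #|nbr G W| == #|W|]]).
  move=> /existsP[W0 /and3P[W0U W00 /eqP nW0]].
  have [W0sU W0card] := (proper_sub W0U, proper_card W0U).
  have [s0 [ms0 s0G rs0]] : exists s, [/\ matching s, s \subset G & rws s = W0].
    by apply: IH; [exact: leq_trans Un|move=> W WW0; apply/hall/(subset_trans WW0)].
  have UW0 : (#|U :\: W0| < n)%N.
    apply: leq_trans Un; rewrite cardsD (setIidPr W0sU) ltn_subLR ?subset_leq_card //.
    by rewrite -[X in (X < _)%N]add0n ltn_add2r card_gt0.
  have [s [ms /matching_del_cols[sG sW0] rs]] :
      exists s, [/\ matching s, s \subset del_cols G (nbr G W0) & rws s = U :\: W0].
    apply: IH => // W WU.
    have dWW0 : [disjoint W & W0].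
      by rewrite disjoints_subset; apply: subset_trans WU _; rewrite setDE subsetIr.
    (* The tight part [W0] cancels from Hall's condition for [W :|: W0]. *)
    have := hall (W :|: W0); rewrite subUset W0sU andbT.
    move=> /(_ (subset_trans WU (subsetDl _ _))).
    rewrite nbr_del_cols nbrU !cardsUD nW0 (setDidPl dWW0).
    by rewrite leq_add2r.
  exists (s0 :|: s); split.
  - apply: matchingU => //; rewrite /sep rs0 rs; apply/andP; split.
      by apply/pred0P => x; rewrite /= inE; case: (x \in W0).
    apply: disjointWl sW0; apply/subsetP => d /clsP[i h].
    apply/nbrP; exists i; last exact: (subsetP s0G).
    by rewrite -rs0; apply/rwsP; exists d.
  - by rewrite subUset s0G.
  - by rewrite rwsU rs0 rs setUC -(setDUK W0sU).
move=> /existsPn noW.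
have [d duG] : exists d, (u, d) \in G.
  have := hall [set u]; rewrite sub1set uU cards1 => /(_ isT) /card_gt0P[d].
  by case/nbrP => v /set1P-> h; exists d.
have Uu : (#|U :\ u| < n)%N by apply: leq_trans Un; rewrite (cardsD1 u U) uU.
have [s [ms /matching_del_cols[sG sd] rs]] :
    exists s, [/\ matching s, s \subset del_cols G [set d] & rws s = U :\ u].
  apply: IH => // W WU.
  have [->|W0] := eqVneq W set0; first by rewrite cards0.
  have WpU : W \proper U.
    by apply: sub_proper_trans WU _; rewrite properD1.
  have := noW W; rewrite WpU W0 /= => neW.
  have := hall _ (proper_sub WpU); rewrite leq_eqVlt eq_sym (negPf neW) /=.
  rewrite nbr_del_cols (cardsD1 d (nbr G W)); case: (d \in _); first by rewrite add1n.
  by rewrite add0n => /ltnW.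
exists ((u, d) |: s); split.
- apply: matchingU => //; last exact: matching1.
  rewrite sep1 rs !inE eqxx /=.
  by apply/negP => h; move/pred0P/(_ d): sd => /=; rewrite set11 h.
- by rewrite subUset sub1set duG.
- by rewrite rwsU rws1 rs setD1K.
Qed.

End Hall.

Section Exchange.
Variables I J : finType.
Implicit Types (s t P Q : {set I * J}).

(* The connected component, in the union of [s] and [t], of a row [v] met by
   [t] only is an alternating path; [P] and [Q] are its edges in [s] and [t].
   It ends in a column met by [t] only, or in a row met by [s] only. *)
Lemma alternating_path s t v :
  matching s -> matching t -> v \in rws t -> v \notin rws s ->
  exists P Q, [/\ P \subset s, Q \subset t,
    sep P (t :\: Q) /\ sep Q (s :\: P), v \in rws Q &
    (exists w, [/\ w \notin cls s, rws Q = v |: rws P & cls Q = w |: cls P]) \/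
    (exists w, [/\ w \in rws P, w \notin rws t, cls Q = cls P &
      v |: rws P = w |: rws Q])].
Proof.
have [n] := ubnP #|t|; elim: n s t v => // n IH s t v + ms mt.
rewrite ltnS => tn /rwsP[d vdt] vs.
have vdtS : [set (v, d)] \subset t by rewrite sub1set.
have [ds|ds] := boolP (d \in cls s); last first.
  exists set0, [set (v, d)]; split; rewrite ?sub0set ?rws1 ?set11 //.
  - by rewrite setD0 sep1 vs ds /sep rws0 cls0 !disjoints_subset !sub0set.
  - by left; exists d; split; rewrite ?rws1 ?cls1 ?rws0 ?cls0 ?setU0.
case/clsP: ds => r rds.
have rdsS : [set (r, d)] \subset s by rewrite sub1set.
have dt : d \notin cls (t :\ (v, d)).
  by move: (matching_sepD mt vdtS); rewrite sep1 => /andP[].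
have vt : v \notin rws (t :\ (v, d)).
  by move: (matching_sepD mt vdtS); rewrite sep1 => /andP[].
have [ds rs] : d \notin cls (s :\ (r, d)) /\ r \notin rws (s :\ (r, d)).
  by move: (matching_sepD ms rdsS); rewrite sep1 => /andP[].
have vr : v != r by apply: contraNneq vs => ->; apply/rwsP; exists d.
have [rt|rt] := boolP (r \in rws t); last first.
  exists [set (r, d)], [set (v, d)]; split; rewrite ?rws1 ?set11 //.
  - split; rewrite sep1 ?dt ?ds andbT; [apply: contra rt|apply: contra vs];
      exact/subsetP/rws_sub/subsetDl.
  - by right; exists r; split; rewrite ?rws1 ?cls1 ?set11 //= setUC.
have ms1 : matching (s :\ (r, d)) by apply: matching_sub ms; apply: subD1set.
have mt1 : matching (t :\ (v, d)) by apply: matching_sub mt; apply: subD1set.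
have rt1 : r \in rws (t :\ (v, d)).
  case/rwsP: rt => e ret; apply/rwsP; exists e.
  by rewrite !inE ret andbT xpair_eqE negb_and eq_sym vr.
have tn1 : (#|t :\ (v, d)| < n)%N.
  by move: tn; rewrite (cardsD1 (v, d) t) vdt add1n.
(* With the edges [(v, d)] of [t] and [(r, d)] of [s] deleted, [r] is a row met by [t] only, and the
   rest of the path starts there. *)
have [P [Q [Ps Qt [sPt sQs] rQ PQ]]] := IH _ _ r tn1 ms1 mt1 rt1 rs.
have Ps' : P \subset s by apply: subset_trans Ps _; apply: subD1set.
have Qt' : Q \subset t by apply: subset_trans Qt _; apply: subD1set.
have tQ : t :\: ((v, d) |: Q) = (t :\ (v, d)) :\: Q by rewrite setDDl.
have sP : s :\: ((r, d) |: P) = (s :\ (r, d)) :\: P by rewrite setDDl.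
exists ((r, d) |: P), ((v, d) |: Q); split.
- by rewrite subUset rdsS.
- by rewrite subUset vdtS.
- split; first rewrite tQ sepUl sPt andbT sep1 /=; last rewrite sP sepUl sQs andbT sep1 /=.
  apply/andP; split.
    apply/negP => h; move: (matching_sepD mt1 Qt) => /andP[/pred0P/(_ r)/=].
    by rewrite rQ h.
  by apply: contra dt; apply/subsetP/cls_sub/subsetDl.
  apply/andP; split.
    apply: contra vs; apply/subsetP/rws_sub.
    by apply: subset_trans (subsetDl _ _) (subD1set _ _).
  by apply: contra ds; apply/subsetP/cls_sub/subsetDl.
- by rewrite rwsU rws1 !inE eqxx.
have vP : v \notin rws P by apply: contra vs; apply/subsetP/rws_sub.
have rP : r \notin rws P by apply: contra rs; apply/subsetP/rws_sub.
case: PQ => [[w [ws rQP cQP]]|[w [wP wt cQP rPQ]]].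
  left; exists w; split.
  - apply: contra ws => /clsP[i iws]; apply/clsP; exists i.
    rewrite !inE iws andbT xpair_eqE negb_and; apply/orP; right.
    apply/eqP => wd; move: (setU11 w (cls P)); rewrite -cQP wd => h.
    by move/negP: dt; apply; move: h; apply/subsetP/cls_sub.
  - by rewrite !rwsU !rws1 rQP.
  - by rewrite !clsU !cls1 cQP /= setUCA.
right; exists w; split.
- by rewrite rwsU !inE wP orbT.
- apply: contra wt => /rwsP[e wet]; apply/rwsP; exists e.
  rewrite !inE wet andbT xpair_eqE negb_and; apply/orP; left.
  by apply: contraNneq vP => <-.
- by rewrite !clsU !cls1 cQP.
- by rewrite !rwsU !rws1 /= rPQ setUCA.
Qed.

End Exchange.

Section Augmentation.
Variables (R : nmodType) (I J : finType).
Implicit Types (s t P Q : {set I * J}).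

(** Quantifying over every weight [a] expresses that an exchange only redistributes the entries,
    counted with multiplicity, so that it applies to whatever matrix is considered. *)
Definition same_total s t s' t' : Prop := forall a : I * J -> R,
  \sum_(p in s') a p + \sum_(p in t') a p
  = \sum_(p in s) a p + \sum_(p in t) a p.

Definition augments s t s' t' (w : J) : Prop :=
  [/\ matching s' /\ matching t', w \notin cls s /\ cls s' = w |: cls s,
      w \notin cls t' /\ cls t = w |: cls t',
      rws s' :|: rws t' \subset rws s :|: rws t & same_total s t s' t'].

Lemma sum_sep (a : I * J -> R) s t : sep s t ->
  \sum_(p in s :|: t) a p = \sum_(p in s) a p + \sum_(p in t) a p.
Proof. by move=> /sep_disj d; rewrite -bigU //=; apply: eq_bigl => x; rewrite !inE. Qed.

Lemma sum_setD (a : I * J -> R) s P : P \subset s ->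
  \sum_(p in s) a p = \sum_(p in s :\: P) a p + \sum_(p in P) a p.
Proof. by move=> Ps; rewrite (big_setID P) /= (setIidPr Ps) addrC. Qed.

Lemma flip_same_total s t P Q : P \subset s -> Q \subset t ->
  matching s -> matching t -> sep P (t :\: Q) -> sep Q (s :\: P) ->
  same_total s t (s :\: P :|: Q) (t :\: Q :|: P).
Proof.
move=> Ps Qt ms mt sPt sQs a.
rewrite (sum_setD a Ps) (sum_setD a Qt) !sum_sep 1?sep_sym //.
by rewrite addrACA [X in _ + X]addrC addrACA.
Qed.

Lemma flip_matching s t P Q : Q \subset t ->
  matching s -> matching t -> sep Q (s :\: P) -> matching (s :\: P :|: Q).
Proof.
move=> Qt ms mt sQs; apply: matchingU; first by rewrite sep_sym.
  exact: matching_sub (subsetDl _ _) ms.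
exact: matching_sub Qt mt.
Qed.

Lemma flip_augments s t v w P Q : P \subset s -> Q \subset t ->
  matching s -> matching t -> sep P (t :\: Q) -> sep Q (s :\: P) ->
  w \notin cls s -> rws Q = v |: rws P -> cls Q = w |: cls P ->
  augments s t (s :\: P :|: Q) (t :\: Q :|: P) w.
Proof.
move=> Ps Qt ms mt sPt sQs ws rQ cQ; split.
- split; first exact: (flip_matching Qt ms mt sQs).
  exact: (flip_matching Ps mt ms sPt).
- by split=> //; rewrite [X in _ |: cls X](setDUK Ps) !clsU cQ setUCA.
- split; last by rewrite {1}(setDUK Qt) !clsU cQ setUCA.
  rewrite clsU inE negb_or; apply/andP; split.
    move/andP: (matching_sepD mt Qt) => [_ /pred0P/(_ w)] /=.
    by rewrite cQ setU11 => /negbT.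
  by apply: contra ws; apply/subsetP/cls_sub.
- rewrite [X in _ \subset rws X :|: _](setDUK Ps).
  rewrite [X in _ \subset _ :|: rws X](setDUK Qt) !rwsU.
  by apply/subsetP => x; rewrite !inE => /orP[]/orP[]->; rewrite ?orbT.
- exact: flip_same_total.
Qed.

(** A path that covers the same columns on both sides can be laid aside while the rest is augmented,
    then put back either as it was or swapped. Swapping it is what frees a prescribed row in
    [augmenting_path_avoiding]. *)
Lemma augments_component s t P Q s0 t0 w : P \subset s -> Q \subset t ->
  matching s -> matching t -> sep P (t :\: Q) -> sep Q (s :\: P) ->
  cls Q = cls P -> augments (s :\: P) (t :\: Q) s0 t0 w ->
  augments s t (s0 :|: P) (t0 :|: Q) w /\ augments s t (s0 :|: Q) (t0 :|: P) w.
Proof.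
move=> Ps Qt ms mt sPt sQs cQ [[ms0 mt0] [ws0 cs0] [wt0 ct0] rst tot].
have mP := matching_sub Ps ms; have mQ := matching_sub Qt mt.
have w'tQ : w \in cls (t :\: Q) by rewrite ct0 setU11.
have wQ : w \notin cls Q.
  apply/negP => h; case/andP: (matching_sepD mt Qt) => _ /pred0P/(_ w) /=.
  by rewrite h w'tQ.
have cs0U : cls s0 \subset cls (s :\: P) :|: cls (t :\: Q).
  by rewrite cs0 ct0 setUCA setUA subsetUl.
have ct0U : cls t0 \subset cls (s :\: P) :|: cls (t :\: Q).
  by rewrite ct0 setUA subsetUr.
have rs0U := subset_trans (subsetUl _ _) rst.
have rt0U := subset_trans (subsetUr _ _) rst.
have rsep A B : sep A (s :\: P) -> sep A (t :\: Q) ->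
    rws B \subset rws (s :\: P) :|: rws (t :\: Q) ->
    cls B \subset cls (s :\: P) :|: cls (t :\: Q) -> sep B A.
  move=> /andP[h1 h2] /andP[h3 h4] h5 h6; apply/andP; split.
    apply: disjointWl h5 _; rewrite -setI_eq0 setIUl setU_eq0 !setI_eq0.
    by rewrite ![[disjoint _ & rws A]]disjoint_sym h1.
  apply: disjointWl h6 _; rewrite -setI_eq0 setIUl setU_eq0 !setI_eq0.
  by rewrite ![[disjoint _ & cls A]]disjoint_sym h2.
have [sPs sQt] := (matching_sepD ms Ps, matching_sepD mt Qt).
have [s0P s0Q] := (rsep _ s0 sPs sPt rs0U cs0U, rsep _ s0 sQs sQt rs0U cs0U).
have [t0P t0Q] := (rsep _ t0 sPs sPt rt0U ct0U, rsep _ t0 sQs sQt rt0U ct0U).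
have rsub : (rws s0 :|: rws t0) :|: (rws P :|: rws Q) \subset rws s :|: rws t.
  rewrite [X in _ \subset rws X :|: _](setDUK Ps).
  by rewrite [X in _ \subset _ :|: rws X](setDUK Qt) !rwsU [(_ :|: rws P) :|: (_ :|: _)]setUACA setSU.
have toteq (a : I * J -> R) : \sum_(p in s0) a p + \sum_(p in t0) a p +
    (\sum_(p in P) a p + \sum_(p in Q) a p) =
    \sum_(p in s) a p + \sum_(p in t) a p.
  by rewrite (sum_setD a Ps) (sum_setD a Qt) tot addrACA.
have wsE : w \notin cls s by rewrite [s](setDUK Ps) clsU inE negb_or ws0 -cQ.
have csE : w |: cls s = w |: (cls (s :\: P) :|: cls P).
  by rewrite -clsU -(setDUK Ps).
have ctE : cls t = w |: (cls t0 :|: cls Q).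
  by rewrite (setDUK Qt) clsU ct0 setUA.
split; split.
- by split; apply: matchingU.
- by rewrite clsU cs0 csE setUA.
- by rewrite clsU inE negb_or wt0.
- by rewrite !rwsU setUACA.
- by move=> a; rewrite !sum_sep // addrACA toteq.
- by split; apply: matchingU.
- by rewrite clsU cs0 csE cQ setUA.
- by rewrite clsU inE negb_or wt0 -cQ.
- by rewrite !rwsU setUACA [X in _ :|: X]setUC.
- by move=> a; rewrite !sum_sep // addrACA [X in _ + X]addrC toteq.
Qed.

Lemma card_component s t P Q : P \subset s -> Q \subset t ->
  matching s -> matching t -> cls Q = cls P ->
  (#|s| < #|t|)%N = (#|s :\: P| < #|t :\: Q|)%N.
Proof.
move=> Ps Qt ms mt cQ.
have PQc : #|P| = #|Q|.
  by rewrite -(card_cls (matching_sub Ps ms)) -(card_cls (matching_sub Qt mt)) cQ.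
by rewrite -[#|s|](cardsID P) -[#|t|](cardsID Q) !(setIidPr _) // PQc ltn_add2l.
Qed.

(** Some row is met by [t] only. Its alternating path either augments, or has as many edges in [s]
    as in [t]; in the latter case removing it preserves the strict inequality and the induction on
    [#|t|] proceeds. *)
Lemma augmenting_path s t : matching s -> matching t -> (#|s| < #|t|)%N ->
  exists s' t' w, augments s t s' t' w.
Proof.
have [n] := ubnP #|t|; elim: n s t => // n IH s t + ms mt.
rewrite ltnS => tn st.
have [v vt vs] : exists2 v, v \in rws t & v \notin rws s.
  apply/subsetPn; apply: contraL st => /subset_leq_card.
  by rewrite !card_rws // -leqNgt.
have [P [Q [Ps Qt [sPt sQs] vQ]]] := alternating_path ms mt vt vs.
case=> [[w [ws rQ cQ]]|[w [wP wt cQ rPQ]]].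
  by exists (s :\: P :|: Q), (t :\: Q :|: P), w; apply: (@flip_augments _ _ v).
have ms1 := matching_sub (subsetDl s P) ms.
have mt1 := matching_sub (subsetDl t Q) mt.
have tD : (#|t :\: Q| < n)%N.
  apply: leq_trans tn; apply: proper_card.
  rewrite properE subsetDl /=; case/rwsP: vQ => d vdQ.
  by apply/subsetPn; exists (v, d); rewrite ?(subsetP Qt) // inE vdQ.
have stD := st; rewrite (card_component Ps Qt ms mt cQ) in stD.
have [s' [t' [w' aug]]] := IH _ _ tD ms1 mt1 stD.
exists (s' :|: P), (t' :|: Q), w'.
by case: (augments_component Ps Qt ms mt sPt sQs cQ aug).
Qed.

(* The path through [i] is flipped together with an augmenting path disjoint
   from it when it does not augment by itself. *)
Lemma augmenting_path_avoiding s t i : matching s -> matching t ->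
  (#|s| < #|t|)%N -> i \notin rws s ->
  exists s' t' w, augments s t s' t' w /\ i \notin rws t'.
Proof.
move=> ms mt st is_.
have [it|it] := boolP (i \in rws t); last first.
  have [s' [t' [w aug]]] := augmenting_path ms mt st.
  exists s', t', w; split=> //; case: aug => _ _ _ /subsetP rst _.
  apply/negP => h; move: (rst i); rewrite !inE h orbT (negPf is_) (negPf it).
  by move=> /(_ isT).
have [P [Q [Ps Qt [sPt sQs] vQ]]] := alternating_path ms mt it is_.
have iP : i \notin rws P by apply: contra is_; apply/subsetP/rws_sub.
have itQ : i \notin rws (t :\: Q).
  by case/andP: (matching_sepD mt Qt) => /pred0P/(_ i) /=; rewrite vQ => /negbT.
case=> [[w [ws rQ cQ]]|[w [wP wt cQ rPQ]]].
  exists (s :\: P :|: Q), (t :\: Q :|: P), w; split.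
    by apply: (@flip_augments _ _ i).
  by rewrite rwsU inE negb_or itQ.
have ms1 := matching_sub (subsetDl s P) ms.
have mt1 := matching_sub (subsetDl t Q) mt.
have stD := st; rewrite (card_component Ps Qt ms mt cQ) in stD.
have [s' [t' [w' aug]]] := augmenting_path ms1 mt1 stD.
exists (s' :|: Q), (t' :|: P), w'; split.
  by case: (augments_component Ps Qt ms mt sPt sQs cQ aug).
rewrite rwsU inE negb_or iP andbT; apply/negP => h.
case: aug => _ _ _ /subsetP rst _.
move: (rst i); rewrite !inE h orbT (negPf itQ) orbF => /(_ isT) h'.
by case/negP: is_; apply: subsetP h'; apply/rws_sub/subsetDl.
Qed.

End Augmentation.

Section ColumnExchange.
Variables (R : nmodType) (I J : finType).
Implicit Types (s t P Q : {set I * J}).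

Definition transpose (K L : finType) (S : {set K * L}) : {set L * K} :=
  [set (p.2, p.1) | p in S].

Lemma mem_transpose (K L : finType) (S : {set K * L}) x y :
  ((x, y) \in transpose S) = ((y, x) \in S).
Proof.
apply/imsetP/idP => [[[a b] h [-> ->]] //|h]; by exists (y, x).
Qed.

Lemma transposeK (K L : finType) : cancel (@transpose K L) (@transpose L K).
Proof. by move=> S; apply/setP => -[x y]; rewrite !mem_transpose. Qed.

Lemma rws_transpose (K L : finType) (S : {set K * L}) : rws (transpose S) = cls S.
Proof. by rewrite /rws /transpose -imset_comp. Qed.

Lemma cls_transpose (K L : finType) (S : {set K * L}) : cls (transpose S) = rws S.
Proof. by rewrite /cls /transpose -imset_comp. Qed.

Lemma matching_transpose (K L : finType) (S : {set K * L}) :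
  matching S -> matching (transpose S).
Proof.
move=> /matchingP mS; apply/matchingP => -[a b] [a' b'].
rewrite !mem_transpose /= => h h' e.
by have [-> ->] : (b, a) = (b', a') by apply: mS => //=; case: e; [right|left].
Qed.

Lemma transposeD (K L : finType) (S T : {set K * L}) :
  transpose (S :\: T) = transpose S :\: transpose T.
Proof. by apply/setP => -[x y]; rewrite !(mem_transpose, inE). Qed.

(** The path is now started from a column, which the transposes reduce to [alternating_path]. The
    last disjunction records its two ends: a row met by [t] only, where one entry moves from [t] to
    [s], or a column met by [s] only, where the sizes stay. *)
Lemma column_exchange s t e : matching s -> matching t ->
  e \in cls t -> e \notin cls s ->
  exists s' t', [/\ matching s' /\ matching t', @same_total R _ _ s t s' t',
    e \in cls s', rws t' \subset rws t /\ rws s' \subset rws s :|: rws t &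
    (#|s'| = #|s|.+1 /\ #|t| = #|t'|.+1) \/ (#|s'| = #|s| /\ #|t'| = #|t|)].
Proof.
move=> ms mt et es.
have et' : e \in rws (transpose t) by rewrite rws_transpose.
have es' : e \notin rws (transpose s) by rewrite rws_transpose.
have [P' [Q' [P's Q't [sPt' sQs'] eQ']]] :=
  alternating_path (matching_transpose ms) (matching_transpose mt) et' es'.
have [[P P'E] [Q Q'E]] : (exists P, P' = transpose P) /\ (exists Q, Q' = transpose Q).
  by split; [exists (transpose P')|exists (transpose Q')]; rewrite transposeK.
have Ps : P \subset s.
  by apply/subsetP => -[x y]; rewrite -mem_transpose -P'E => /(subsetP P's); rewrite mem_transpose.
have Qt : Q \subset t.
  by apply/subsetP => -[x y]; rewrite -mem_transpose -Q'E => /(subsetP Q't); rewrite mem_transpose.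
have sPt : sep P (t :\: Q).
  by move: sPt'; rewrite P'E Q'E -transposeD /sep !rws_transpose !cls_transpose andbC.
have sQs : sep Q (s :\: P).
  by move: sQs'; rewrite P'E Q'E -transposeD /sep !rws_transpose !cls_transpose andbC.
have eQ : e \in cls Q by rewrite -rws_transpose -Q'E.
have mP := matching_sub Ps ms; have mQ := matching_sub Qt mt.
have sDP : sep (s :\: P) P by rewrite sep_sym matching_sepD.
have sDQ : sep (t :\: Q) Q by rewrite sep_sym matching_sepD.
have sQ' : sep (s :\: P) Q by rewrite sep_sym.
have sP' : sep (t :\: Q) P by rewrite sep_sym.
move=> cases; exists (s :\: P :|: Q), (t :\: Q :|: P); split.
- by split; apply: flip_matching; eassumption.
- exact: flip_same_total.
- by rewrite clsU inE eQ orbT.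
- split; last first.
    by rewrite rwsU; apply: setUSS; apply: rws_sub => //; exact: subsetDl.
  rewrite rwsU subUset (rws_sub (subsetDl _ _)) /=.
  apply: subset_trans (rws_sub Qt).
  case: cases => [[w [_ _]]|[w [_ _]]]; rewrite P'E Q'E !cls_transpose => ->//.
  exact: subsetUr.
- have [cs ct] : #|s| = (#|s :\: P| + #|P|)%N /\ #|t| = (#|t :\: Q| + #|Q|)%N.
    by rewrite {1}(setDUK Ps) {1}(setDUK Qt) !cardsU_sep.
  rewrite !cardsU_sep // cs ct.
  case: cases => [[w [ws _]]|[w [_ _]]]; rewrite P'E Q'E !cls_transpose.
    move=> h; left.
    have -> : #|Q| = #|P|.+1.
      rewrite -!card_rws // h cardsU1; case: (boolP (w \in _)) => //= wP.
      by case/negP: ws; rewrite cls_transpose; apply: subsetP wP; apply: rws_sub.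
    by rewrite !addnS.
  by move=> h _; right; rewrite -(card_rws mQ) h card_rws.
Qed.

End ColumnExchange.

(** * The matroid of covers *)

Section CoverRank.
Variables (I J : finType) (Z : {set I * J}) (Q : {set I}).
Implicit Types (W U : {set I}) (Y B : {set J}).

Definition cover_size Y W : nat := (#|Q :\: W| + #|Y :|: nbr Z W|)%N.

(* The least number of files, including the columns [Y], in a cover of the
   zeros in the rows [Q]; [W] is the set of rows left out of the cover. *)
Definition rk Y : nat :=
  cover_size Y [arg min_(W < set0 | W \subset Q) cover_size Y W].

Lemma rk_le Y W : W \subset Q -> (rk Y <= #|Q :\: W| + #|Y :|: nbr Z W|)%N.
Proof. by rewrite /rk; case: arg_minnP => [|W' _ h WQ]; [exact: sub0set|exact: h]. Qed.

Lemma rk_attained Y :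
  exists2 W : {set I}, W \subset Q & rk Y = (#|Q :\: W| + #|Y :|: nbr Z W|)%N.
Proof. by rewrite /rk; case: arg_minnP => [|W' WQ _]; [exact: sub0set|exists W']. Qed.

Lemma rkS Y Y' : Y \subset Y' -> (rk Y <= rk Y')%N.
Proof.
move=> YY'; have [W WQ ->] := rk_attained Y'; apply: leq_trans (rk_le Y WQ) _.
by rewrite leq_add2l subset_leq_card // setSU.
Qed.

Lemma rk_setU1 d Y : (rk (d |: Y) <= (rk Y).+1)%N.
Proof.
have [W WQ ->] := rk_attained Y; apply: leq_trans (rk_le _ WQ) _.
rewrite -addnS leq_add2l -setUA cardsU1 -add1n leq_add2r.
by case: (_ \notin _).
Qed.

(** Two optimal covers recombine: leaving out the rows [W :|: W'] serves [Y :|: Y'], and leaving out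
    [W :&: W'] serves [Y :&: Y']. *)
Lemma rk_submod Y Y' : (rk (Y :|: Y') + rk (Y :&: Y') <= rk Y + rk Y')%N.
Proof.
have [W WQ ->] := rk_attained Y; have [W' W'Q ->] := rk_attained Y'.
have h1 : (rk (Y :|: Y') <= _)%N :=
  @rk_le (Y :|: Y') (W :|: W') (etrans (subUset _ _ _) (introT andP (conj WQ W'Q))).
have h2 := @rk_le (Y :&: Y') (W :&: W') (subset_trans (subsetIl _ _) WQ).
apply: leq_trans (leq_add h1 h2) _.
rewrite nbrU setUACA setDUr setDIr addnACA [X in (_ <= X)%N]addnACA leq_add //.
  by rewrite addnC cardsUI.
rewrite -[X in (_ <= X)%N]cardsUI leq_add2l subset_leq_card //.
rewrite subsetI; apply/andP; split; apply: setUSS;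
  by rewrite ?nbrS ?subsetIl ?subsetIr.
Qed.

Lemma rk_setU1_local Y Y' d : Y \subset Y' -> d \notin Y' ->
  (rk (d |: Y') + rk Y <= rk Y' + rk (d |: Y))%N.
Proof.
move=> YY' dY'; have := rk_submod (d |: Y) Y'.
rewrite -setUA (setUidPr YY') setIUl (setIidPl YY').
suff -> : [set d] :&: Y' = set0 by rewrite set0U [X in (_ <= X)%N]addnC.
by apply/setP => x; rewrite !inE; case: eqP => // ->; rewrite (negPf dY').
Qed.

Definition cl Y : {set J} := [set d | rk (d |: Y) == rk Y].

Definition flat B : bool := [forall d, (d \notin B) ==> (rk (d |: B) == (rk B).+1)].

Lemma flatP B : reflect (forall d, d \notin B -> rk (d |: B) = (rk B).+1) (flat B).
Proof.
apply: (iffP forallP) => h d; last by apply/implyP => /h ->.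
by move=> dB; move/implyP: (h d) => /(_ dB)/eqP.
Qed.

Lemma sub_cl Y : Y \subset cl Y.
Proof. by apply/subsetP => d dY; rewrite inE setUC (setUidPl _) ?sub1set. Qed.

Lemma cl_sub Y Y' : Y \subset Y' -> cl Y \subset cl Y'.
Proof.
move=> YY'; apply/subsetP => d; rewrite !inE => /eqP e.
have [dY'|dY'] := boolP (d \in Y'); first by rewrite setUC (setUidPl _) ?sub1set.
have := rk_setU1_local YY' dY'; rewrite e leq_add2r => h.
by rewrite eqn_leq h rkS // subsetUr.
Qed.

Lemma rk_cl Y : rk (cl Y) = rk Y.
Proof.
have key (S : {set J}) : S \subset cl Y -> rk (Y :|: S) = rk Y.
  have [n] := ubnP #|S|; elim: n S => // n IH S Sn SY.
  have [->|[d dS]] := set_0Vmem S; first by rewrite setU0.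
  have Sd : (#|S :\ d| < n)%N by move: Sn; rewrite (cardsD1 d S) dS.
  have Sdc : S :\ d \subset cl Y by apply: subset_trans (subD1set _ _) SY.
  have -> : Y :|: S = d |: (Y :|: S :\ d) by rewrite setUCA setD1K.
  have := IH _ Sd Sdc; set T := Y :|: _ => rT.
  have [dT|dT] := boolP (d \in T); first by rewrite setUC (setUidPl _) ?sub1set.
  have := @rk_setU1_local Y T d (subsetUl _ _) dT.
  move/subsetP/(_ _ dS): SY; rewrite inE => /eqP ->; rewrite leq_add2r => h.
  by apply/eqP; rewrite -{1}rT eqn_leq h rkS // subsetUr.
by rewrite -(key _ (subxx _)) (setUidPr (sub_cl _)).
Qed.

Lemma flat_cl Y : flat (cl Y).
Proof.
apply/flatP => d; rewrite inE => dY; apply/eqP; rewrite eqn_leq rk_setU1 rk_cl.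
rewrite /= ltn_neqAle eq_sym; apply/andP; split; last first.
  exact: rkS (subset_trans (sub_cl Y) (subsetUr _ _)).
apply: contra dY => /eqP h; rewrite eqn_leq [X in _ && X]rkS ?subsetUr // andbT.
by rewrite -h rkS // setUS // sub_cl.
Qed.

Lemma eq_cl Y Y' : Y \subset Y' -> Y' \subset cl Y -> cl Y' = cl Y.
Proof.
move=> YY' Y'c.
have e : rk Y' = rk Y.
  by apply/eqP; rewrite eqn_leq (rkS YY') andbT -(rk_cl Y) rkS.
apply/eqP; rewrite eqEsubset (cl_sub YY') andbT.
apply/subsetP => d; rewrite !inE e => /eqP h.
by rewrite eqn_leq -{1}h (rkS (setUS _ YY')) (rkS (subsetUr _ _)).
Qed.

Lemma cl_id B : flat B -> cl B = B.
Proof.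
move=> /flatP fB; apply/eqP; rewrite eqEsubset sub_cl andbT.
by apply/subsetP => d; rewrite inE; apply: contraTT => /fB ->; rewrite eqn_leq ltnn.
Qed.

Lemma cl_setU1_in Y c : c \in cl Y -> cl (c |: Y) = cl Y.
Proof.
by move=> cY; apply: eq_cl; rewrite ?subsetUr // subUset sub1set cY sub_cl.
Qed.

Lemma cl_setU1_cl Y c : cl (c |: cl Y) = cl (c |: Y).
Proof.
apply: eq_cl; first by rewrite setUS // sub_cl.
rewrite subUset sub1set cl_sub ?subsetUr // andbT.
by apply: (subsetP (sub_cl _)); rewrite setU11.
Qed.

Lemma rk_cl_setU1 B d : flat B -> d \notin B -> rk (cl (d |: B)) = (rk B).+1.
Proof. by move=> /flatP fB /fB <-; rewrite rk_cl. Qed.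

(** These rows must belong to any cover whose columns are just [B]. For a flat [B] this cover is a
    minimum one, by [flat_rk]. *)
Definition outer_rows B : {set I} := [set i in Q | ~~ (nbr Z [set i] \subset B)].

Lemma outer_rowsP B i :
  reflect (i \in Q /\ exists2 d, d \notin B & (i, d) \in Z) (i \in outer_rows B).
Proof.
rewrite inE; apply: (iffP andP) => -[iQ h]; split => //.
  by case/subsetPn : h => d /nbrP[j /set1P->]; exists d.
case: h => d dB h; apply/subsetPn; exists d => //; apply/nbrP.
by exists i; rewrite ?set11.
Qed.

Lemma outer_rows_sub B : outer_rows B \subset Q.
Proof. by apply/subsetP => i; rewrite inE => /andP[]. Qed.

Lemma outer_rowsS B B' : B \subset B' -> outer_rows B' \subset outer_rows B.
Proof.
move=> /subsetP BB'; apply/subsetP => i /outer_rowsP[iQ [d dB h]].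
by apply/outer_rowsP; split => //; exists d => //; apply: contra dB; apply: BB'.
Qed.

(** A minimum cover has no column outside [B]: such a column could be added to [B] without raising
    the rank, against flatness. Its rows are then forced to contain the outer ones. *)
Lemma flat_rk B : flat B -> rk B = (#|B| + #|outer_rows B|)%N.
Proof.
move=> /flatP fB; have [W WQ rB] := rk_attained B.
have nWB : nbr Z W \subset B.
  apply/subsetP => d dW; apply: contraT => /fB h.
  have := rk_le (d |: B) WQ; rewrite h -setUA setUCA [d |: _](setUidPr _) ?sub1set //.
  by rewrite rB ltnn.
apply/eqP; rewrite eqn_leq; apply/andP; split.
  apply: leq_trans (rk_le B (subsetDl Q (outer_rows B))) _.
  rewrite setDDr setDv set0U (setIidPr (outer_rows_sub B)) addnC leq_add2r.
  rewrite (setUidPl _) //; apply/subsetP => d /nbrP[i]; rewrite inE => /andP[iU iQ] h.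
  by apply: contraR iU => dB; apply/outer_rowsP; split=> //; exists d.
rewrite rB (setUidPl nWB) addnC leq_add2r subset_leq_card //.
apply/subsetP => i /outer_rowsP[iQ [d dB h]]; rewrite inE iQ andbT.
apply: contra dB => iW; apply: (subsetP nWB); apply/nbrP; by exists i.
Qed.

(** Hall's condition comes from [rk (e |: B) = (rk B).+1]. If a set [W] of outer rows had fewer than
    [#|W|] neighbours off [e |: B], trading [W] for these neighbours would give a cover with the
    columns [e |: B] and at most [rk B] files. The spare column [e] leaves room for one more entry
    in the assignments below. *)
Lemma flat_matching B e : flat B -> e \notin B ->
  exists s, [/\ matching s, s \subset Z, rws s = outer_rows B &
    [disjoint e |: B & cls s]].
Proof.
move=> fB eB.
suff [s [ms /matching_del_cols[sZ sd] rs]] : exists s,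
    [/\ matching s, s \subset del_cols Z (e |: B) & rws s = outer_rows B].
  by exists s.
apply: hall_marriage => W WU.
rewrite nbr_del_cols -(leq_add2r (#|e |: B|)) -cardsUD cardsU1 eB add1n addnS.
have := rk_le (e |: B) (subsetDl Q (outer_rows B :\: W)).
move/flatP: (fB) => ->//; rewrite flat_rk // setDDr setDv set0U.
rewrite (setIidPr (subset_trans (subsetDl _ _) (outer_rows_sub B))).
rewrite cardsD (setIidPr WU) => h.
have {h} : (#|B| + #|outer_rows B| < #|outer_rows B| - #|W| +
    #|nbr Z W :|: (e |: B)|)%N.
  apply: leq_trans h _; rewrite leq_add2l; apply: subset_leq_card.
  apply/subsetP => d; rewrite !in_setU => /orP[->|/nbrP[i]]; first by rewrite orbT.
  rewrite in_setD => /andP[iUW iQ] h; case: (boolP (d \in B)) => dB; first by rewrite !orbT.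
  have iU : i \in outer_rows B by apply/outer_rowsP; split=> //; exists d.
  move: iUW; rewrite in_setD iU andbT negbK => iW.
  by apply/orP; left; apply/nbrP; exists i.
rewrite cardsUD cardsU1 eB add1n.
have := subset_leq_card WU; move: #|W| #|outer_rows B| #|B| #|_ :\: _| => *; lia.
Qed.

End CoverRank.

Section ZeroClosure.
Variables (I J : finType) (Z : {set I * J}) (Q : {set I}).

(** Hall's theorem on the side of the columns. If columns [W] of the closure had too few neighbours
    [N] among the rows that are not outer, replacing [W] by [N] in the cover of [flat_rk] would
    cover all zeros with fewer than [rk set0] files. *)
Lemma cl0_matching : exists s : {set I * J}, [/\ matching s, s \subset Z,
  cls s = cl Z Q set0 & rws s \subset Q :\: outer_rows Z Q (cl Z Q set0)].
Proof.
set B := cl Z Q set0; set U := outer_rows Z Q B.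
pose G : {set J * I} := [set p | ((p.2, p.1) \in Z) && (p.2 \in Q :\: U)].
suff [s [ms sG rs]] : exists s : {set J * I},
    [/\ matching s, s \subset G & rws s = B].
  exists (transpose s); split.
  - exact: matching_transpose.
  - apply/subsetP => -[i d]; rewrite mem_transpose => /(subsetP sG).
    by rewrite inE => /andP[].
  - by rewrite cls_transpose.
  - rewrite rws_transpose; apply/subsetP => i /clsP[d] /(subsetP sG).
    by rewrite inE => /andP[].
apply: hall_marriage => W WB.
set N := nbr G W.
have NU : N \subset Q :\: U.
  by apply/subsetP => i /nbrP[d _]; rewrite inE => /andP[].
have fB : flat Z Q B := flat_cl Z Q set0.
have UQ : U \subset Q := outer_rows_sub _ _ _.
have UNQ : U :|: N \subset Q.
  by rewrite subUset UQ (subset_trans NU (subsetDl _ _)).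
have := rk_le Z set0 (subsetDl Q (U :|: N)).
rewrite -(rk_cl Z Q set0) -/B flat_rk // -/U setDDr setDv set0U (setIidPr UNQ) set0U.
have UN : (#|U :|: N| <= #|U| + #|N|)%N by rewrite cardsU leq_subr.
have nB : nbr Z (Q :\: (U :|: N)) \subset B :\: W.
  apply/subsetP => d /nbrP[i]; rewrite !in_setD in_setU negb_or -andbA => /and3P[iU iN iQ] h.
  apply/andP; split; last first.
    by apply: contraR iU => dB; apply/outer_rowsP; split=> //; exists d.
  apply: contra iN => dW; apply/nbrP; exists d => //.
  by rewrite inE /= h in_setD iU.
have := subset_leq_card nB; rewrite cardsD (setIidPr WB).
have := subset_leq_card WB; move: UN.
by move: #|U :|: N| #|U| #|N| #|W| #|B| #|_| => *; lia.
Qed.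

End ZeroClosure.

(** * Optimal assignments *)

Section MinimumCost.
Variables (R : realFieldType) (I J : finType).
Implicit Types (a : I * J -> R) (S T : {set I * J}) (X : {set I}) (Y : {set J}).

Definition total a S : R := \sum_(p in S) a p.

Definition adm k X Y S : bool :=
  [&& matching S, #|S| == k, rws S \subset X & cls S \subset Y].

Lemma admP k X Y S : reflect
  [/\ matching S, #|S| = k, rws S \subset X & cls S \subset Y] (adm k X Y S).
Proof.
apply: (iffP and4P) => [[? /eqP ? ? ?]|[? /eqP ? ? ?]]; by split.
Qed.

Lemma adm_exists k X Y : (k <= #|X|)%N -> (k <= #|Y|)%N -> exists S, adm k X Y S.
Proof.
move=> kX kY.
have [X' [X'X X'k]] : exists X' : {set I}, X' \subset X /\ #|X'| = k.
  exists [set x in take k (enum X)]; split.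
    by apply/subsetP => x; rewrite inE => /mem_take; rewrite mem_enum.
  rewrite cardsE (card_uniqP _) ?take_uniq ?enum_uniq //.
  by rewrite size_take -cardE; case: ltnP => // h; apply/eqP; rewrite eqn_leq h.
have [W WX'|S [mS SG rS]] := @hall_marriage I J (setX X' Y) X'.
  have [->|[i iW]] := set_0Vmem W; first by rewrite cards0.
  rewrite (leq_trans (subset_leq_card WX')) // X'k (leq_trans kY) // subset_leq_card //.
  by apply/subsetP => d dY; apply/nbrP; exists i; rewrite // inE (subsetP WX').
exists S; apply/admP; split; rewrite ?rS //; first by rewrite -card_rws // rS.
by apply/subsetP => d /clsP[i /(subsetP SG)]; rewrite inE => /andP[].
Qed.

(* [0] when there is no such assignment. *)
Definition vmin a k X Y : R :=
  \big[Num.min/total a (odflt set0 [pick S | adm k X Y S])]_(S | adm k X Y S) total a S.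

Lemma vmin_le a k X Y S : adm k X Y S -> vmin a k X Y <= total a S.
Proof. exact: bigmin_le_cond. Qed.

Lemma vmin_attained a k X Y : (k <= #|X|)%N -> (k <= #|Y|)%N ->
  exists2 S, adm k X Y S & total a S = vmin a k X Y.
Proof.
move=> kX kY; have [S0 aS0] := adm_exists kX kY.
rewrite /vmin; elim/big_rec: _ => [|S x aS [T aT <-]].
  by case: pickP => [S aS|/(_ S0)]; [exists S|rewrite aS0].
by rewrite minEle; case: ifP => _; [exists S|exists T].
Qed.

Lemma admS k X X' Y Y' S : X \subset X' -> Y \subset Y' -> adm k X Y S -> adm k X' Y' S.
Proof.
move=> XX' YY' /admP[mS cS rS lS]; apply/admP; split=> //.
  exact: subset_trans XX'.
exact: subset_trans YY'.
Qed.

Lemma le_vminS a k X X' Y Y' : X \subset X' -> Y \subset Y' ->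
  (k <= #|X|)%N -> (k <= #|Y|)%N -> vmin a k X' Y' <= vmin a k X Y.
Proof.
move=> XX' YY' kX kY; have [S aS <-] := vmin_attained a kX kY.
exact/vmin_le/(admS XX' YY').
Qed.

Lemma le_total a S T : (forall p, 0 <= a p) -> S \subset T -> total a S <= total a T.
Proof.
move=> a0 ST; rewrite /total [X in _ <= X](big_setID S) /= (setIidPr ST).
by rewrite lerDl sumr_ge0.
Qed.

Lemma total_ge0 a S : (forall p, 0 <= a p) -> 0 <= total a S.
Proof. by move=> a0; apply: sumr_ge0. Qed.

Lemma del_rows X0 k X Y S : adm k X Y S ->
  exists T, [/\ T \subset S /\ rws (S :\: T) \subset X0,
   rws T \subset X :\: X0, cls T \subset Y,
   matching T & (k - #|X0| <= #|T|)%N].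
Proof.
case/admP=> mS cS rS lS.
exists [set p in S | p.1 \notin X0].
have TS : [set p in S | p.1 \notin X0] \subset S.
  by apply/subsetP => p; rewrite inE => /andP[].
have mT := matching_sub TS mS.
have mD := matching_sub (subsetDl S [set p in S | p.1 \notin X0]) mS.
have rD : rws (S :\: [set p in S | p.1 \notin X0]) \subset X0.
  apply/subsetP => i /rwsP[d].
  by rewrite !inE /=; case: (_ \in S); rewrite ?andbF //= andbT negbK.
split=> //.
- apply/subsetP => i /rwsP[d]; rewrite !inE /= => /andP[h ->].
  by apply: (subsetP rS); apply/rwsP; exists d.
- exact: subset_trans (cls_sub TS) lS.
rewrite -cS -(cardsID [set p in S | p.1 \notin X0] S) (setIidPr TS).
rewrite leq_subLR [X in (_ <= X)%N]addnC leq_add2l.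
by rewrite -(card_rws mD) subset_leq_card.
Qed.

Lemma adm_shrink k X Y T : (k <= #|T|)%N -> matching T ->
  rws T \subset X -> cls T \subset Y -> exists2 S : {set I * J}, S \subset T & adm k X Y S.
Proof.
move=> kT mT rT lT.
have sub : [set x in take k (enum T)] \subset T.
  by apply/subsetP => x; rewrite inE => /mem_take; rewrite mem_enum.
exists [set x in take k (enum T)] => //; apply/admP; split.
- exact: matching_sub sub mT.
- rewrite cardsE (card_uniqP _) ?take_uniq ?enum_uniq //.
  by rewrite size_take -cardE; case: ltnP => // h; apply/eqP; rewrite eqn_leq h.
- exact: subset_trans (rws_sub sub) rT.
- exact: subset_trans (cls_sub sub) lT.
Qed.

Lemma vmin_del_rows a X0 k X Y : (forall p, 0 <= a p) ->
  (k <= #|X|)%N -> (k <= #|Y|)%N ->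
  vmin a (k - #|X0|)%N (X :\: X0) Y <= vmin a k X Y.
Proof.
move=> a0 kX kY; have [S aS <-] := vmin_attained a kX kY.
have [T [[TS _] rT lT mT cT]] := del_rows X0 aS.
have [T' T'T aT'] := adm_shrink cT mT rT lT.
exact: le_trans (vmin_le a aT') (le_total a0 (subset_trans T'T TS)).
Qed.

Lemma vmin0 a X Y : vmin a 0 X Y = 0.
Proof.
have [S /admP[_ /eqP]] := @vmin_attained a 0 X Y isT isT.
by rewrite cards_eq0 => /eqP-> _ _ <-; rewrite /total big_set0.
Qed.

Lemma vmin_ge0 a k X Y : (forall p, 0 <= a p) -> 0 <= vmin a k X Y.
Proof.
move=> a0; rewrite /vmin; apply/bigmin_geP.
by split=> [|S _]; apply: total_ge0.
Qed.

Lemma eq_vmin a a' k X Y : (forall i d, i \in X -> d \in Y -> a (i, d) = a' (i, d)) ->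
  (k <= #|X|)%N -> (k <= #|Y|)%N -> vmin a k X Y = vmin a' k X Y.
Proof.
move=> aa' kX kY.
have key b b' : (forall i d, i \in X -> d \in Y -> b (i, d) = b' (i, d)) ->
    vmin b k X Y <= vmin b' k X Y.
  move=> bb'; have [S aS <-] := vmin_attained b' kX kY.
  apply: le_trans (vmin_le b aS) _; case/admP: aS => _ _ rS lS.
  rewrite /total le_eqVlt (eq_bigr b') ?eqxx // => -[i d] h.
  apply: bb'; [apply: (subsetP rS); apply/rwsP; by exists d|].
  by apply: (subsetP lS); apply/clsP; exists i.
by apply/eqP; rewrite eq_le !key // => i d iX dY; rewrite aa'.
Qed.

Lemma total_setU1 a p S : p \notin S -> total a (p |: S) = a p + total a S.
Proof. by move=> pS; rewrite /total big_setU1. Qed.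

Lemma adm_setU1 k X Y i d S : adm k X Y S -> i \notin X -> d \notin Y ->
  adm k.+1 (i |: X) (d |: Y) ((i, d) |: S).
Proof.
case/admP=> mS cS rS lS iX dY.
have iS : i \notin rws S by apply: contra iX; apply/subsetP.
have dS : d \notin cls S by apply: contra dY; apply/subsetP.
have sS : sep [set (i, d)] S by rewrite sep1 iS dS.
apply/admP; split.
- by apply: matchingU => //; exact: matching1.
- by rewrite cardsU_sep // cards1 cS.
- by rewrite rwsU rws1 setUS.
- by rewrite clsU cls1 setUS.
Qed.

Lemma adm_sep k k' X X' Y Y' S T : adm k X Y S -> adm k' X' Y' T ->
  [disjoint X & X'] -> [disjoint Y & Y'] ->
  adm (k + k')%N (X :|: X') (Y :|: Y') (S :|: T) /\
  forall a, total a (S :|: T) = total a S + total a T.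
Proof.
case/admP=> mS cS rS lS /admP[mT cT rT lT] dX dY.
have sST : sep S T.
  apply/andP; split; first exact: disjointWl rS (disjointWr rT dX).
  exact: disjointWl lS (disjointWr lT dY).
split; last by move=> a; exact: sum_sep.
apply/admP; split.
- exact: matchingU.
- by rewrite cardsU_sep // cS cT.
- by rewrite rwsU setUSS.
- by rewrite clsU setUSS.
Qed.

(* A (k+2)-assignment and a k-assignment avoiding the row [i] are exchanged into
   two (k+1)-assignments, one of which avoids [i]. *)
Lemma vmin_exchange a k X Y i : i \in X -> (k.+2 <= #|X|)%N -> (k.+2 <= #|Y|)%N ->
  vmin a k.+1 (X :\ i) Y + vmin a k.+1 X Y <= vmin a k (X :\ i) Y + vmin a k.+2 X Y.
Proof.
move=> iX kX kY.
have kXi : (k.+1 <= #|X :\ i|)%N by move: kX; rewrite (cardsD1 i X) iX.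
have [S aS eS] := vmin_attained a (ltnW kXi) (ltnW (ltnW kY)).
have [T aT eT] := vmin_attained a kX kY.
case/admP: aS => mS cS rS lS; case/admP: aT => mT cT rT lT.
have iS : i \notin rws S.
  by apply/negP => /(subsetP rS); rewrite !inE eqxx.
have [|S' [T' [w [[[mS' mT'] [wS cS'] [wT cT'] rST tot] iT']]]] :=
    augmenting_path_avoiding R mS mT _ iS; first by rewrite cS cT.
have rSTX : rws S :|: rws T \subset X.
  by rewrite subUset rT (subset_trans rS (subD1set _ _)).
have /andP[rS'X rT'X] : (rws S' \subset X) && (rws T' \subset X).
  by rewrite -subUset (subset_trans rST).
rewrite -eS -eT /total -(tot a) addrC lerD //; apply: vmin_le; apply/admP; split=> //.
- by rewrite -card_cls // cS' cardsU1 wS card_cls // cS.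
- rewrite cS' subUset lS andbT sub1set; apply: (subsetP lT).
  by rewrite cT' setU11.
- apply/eqP; rewrite -eqSS -cT -(card_cls mT) cT' cardsU1 wT add1n card_cls //.
- by rewrite subsetD1 rT'X.
- by rewrite (subset_trans _ lT) // cT' subsetUr.
Qed.

End MinimumCost.

(** * Costs at a settled flat *)

Section Stage.
Variables (R : realFieldType) (I J : finType).
Variables (Z : {set I * J}) (Q : {set I}) (B : {set J}).
Implicit Types (a : I * J -> R) (S T : {set I * J}).

Definition zeros_exactly a : bool :=
  [forall p, if p \in Z then a p == 0 else 0 < a p].

Lemma zeros_exactlyP a : reflect
  ((forall p, p \in Z -> a p = 0) /\ (forall p, p \notin Z -> 0 < a p))
  (zeros_exactly a).
Proof.
apply: (iffP forallP) => [h|[h0 h1] p].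
  by split=> p pZ; move: (h p); rewrite ?pZ ?(negPf pZ) // => /eqP.
by case: ifPn => pZ; [rewrite h0|rewrite h1].
Qed.

Lemma zeros_exactly_ge0 a : zeros_exactly a -> forall p, 0 <= a p.
Proof.
by move=> /zeros_exactlyP[h0 h1] p; case: (boolP (p \in Z)) => [/h0->|/h1/ltW].
Qed.

Local Notation U := (outer_rows Z Q B).
Local Notation L := (Q :\: U).
Local Notation b := #|B|.
Local Notation r := (rk Z Q B).

(* The columns that belong to every optimal r-assignment are those of [B]. *)
Definition settled a : bool := [forall S, adm b L setT S ==>
  (total a S <= vmin a r Q setT) ==> (cls S == B)].

Lemma settledP a : reflect
  (forall S, adm b L setT S -> total a S <= vmin a r Q setT -> cls S = B)
  (settled a).
Proof.
apply: (iffP forallP) => h S; last first.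
  by apply/implyP => aS; apply/implyP => cS; rewrite h.
by move=> aS cS; move/implyP/(_ aS)/implyP/(_ cS)/eqP: (h S).
Qed.

Hypothesis fB : flat Z Q B.

(** The zeros of [flat_matching] occupy the outer rows and avoid the columns [e |: B], so they
    complete [S] at no cost. *)
Lemma extend_assignment a k (X : {set I}) e S : zeros_exactly a -> e \notin B ->
  X \subset L -> adm k X (e |: B) S ->
  vmin a (k + #|U|)%N (X :|: U) setT <= total a S.
Proof.
move=> /zeros_exactlyP[a0 _] eB XL aS.
have [T [mT TZ rT lT]] := flat_matching fB eB.
have aT : adm #|U| U (cls T) T by apply/admP; rewrite -(card_rws mT) rT.
have dXU : [disjoint X & U].
  by apply: disjointWl XL _; rewrite disjoint_sym disjoints_subset setCD subsetUr.
have [aST tST] := adm_sep R aS aT dXU lT.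
apply: le_trans (vmin_le a (admS (subxx _) (subsetT _) aST)) _.
by rewrite tST [total a T]big1 ?addr0 // => p /(subsetP TZ)/a0.
Qed.

(** Either a column outside [B] is available for [extend_assignment], or [B] is everything and there
    are no outer rows to complete. *)
Lemma extend_inside a k (X : {set I}) S : zeros_exactly a -> X \subset L -> adm k X B S ->
  vmin a (k + #|U|)%N (X :|: U) setT <= total a S.
Proof.
move=> ga XL aS; have [BT|[e eB]] : B = setT \/ exists e, e \notin B.
- case: (boolP [exists e, e \notin B]) => [/existsP|/existsPn h]; first by right.
  by left; apply/setP => e; move: (h e); rewrite negbK inE.
- have -> : U = set0.
    by apply/setP => i; rewrite in_set0; apply/negP => /outer_rowsP[_ [d]]; rewrite BT inE.
  by rewrite cards0 addn0 setU0; apply/vmin_le/(admS _ _ aS); rewrite ?subsetT.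
- by apply: (extend_assignment ga eB XL); apply: admS aS; rewrite ?subsetUr.
Qed.

Lemma LU : L :|: U = Q.
Proof. by rewrite -(setDUK (outer_rows_sub _ _ _)). Qed.

Lemma LDU i : i \in L -> (L :\ i) :|: U = Q :\ i.
Proof.
move=> iL; apply/setP => x; move: iL; rewrite !(in_setU, in_setD, in_set1) => /andP[iU iQ].
case: (eqVneq x i) => [->|_] /=; first by rewrite (negPf iU).
by case: (boolP (x \in U)) => [/(subsetP (outer_rows_sub _ _ _))->|_]; rewrite ?orbT ?orbF.
Qed.

Hypothesis rQ : (r <= #|Q|)%N.
Hypothesis rJ : (r <= #|[set: J]|)%N.

Let rE : r = (b + #|U|)%N := flat_rk fB.

Lemma card_L : #|L| = (#|Q| - #|U|)%N.
Proof. by rewrite cardsD (setIidPr (outer_rows_sub _ _ _)). Qed.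

Lemma le_bL : (b <= #|L|)%N.
Proof. by rewrite card_L leq_subRL ?subset_leq_card ?outer_rows_sub // addnC -rE. Qed.

Lemma le_bJ : (b <= #|[set: J]|)%N.
Proof. by apply: leq_trans rJ; rewrite rE leq_addr. Qed.

Section Settled.
Variable a : I * J -> R.
Hypotheses (ga : zeros_exactly a) (sa : settled a).

Let a_ge0 : forall p, 0 <= a p := zeros_exactly_ge0 ga.

Lemma vmin_L_le k : (k <= #|Q|)%N -> (k <= #|[set: J]|)%N ->
  vmin a (k - #|U|)%N L setT <= vmin a k Q setT.
Proof. by move=> kQ kJ; apply: vmin_del_rows. Qed.

(** Deleting the outer rows from an optimal [r]-assignment leaves at least [b] entries in [L]. An
    optimal [b]-assignment of [L] is therefore no dearer, so that being settled places it in the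
    columns [B], and the outer rows extend it back. *)
Lemma settled_opt : exists2 S, adm b L B S & total a S = vmin a r Q setT.
Proof.
have [S aS eS] := vmin_attained a le_bL le_bJ.
have le : total a S <= vmin a r Q setT.
  by rewrite eS; move: (vmin_L_le rQ rJ); rewrite {1}rE addnK.
have cS := settledP _ sa _ aS le.
have aS' : adm b L B S by case/admP: aS => *; apply/admP; rewrite cS.
exists S => //; apply/eqP; rewrite eq_le le /=.
by move: (extend_inside ga (subxx _) aS'); rewrite LU -rE.
Qed.

Lemma vmin_LT : vmin a b L setT = vmin a r Q setT.
Proof.
apply/eqP; rewrite eq_le; apply/andP; split.
  by move: (vmin_L_le rQ rJ); rewrite {1}rE addnK.
have [S aS <-] := vmin_attained a le_bL le_bJ.
have [le|] := boolP (total a S <= vmin a r Q setT); last by rewrite -ltNge => /ltW.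
have aS' : adm b L B S.
  have cS := settledP _ sa _ aS le.
  by case/admP: aS => *; apply/admP; rewrite cS.
by move: (extend_inside ga (subxx _) aS'); rewrite LU -rE.
Qed.

Lemma vmin_LB : vmin a b L B = vmin a r Q setT.
Proof.
apply/eqP; rewrite eq_le -{2}vmin_LT le_vminS ?subsetT ?le_bL // andbT.
by have [S aS <-] := settled_opt; apply: vmin_le.
Qed.

Lemma LDL i : L :\ i \subset L. Proof. exact: subD1set. Qed.

Lemma QDU i : i \in L -> (Q :\ i) :\: U = L :\ i.
Proof. by move=> iL; rewrite setDDl setUC -setDDl. Qed.

Lemma card_LD i : i \in L -> #|L| = #|L :\ i|.+1.
Proof. by move=> iL; rewrite (cardsD1 i) iL. Qed.

Lemma card_QD i : i \in Q -> #|Q| = #|Q :\ i|.+1.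
Proof. by move=> iQ; rewrite (cardsD1 i) iQ. Qed.

Lemma inLQ i : i \in L -> i \in Q.
Proof. by rewrite in_setD => /andP[]. Qed.

Lemma inUQ i : i \in U -> i \in Q.
Proof. exact: (subsetP (outer_rows_sub _ _ _)). Qed.

Lemma vmin_pred k (X : {set I}) i : (k <= #|X|)%N -> (k <= #|[set: J]|)%N ->
  vmin a k.-1 (X :\ i) setT <= vmin a k X setT.
Proof. by move=> kX kJ; rewrite -subn1 -(cards1 i); apply: vmin_del_rows. Qed.

(* The assignments of the rows [L] that avoid [i] can be moved into [B]: this
   is the exchange of a (b-1)-assignment with the optimal b-assignment. *)
Lemma vmin_LD_LB i : i \in L -> vmin a b.-1 (L :\ i) setT = vmin a b.-1 (L :\ i) B.
Proof.
move=> iL; case bE : b => [|k]; first by rewrite !vmin0.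
have kL : (k <= #|L :\ i|)%N by move: le_bL; rewrite (card_LD iL) bE.
have kJ : (k <= #|[set: J]|)%N by move: le_bJ; rewrite bE; apply: ltnW.
have kB : (k <= b)%N by rewrite bE.
apply/eqP; rewrite eq_le le_vminS ?subsetT //=.
have [S /admP[mS cS rS lS] eS] := vmin_attained a kL kJ.
have [T /admP[mT cT rT lT] eT] := settled_opt.
have iS : i \notin rws S by apply/negP => /(subsetP rS); rewrite !inE eqxx.
have [|S' [T' [w [[[mS' mT'] [wS cS'] [wT cT'] rST tot] iT']]]] :=
    augmenting_path_avoiding R mS mT _ iS; first by rewrite cS cT bE.
have rSTL : rws S :|: rws T \subset L.
  by rewrite subUset rT (subset_trans rS (subD1set _ _)).
have /andP[rS'L rT'L] : (rws S' \subset L) && (rws T' \subset L).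
  by rewrite -subUset (subset_trans rST).
have aT' : adm k (L :\ i) B T'.
  apply/admP; split=> //; last 2 first.
  - by rewrite subsetD1 rT'L.
  - by rewrite (subset_trans _ lT) // cT' subsetUr.
  by apply/eqP; rewrite -eqSS -bE -cT -(card_cls mT) cT' cardsU1 wT add1n card_cls.
have aS' : adm b L setT S'.
  apply/admP; split; rewrite ?subsetT //.
  by rewrite -card_cls // cS' cardsU1 wS card_cls // cS bE.
rewrite /= in eS *; rewrite -eS; apply: le_trans (vmin_le a aT') _.
have := vmin_le a aS'; rewrite vmin_LT -eT.
by move: (tot a); rewrite -!/(total a _) => e h; move: e h; lra.
Qed.

(** Together with [vmin_LB] this expresses the threshold of row [i] at level [r] by entries in the
    columns [B] only. *)
Lemma vmin_QD i : i \in L -> vmin a r.-1 (Q :\ i) setT = vmin a b.-1 (L :\ i) B.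
Proof.
move=> iL; have iQ := inLQ iL.
case bE : b => [|k].
  (* For [b = 0] the truncated index [b.-1] is 0 too, and the left side vanishes because the optimal
     [r]-assignment already costs 0. *)
  apply/eqP; rewrite vmin0 eq_le vmin_ge0 // andbT.
  by apply: le_trans (vmin_pred i rQ rJ) _; rewrite -vmin_LB bE vmin0.
have rk1 : r = (k + #|U|).+1 by rewrite rE bE.
have kL : (k <= #|L :\ i|)%N by move: le_bL; rewrite (card_LD iL) bE.
rewrite /= rk1 /=; apply/eqP; rewrite eq_le; apply/andP; split.
  have [S aS <-] := @vmin_attained _ _ _ a k (L :\ i) B kL (leq_trans (leqnSn k) (eq_leq (esym bE))).
  by move: (extend_inside ga (LDL i) aS); rewrite LDU.
have := vmin_LD_LB iL; rewrite bE /= => <-.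
rewrite -(QDU iL) -{1}[k](addnK #|U|); apply: vmin_del_rows => //.
  by move: rQ; rewrite (card_QD iQ) rk1.
by move: rJ; rewrite rk1; apply: ltnW.
Qed.

(** The rows [L] are also what remains of [Q :\ i] once the other outer rows are deleted, and they
    carry the whole cost. The same argument one level up makes the threshold of an outer row
    stationary ([threshold_outer]). *)
Lemma vmin_QU i : i \in U -> vmin a r.-1 (Q :\ i) setT = vmin a r Q setT.
Proof.
move=> iU; apply/eqP; rewrite eq_le vmin_pred //=.
have iQ := inUQ iU.
have UE : #|U| = #|U :\ i|.+1 by rewrite (cardsD1 i) iU.
have rk1 : r = (b + #|U :\ i|).+1 by rewrite rE UE addnS.
rewrite -vmin_LT.
have -> : L = (Q :\ i) :\: (U :\ i) by rewrite setDDl setD1K.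
rewrite rk1 /= -{1}[b](addnK #|U :\ i|); apply: vmin_del_rows => //.
  by move: rQ; rewrite (card_QD iQ) rk1.
by move: rJ; rewrite rk1; apply: ltnW.
Qed.

(** This justifies the intended reading of [settled]. For a column [d] outside [B], an optimal
    assignment inside [B] is completed by zeros in the outer rows that avoid [d]. *)
Lemma settled_cols d : reflect
  (forall S, adm r Q setT S -> total a S <= vmin a r Q setT -> d \in cls S) (d \in B).
Proof.
apply: (iffP idP) => [dB S aS tS|h].
  have [T [[TS _] rT lT mT cT]] := del_rows U aS.
  move: cT; rewrite {1}rE addnK => cT.
  have [T' T'T aT'] := adm_shrink cT mT rT lT.
  have T'S := subset_trans T'T TS.
  apply: (subsetP (cls_sub T'S)).
  by rewrite (settledP _ sa _ aT') // (le_trans (le_total a_ge0 T'S)).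
apply: contraT => dB.
have [T [mT TZ rT lT]] := flat_matching fB dB.
have [S aS eS] := settled_opt.
have aT : adm #|U| U (cls T) T by apply/admP; rewrite -(card_rws mT) rT.
have dLU : [disjoint L & U] by rewrite disjoint_sym disjoints_subset setCD subsetUr.
have dBT : [disjoint B & cls T] by apply: disjointWl lT; apply: subsetUr.
have [aST tST] := adm_sep R aS aT dLU dBT.
move: aST; rewrite LU -rE => aST.
have := h _ (admS (subxx _) (subsetT _) aST).
rewrite tST [total a T]big1 ?addr0 ?eS => [|p /(subsetP TZ) pZ]; last first.
  by case/zeros_exactlyP: ga => /(_ _ pZ).
move=> /(_ (lexx _)); rewrite clsU inE => /orP[|dT].
  by case/admP: aS => _ _ _ /subsetP/(_ d) + /[dup] => /[apply]; rewrite (negPf dB).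
by move/pred0P/(_ d): lT; rewrite /= setU11 dT.
Qed.

(** A smaller or equal entry could be added to an optimal [b.-1]-assignment avoiding row [i], giving
    an optimal assignment that uses a column outside [B]. For [b = 0] the claim is that the entry is
    positive: a zero there would make row [i] outer. *)
Lemma settled_lt i d : i \in L -> d \notin B ->
  vmin a b L B - vmin a b.-1 (L :\ i) B < a (i, d).
Proof.
move=> iL dB; case bE : b => [|k].
  rewrite !vmin0 subrr; case/zeros_exactlyP: ga => _; apply.
  move: iL; rewrite in_setD => /andP[iU iQ]; apply: contra iU => h.
  by apply/outer_rowsP; split=> //; exists d.
have kL : (k <= #|L :\ i|)%N by move: le_bL; rewrite (card_LD iL) bE.
have kB : (k <= b)%N by rewrite bE.
have [S aS eS] := vmin_attained a kL kB.
have iLi : i \notin L :\ i by rewrite !inE eqxx.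
have := adm_setU1 aS iLi dB; rewrite setD1K // => aS'.
have iS : (i, d) \notin S.
  apply/negP => h; case/negP: dB; case/admP: aS => _ _ _ /subsetP; apply.
  by apply/clsP; exists i.
rewrite ltrBlDr /= -eS -bE vmin_LB -total_setU1 // ltNge.
apply: contra dB => le.
rewrite -(settledP _ sa _ _ le); last by rewrite bE; apply: admS aS'; rewrite ?subsetT.
by apply/clsP; exists i; rewrite setU11.
Qed.

Hypothesis rQ' : (r < #|Q|)%N.
Hypothesis rJ' : (r < #|[set: J]|)%N.

Lemma lt_bL : (b < #|L|)%N.
Proof. by rewrite card_L ltn_subRL addnC -rE. Qed.

Lemma lt_bJ : (b < #|[set: J]|)%N.
Proof. by apply: leq_ltn_trans rJ'; rewrite rE leq_addr. Qed.

Lemma le_bLD i : i \in L -> (b <= #|L :\ i|)%N.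
Proof. by move=> iL; move: lt_bL; rewrite (card_LD iL). Qed.

Lemma next_le i d : i \in L -> d \notin B ->
  vmin a r.+1 Q setT <= vmin a b (L :\ i) B + a (i, d).
Proof.
move=> iL dB; have [S aS <-] := vmin_attained a (le_bLD iL) (leqnn b).
have iLi : i \notin L :\ i by rewrite !inE eqxx.
have := adm_setU1 aS iLi dB; rewrite setD1K // => aS'.
have iS : (i, d) \notin S.
  apply/negP => h; case/negP: dB; case/admP: aS => _ _ _ /subsetP; apply.
  by apply/clsP; exists i.
have := extend_assignment ga dB (subxx _) aS'.
by rewrite LU addSn -rE total_setU1 // addrC.
Qed.

(** Augmenting an optimal [b]-assignment along [T] preserves the total cost, so both outputs are
    optimal for their sizes. The smaller one has the columns [B] by settledness, so a single column
    [w] is new. The entry [(i, w)] is read off the larger output, not off [T]. *)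
Lemma next_shape T : adm b.+1 L setT T -> total a T <= vmin a b.+1 L setT ->
  exists i d, [/\ i \in L, d \notin B, cls T = d |: B &
    vmin a b (L :\ i) B + a (i, d) <= total a T].
Proof.
case/admP=> mT cT rT lT tT.
have [S aS eS] := settled_opt; case/admP: aS => mS cS rS lS.
have [|S' [T' [w [[mS' mT'] [wS cS'] [wT cT'] rST tot]]]] :=
    augmenting_path R mS mT; first by rewrite cS cT.
have rSTL : rws S :|: rws T \subset L by rewrite subUset rT rS.
have /andP[rS'L rT'L] : (rws S' \subset L) && (rws T' \subset L).
  by rewrite -subUset (subset_trans rST).
have clsS : cls S = B by apply/eqP; rewrite eqEcard lS (card_cls mS) cS leqnn.
have aS' : adm b.+1 L setT S'.
  apply/admP; split; rewrite ?subsetT //.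
  by rewrite -card_cls // cS' cardsU1 wS card_cls // cS.
have aT' : adm b L setT T'.
  apply/admP; split; rewrite ?subsetT //.
  by apply/eqP; rewrite -eqSS -cT -(card_cls mT) cT' cardsU1 wT add1n card_cls.
have := tot a; rewrite -!/(total a _) => e.
have h1 := vmin_le a aS'; have h2 := vmin_le a aT'; rewrite vmin_LT -eS in h2.
have clsT' : cls T' = B.
  by apply: (settledP _ sa _ aT'); rewrite -eS; move: e h1 tT; lra.
have [i iwS'] : exists i, (i, w) \in S' by apply/clsP; rewrite cS' setU11.
exists i, w; split.
- by apply: (subsetP rS'L); apply/rwsP; exists w.
- by rewrite -clsS.
- by rewrite cT' clsT'.
have pS' : [set (i, w)] \subset S' by rewrite sub1set.
have := matching_sepD mS' pS'; rewrite sep1 => /andP[iD wD].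
have aD : adm b (L :\ i) B (S' :\ (i, w)).
  apply/admP; split.
  - exact: matching_sub (subD1set _ _) mS'.
  - by apply/eqP; case/admP: aS' => _ + _ _; rewrite (cardsD1 (i, w)) iwS' add1n => /eqP.
  - by rewrite subsetD1 iD andbT (subset_trans _ rS'L) // rws_sub // subD1set.
  - apply/subsetP => x xD; have : x \in w |: B.
      by rewrite -clsS -cS'; apply: subsetP xD; rewrite cls_sub // subD1set.
    by rewrite !inE => /orP[/eqP xw|//]; move: xD; rewrite xw => xD; rewrite /= xD in wD.
have h3 := vmin_le a aD.
have : total a S' = a (i, w) + total a (S' :\ (i, w)).
  by rewrite -{1}(setD1K iwS') total_setU1 // !inE eqxx.
by move: e h1 h2 h3 tT; lra.
Qed.

Lemma next_LT : vmin a b.+1 L setT = vmin a r.+1 Q setT.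
Proof.
apply/eqP; rewrite eq_le; apply/andP; split.
  by have := @vmin_L_le r.+1 rQ' rJ'; rewrite {1}rE -addSn addnK.
have [T aT eT] := vmin_attained a lt_bL lt_bJ.
have le : total a T <= vmin a b.+1 L setT by rewrite eT.
have [i [d [iL dB _ h]]] := next_shape aT le.
by rewrite -eT; apply: le_trans (next_le iL dB) h.
Qed.

Lemma next_attained : exists i d, [/\ i \in L, d \notin B &
  vmin a b (L :\ i) B + a (i, d) = vmin a r.+1 Q setT].
Proof.
have [T aT eT] := vmin_attained a lt_bL lt_bJ.
have le : total a T <= vmin a b.+1 L setT by rewrite eT.
have [i [d [iL dB _ h]]] := next_shape aT le; exists i, d; split=> //.
by apply/eqP; rewrite eq_le next_le // andbT -next_LT -eT.
Qed.

(** An optimal [b]-assignment of [L :\ i] either stays in [B], which gives the first term, or uses a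
    column outside [B]. In that case it is exchanged with an optimal assignment of [L] along this
    column. If the sizes change, the second term results; if they do not, an optimal assignment
    leaves [B], against settledness. The reverse bound by the second term is [vmin_exchange]. *)
Lemma vmin_next_QD i : i \in L -> vmin a r (Q :\ i) setT =
  Num.min (vmin a b (L :\ i) B)
    (vmin a r.+1 Q setT - (vmin a b L B - vmin a b.-1 (L :\ i) B)).
Proof.
move=> iL; have iQ := inLQ iL.
have rQi : (r <= #|Q :\ i|)%N by move: rQ'; rewrite (card_QD iQ).
apply/eqP; rewrite eq_le; apply/andP; split.
  rewrite le_min; apply/andP; split.
    have [S aS <-] := vmin_attained a (le_bLD iL) (leqnn b).
    by have := extend_inside ga (LDL i) aS; rewrite LDU // -rE.
  case rk0 : r => [|k].
    have b0 : b = 0%N by apply/eqP; rewrite -leqn0 -rk0 rE leq_addr.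
    by rewrite b0 !vmin0 subrr subr0 vmin_ge0.
  have := @vmin_exchange _ _ _ a k Q setT i iQ.
  rewrite -rk0 => /(_ rQ' rJ').
  by rewrite -vmin_QD // vmin_LB rk0 /=; lra.
have [S aS eS] := vmin_attained a (le_bLD iL) le_bJ.
have leS : total a S <= vmin a r (Q :\ i) setT.
  rewrite eS -(QDU iL); have := @vmin_del_rows _ _ _ a U r (Q :\ i) setT a_ge0 rQi rJ.
  by rewrite {1}rE addnK.
apply: le_trans leS; rewrite ge_min; case/admP: (aS) => mS cS rS lS.
have [SB|/subsetPn[e eS' eB]] := boolP (cls S \subset B).
  by rewrite vmin_le //; apply/admP.
apply/orP; right.
have [T aT eT] := settled_opt; case/admP: aT => mT cT rT lT.
have eT' : e \notin cls T by apply: contra eB; apply/subsetP.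
have [T' [S' [[mT' mS'] tot eT'' [rS' rT'] cards]]] :=
  column_exchange R mT mS eS' eT'.
have rT'L : rws T' \subset L.
  by rewrite (subset_trans rT') // subUset rT (subset_trans rS (LDL i)).
have rS'L : rws S' \subset L :\ i := subset_trans rS' rS.
have := tot a; rewrite -!/(total a _) => tE.
case: cards => [[c1 c2]|[c1 c2]].
  have aT' : adm b.+1 L setT T' by apply/admP; rewrite subsetT c1 cT.
  have aS' : adm b.-1 (L :\ i) setT S'.
    by apply/admP; rewrite subsetT; split=> //; rewrite -cS c2.
  have h1 := vmin_le a aT'; have h2 := vmin_le a aS'.
  rewrite next_LT in h1; rewrite vmin_LD_LB // in h2.
  by rewrite vmin_LB -eT; move: h1 h2 tE; lra.
have aT' : adm b L setT T' by apply/admP; rewrite subsetT c1 cT.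
have aS' : adm b (L :\ i) setT S' by apply/admP; rewrite subsetT c2 cS.
have h2 := vmin_le a aS'; rewrite -eS in h2.
case/negP: eB; rewrite -(settledP _ sa _ aT') // -eT.
by move: h2 tE; lra.
Qed.

(* In a new column, an entry of row [i] enters the optimal k-assignment when it is
   below this value. *)
Definition threshold k i : R := vmin a k Q setT - vmin a k.-1 (Q :\ i) setT.

(** The right side is the length of the interval of values at which an entry of row [i] in a new
    column enters: above the threshold of level [r], and at most the next optimal cost minus the
    cost of the rest. No column occurs in it. *)
Lemma threshold_step i : i \in L -> threshold r.+1 i - threshold r i =
  Num.max 0 (vmin a r.+1 Q setT - vmin a b (L :\ i) B -
    (vmin a b L B - vmin a b.-1 (L :\ i) B)).
Proof.
move=> iL; rewrite /threshold /= vmin_next_QD // vmin_QD // -vmin_LB.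
set x := vmin a b _ _; set v := vmin a r.+1 _ _; set y := vmin a b L B.
set z := vmin a b.-1 _ _.
by rewrite /Num.min /Num.max; case: ltP => h1; case: ltP => h2; lra.
Qed.

Lemma threshold_outer i : i \in U -> threshold r.+1 i - threshold r i = 0.
Proof.
move=> iU; rewrite /threshold /= vmin_QU //; have iQ := inUQ iU.
suff -> : vmin a r (Q :\ i) setT = vmin a r.+1 Q setT by rewrite !subrr.
apply/eqP; rewrite eq_le; apply/andP; split.
  exact: (@vmin_pred r.+1 Q i rQ' rJ').
have UE : #|U| = #|U :\ i|.+1 by rewrite (cardsD1 i) iU.
have rE' : r = (b.+1 + #|U :\ i|)%N by rewrite rE UE addnS.
rewrite -next_LT; have -> : L = (Q :\ i) :\: (U :\ i) by rewrite setDDl setD1K.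
rewrite rE' -{1}[b.+1](addnK #|U :\ i|); apply: vmin_del_rows => //.
  by rewrite -rE'; move: rQ'; rewrite (card_QD iQ).
by rewrite -rE'.
Qed.


End Settled.
End Stage.

(** * The passage from one settled flat to the next *)

Section Evolution.
Variables (R : realFieldType) (I J : finType).
Variables (Z : {set I * J}) (Q : {set I}).
Implicit Types (a : I * J -> R) (S T : {set I * J}) (B : {set J}).

Local Notation U B := (outer_rows Z Q B).
Local Notation L B := (Q :\: U B).
Local Notation r B := (rk Z Q B).

Lemma settled_unique a B B' : flat Z Q B -> flat Z Q B' -> zeros_exactly Z a ->
  settled Z Q B a -> settled Z Q B' a -> r B = r B' ->
  (r B <= #|Q|)%N -> (r B <= #|[set: J]|)%N -> B = B'.
Proof.
move=> fB fB' ga sB sB' e rQ rJ; apply/setP => d.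
have [rQ' rJ'] : (r B' <= #|Q|)%N /\ (r B' <= #|[set: J]|)%N by rewrite -e.
have h := settled_cols fB rQ rJ ga sB d; rewrite e in h.
have h' := settled_cols fB' rQ' rJ' ga sB' d.
by apply/idP/idP => [/h x|/h' x]; [apply/h'|apply/h].
Qed.

(** Passing from [B] to [B'] turns some outer rows into inner ones. Deleting these rows from [S]
    leaves an optimal [T] of size [#|B|.+1], whose columns are [d0 |: B] by [next_shape]. The
    deleted part then costs nothing, so it consists of zeros in rows no longer outer, which lie in
    the columns [B']. *)
Lemma settled_next a B d0 : flat Z Q B -> zeros_exactly Z a -> settled Z Q B a ->
  (r B < #|Q|)%N -> (r B < #|[set: J]|)%N -> d0 \notin B ->
  (forall i d, i \in L B -> d \notin B ->
    vmin a #|B| (L B :\ i) B + a (i, d) <= vmin a (r B).+1 Q setT -> d = d0) ->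
  settled Z Q (cl Z Q (d0 |: B)) a.
Proof.
move=> fB ga sB rQ rJ d0B uniq_d0.
have [rQ' rJ'] := (ltnW rQ, ltnW rJ).
set B' := cl Z Q _; have fB' : flat Z Q B' := flat_cl _ _ _.
have rB' : r B' = (r B).+1 by rewrite rk_cl_setU1.
have dBB' : d0 |: B \subset B' := sub_cl _ _ _.
have BB' : B \subset B' := subset_trans (subsetUr _ _) dBB'.
have U'U : U B' \subset U B := outer_rowsS Z Q BB'.
apply/settledP => S aS; rewrite rB' => tS.
have a_ge0 := zeros_exactly_ge0 ga.
have [T [[TS rD] rT lT mT cT]] := del_rows (U B :\: U B') aS.
have cT' : (#|B|.+1 <= #|T|)%N.
  have arith (n n' u u' q q' : nat) : q = (n + u)%N -> q' = (n' + u')%N ->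
      q' = q.+1 -> (u' <= u)%N -> (n.+1 <= n' - (u - u'))%N by clear; lia.
  apply: leq_trans cT; rewrite cardsD (setIidPr U'U).
  exact: arith (flat_rk fB) (flat_rk fB') rB' (subset_leq_card U'U).
have rTL : rws T \subset L B.
  apply: subset_trans rT _; apply/subsetP => i; rewrite !in_setD.
  by case: (i \in U B); case: (i \in U B').
have tT : total a T <= vmin a #|B|.+1 (L B) setT.
  by rewrite (next_LT fB rQ' rJ' ga sB rQ rJ) (le_trans (le_total a_ge0 TS)).
(* Applied twice: to [T], which therefore meets column [d0], and to [T] without its entry there,
   which rules out any surplus entry in [T]. *)
have shape T0 : T0 \subset T -> (#|B|.+1 <= #|T0|)%N -> d0 \in cls T0.
  move=> T0T cT0.
  have [T1 T1T aT1] := adm_shrink cT0 (matching_sub T0T mT)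
    (subset_trans (rws_sub T0T) rTL) (subsetT _).
  have tT1 : total a T1 <= vmin a #|B|.+1 (L B) setT.
    exact: le_trans (le_total a_ge0 (subset_trans T1T T0T)) tT.
  have [i [d [iL dB cT1 h]]] := next_shape fB rQ' rJ' ga sB aT1 tT1.
  have dd0 : d = d0.
    apply: (uniq_d0 i) => //; rewrite -(next_LT fB rQ' rJ' ga sB rQ rJ).
    exact: le_trans h tT1.
  by apply: (subsetP (cls_sub T1T)); rewrite cT1 dd0 setU11.
have [i0 i0T] : exists i, (i, d0) \in T by apply/clsP/shape.
have cTb : #|T| = #|B|.+1.
  apply/eqP; rewrite eqn_leq cT' andbT leqNgt; apply/negP => h.
  have /(shape _ (subD1set _ _)) : (#|B|.+1 <= #|T :\ (i0, d0)|)%N.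
    by move: h; rewrite (cardsD1 (i0, d0) T) i0T.
  have pT : [set (i0, d0)] \subset T by rewrite sub1set.
  by move: (matching_sepD mT pT); rewrite sep1 => /andP[_ /negP].
have aT : adm #|B|.+1 (L B) setT T by apply/admP; rewrite subsetT.
have [i [d [iL dB clsT h]]] := next_shape fB rQ' rJ' ga sB aT tT.
have dd0 : d = d0.
  apply: (uniq_d0 i) => //; rewrite -(next_LT fB rQ' rJ' ga sB rQ rJ).
  exact: le_trans h tT.
have tSE : total a S = total a (S :\: T) + total a T by exact: sum_setD.
have rest0 : total a (S :\: T) = 0.
  apply/eqP; rewrite eq_le total_ge0 // andbT.
  have := vmin_le a aT; rewrite (next_LT fB rQ' rJ' ga sB rQ rJ).
  by move: tSE tS; lra.
have restZ p : p \in S :\: T -> p \in Z.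
  move=> pST; apply: contraT => pZ.
  have : 0 < total a (S :\: T).
    rewrite /total (bigD1 p) //= ltr_pwDl ?sumr_ge0 //.
    by case/zeros_exactlyP: ga => _ /(_ p pZ).
  by rewrite rest0 ltxx.
have clsS : cls S \subset B'.
  rewrite (setDUK TS) clsU subUset clsT dd0 dBB' andbT.
  apply/subsetP => e /clsP[j jST]; apply: contraT => eB'.
  have jrD : j \in U B :\: U B' by apply: (subsetP rD); apply/rwsP; exists e.
  move: (jrD); rewrite in_setD => /andP[/negP + jU]; case.
  apply/outer_rowsP; split; first exact: subsetP (outer_rows_sub _ _ _) _ jU.
  by exists e => //; apply: restZ.
case/admP: aS => mS cS _ _; apply/eqP; rewrite eqEcard clsS.
by rewrite card_cls // cS leqnn.
Qed.

(** The start of the chain. An assignment of cost 0 uses zeros only, and in a row that is not outer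
    all zeros lie in the columns of the closure. *)
Lemma settled_cl0 a : zeros_exactly Z a ->
  settled Z Q (cl Z Q set0) a /\ vmin a (rk Z Q set0) Q setT = 0.
Proof.
move=> ga; have a_ge0 := zeros_exactly_ge0 ga; rewrite -(rk_cl Z Q set0).
set B := cl Z Q set0; have fB : flat Z Q B := flat_cl _ _ _.
have [S [mS SZ cS rS]] := cl0_matching Z Q.
have aS : adm #|B| (L B) B S by apply/admP; rewrite cS -(card_cls mS) cS.
have v0 : vmin a (r B) Q setT = 0.
  apply/eqP; rewrite eq_le vmin_ge0 // andbT.
  have := extend_inside fB ga (subxx _) aS; rewrite LU -flat_rk //.
  rewrite [total a S]big1 // => p /(subsetP SZ) pZ.
  by case/zeros_exactlyP: ga => /(_ p pZ).
split=> //; apply/settledP => T; rewrite v0 => /admP[mT cT rT _] tT.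
apply/eqP; rewrite eqEcard (card_cls mT) cT leqnn andbT.
apply/subsetP => d /clsP[i idT]; apply: contraT => dB.
have idZ : (i, d) \in Z.
  apply: contraT => idZ; move: tT; rewrite leNgt => /negP; case.
  rewrite /total (bigD1 (i, d)) //= ltr_pwDl ?sumr_ge0 //.
  by case/zeros_exactlyP: ga => _ /(_ _ idZ).
have : i \in L B by apply: (subsetP rT); apply/rwsP; exists d.
rewrite in_setD => /andP[/negP + iQ]; case.
by apply/outer_rowsP; split => //; exists d.
Qed.

(* As a function of one entry outside [B], being settled is a half-line, and
   its end point is the threshold of the row. *)
Lemma settled_entry a a' B i d : flat Z Q B -> zeros_exactly Z a ->
  zeros_exactly Z a' -> (r B <= #|Q|)%N -> (r B <= #|[set: J]|)%N ->
  i \in L B -> d \notin B -> (forall p, p != (i, d) -> a p = a' p) ->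
  settled Z Q B a ->
  settled Z Q B a' =
  (vmin a #|B| (L B) B - vmin a #|B|.-1 (L B :\ i) B < a' (i, d)).
Proof.
move=> fB ga ga' rQ rJ iL dB aa' sa.
have le_b : (#|B| <= #|L B|)%N := le_bL fB rQ.
have kL : (#|B|.-1 <= #|L B :\ i|)%N.
  by move: le_b; rewrite (cardsD1 i (L B)) iL; case: #|B|.
have kB : (#|B|.-1 <= #|B|)%N by rewrite leq_pred.
have eqB k (X : {set I}) : (k <= #|X|)%N -> (k <= #|B|)%N -> vmin a k X B = vmin a' k X B.
  move=> h1 h2; apply: eq_vmin => // j e _ eB; apply: aa'.
  by apply: contraNneq dB => -[_ <-].
apply/idP/idP => [sa'|lt].
  by have := settled_lt fB rQ rJ ga' sa' iL dB; rewrite -!eqB.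
apply/settledP => S aS tS.
have tot_eq T : (i, d) \notin T -> total a T = total a' T.
  move=> idT; apply: eq_bigr => p pT; apply: aa'.
  by apply: contraNneq idT => <-.
have tS' : total a' S <= vmin a #|B| (L B) B.
  apply: le_trans tS _; have [T aT ->] : exists2 T, adm #|B| (L B) B T &
      vmin a #|B| (L B) B = total a' T.
    by rewrite eqB //; have [T aT <-] := vmin_attained a' le_b (leqnn _); exists T.
  by have := extend_inside fB ga' (subxx _) aT; rewrite LU -flat_rk.
have [idS|idS] := boolP ((i, d) \in S); last first.
  apply: (settledP _ _ _ _ sa) => //.
  by rewrite tot_eq // -(vmin_LB fB rQ rJ ga sa).
(* If [S] used [(i, d)], the rest would cost at least this much, and the entry would not exceed the
   threshold. *)
have : vmin a #|B|.-1 (L B :\ i) B <= total a' (S :\ (i, d)).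
  rewrite -tot_eq ?inE ?eqxx // -(vmin_LD_LB fB rQ rJ ga sa iL).
  apply: vmin_le; case/admP: (aS) => mS cS rS lS.
  have pS : [set (i, d)] \subset S by rewrite sub1set.
  have := matching_sepD mS pS; rewrite sep1 => /andP[iD dD].
  apply/admP; split; rewrite ?subsetT //.
  - exact: matching_sub (subD1set _ _) mS.
  - by rewrite -cS (cardsD1 (i, d) S) idS.
  - by rewrite subsetD1 iD andbT (subset_trans _ rS) // rws_sub // subD1set.
have : total a' S = a' (i, d) + total a' (S :\ (i, d)).
  by rewrite -{1}(setD1K idS) total_setU1 // !inE eqxx.
by move: lt tS' => h1 h2 h3 h4; exfalso; move: h1 h2 h3 h4; lra.
Qed.

End Evolution.

Require Import Defs.
From mathcomp Require Import all_classical all_reals all_analysis.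
From mathcomp Require Import measurable_realfun.

Import numFieldNormedType.Exports.

(** * Random matrices, one entry at a time *)

Section VectorSpace.
Variables (R : realType) (I : finType).

(** Boxes are closed under intersection and generate the product sigma-algebra, and mutual
    independence is stated on them, so laws on [vect] can be compared on boxes. *)
Definition boxes : set (set (I -> R)) :=
  [set E | exists2 A : I -> set R, (forall i, measurable (A i)) &
                                   E = [set a | forall i, A i (a i)]]%classic.

Definition vect := g_sigma_algebraType boxes.

HB.instance Definition _ := Measurable.on vect.

Lemma measurable_box (A : I -> set R) : (forall i, measurable (A i)) ->
  measurable ([set a | forall i, A i (a i)]%classic : set vect).
Proof. by move=> mA; apply: sub_sigma_algebra; exists A. Qed.

Lemma measurable_coord i : measurable_fun [set: vect]%classic (fun a : vect => a i).
Proof.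
move=> _ A mA; rewrite setTI.
rewrite (_ : _ @^-1` _ = [set a : vect | forall j, (if j == i then A else setT) (a j)])%classic.
  by apply: (@measurable_box (fun j => if j == i then A else setT)) => j; case: ifP.
apply/seteqP; split => a /= Aa; last by have := Aa i; rewrite eqxx.
by move=> j; case: eqP => [->|_].
Qed.

Lemma measurable_into d (T : measurableType d) (f : T -> vect) :
  (forall i, measurable_fun [set: T]%classic (fun x => f x i)) ->
  measurable_fun [set: T]%classic f.
Proof.
move=> mf; refine (@measurability _ _ T vect setT f boxes _ _) => //.
move=> _ [_ [A mA ->] <-]; rewrite setTI.
rewrite (_ : _ @^-1` _ = \bigcap_(i in [set: I]) (fun x => f x i) @^-1` A i)%classic.
  apply: fin_bigcap_measurable => //.
  by move=> i _; rewrite -[X in measurable X]setTI; exact: mf.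
by apply/seteqP; split => x /= h i => [_|]; exact: h.
Qed.

Definition upd (a : vect) (p : I) (s : R) : vect := fun q => if q == p then s else a q.

Definition updp (p : I) (z : vect * R) : vect := upd z.1 p z.2.

Lemma measurable_updp p : measurable_fun [set: vect * R]%classic (updp p).
Proof.
apply: measurable_into => q; rewrite /updp /upd; case: (q == p).
  exact: measurable_snd.
exact: (measurableT_comp (measurable_coord q) measurable_fst).
Qed.

HB.instance Definition _ p := isMeasurableFun.Build _ _ _ _ (updp p) (measurable_updp p).

End VectorSpace.

Section Resampling.
Local Open Scope ereal_scope.
Variables (R : realType) (I : finType).
Local Notation vect := (vect R I).
Variables (P : probability vect R) (mu : probability R R) (p : I).

(* The coordinate [p] is independent of the others and has law [mu]. *)
Definition resampled : Prop := forall E : set vect, measurable E ->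
  P E = (P \x mu) (updp p @^-1` E)%classic.

Hypothesis rP : resampled.

Lemma integral_resampled (f : vect -> \bar R) :
  measurable_fun [set: vect]%classic f -> (forall a, 0 <= f a) ->
  \int[P]_a f a = \int[P]_a \int[mu]_s f (upd a p s).
Proof.
move=> mf f0.
transitivity (\int[pushforward (P \x mu) (updp p)]_a f a).
  by apply: eq_measure_integral => E mE _; exact: rP.
rewrite ge0_integral_pushforward // fubini_tonelli1 //.
  by apply: measurableT_comp => //; exact: measurable_updp.
by move=> z; exact: f0.
Qed.

End Resampling.

(* [R] carries two convertible measurable structures, with different displays:
   that of Lebesgue measure, and that of random variables. *)
Definition borel_id (R : realType) (x : measurableTypeR R) : R := x.

Lemma measurable_borel_id (R : realType) : measurable_fun setT (@borel_id R).
Proof. by move=> _ A mA; rewrite setTI. Qed.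

HB.instance Definition _ (R : realType) :=
  isMeasurableFun.Build _ _ _ _ (@borel_id R) (@measurable_borel_id R).

(** * The exponential law and its Stein identity *)

Section ExponentialLaw.
Local Open Scope ereal_scope.
Local Open Scope classical_set_scope.
Variables (R : realType) (rate : R).
Hypothesis rate_gt0 : (0 < rate)%R.

Definition exponential_law (mu : set R -> \bar R) : Prop := forall t : R, (0 <= t)%R ->
  mu [set x | (t < x)%R] = (expR (- (rate * t)))%:E.

Let expo : probability R R := distribution
  (exponential_distribution_exponential_prob__canonical__probability_measure_Probability rate_gt0)
  (@borel_id R).

Let expoE (D : set R) : expo D = \int[lebesgue_measure]_(x in D) (exponential_pdf rate x)%:E.
Proof. by []. Qed.

Lemma ray_setC (t : R) : `]t, +oo[ = ~` `]-oo, t] :> set R.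
Proof. by rewrite setCitvl. Qed.

Lemma expo_lt0 (t : R) : (t <= 0)%R -> expo `]-oo, t] = 0.
Proof.
move=> t0; have mpdf := measurable_exponential_pdf rate.
have expo_neg : expo `]-oo, 0%R[ = 0.
  rewrite expoE integral0_eq // => x /=; rewrite in_itv /= => x0.
  by rewrite lt0_exponential_pdf.
have expo_0 : expo [set 0%R] = 0 by rewrite expoE integral_set1.
apply/eqP; rewrite eq_le measure_ge0 andbT.
have -> : 0 = expo `]-oo, 0%R[ + expo [set 0%R] by rewrite expo_neg expo_0 adde0.
apply: le_trans (measureU2 _ _ _) => //; apply: le_measure; rewrite ?inE //.
  exact: measurableU.
move=> x /=; rewrite !in_itv /= => /le_trans/(_ t0).
by rewrite le_eqVlt => /orP[/eqP->|]; [right|left].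
Qed.

Lemma expo_ray (t : R) : (0 <= t)%R -> expo `]t, +oo[ = (expR (- (rate * t)))%:E.
Proof.
move=> t0; rewrite ray_setC probability_setC //.
move: t0; rewrite le_eqVlt => /orP[/eqP<-|t0].
  by rewrite expo_lt0 // sube0 mulr0 oppr0 expR0.
have expo_neg : expo `]-oo, 0%R[ = 0.
  apply/eqP; rewrite eq_le measure_ge0 andbT -(expo_lt0 (lexx _)).
  by apply: le_measure; rewrite ?inE // => x /=; rewrite !in_itv /= => /ltW.
have tE : `]-oo, t] = `]-oo, 0%R[ `|` `[0%R, t] :> set R.
  by rewrite -itv_bndbnd_setU // bnd_simp ltW.
have expo_c : expo `[0%R, t] = 1 - (expR (- rate * t))%:E by exact: exponential_prob_itv0c.
have expoU : expo (`]-oo, 0%R[ `|` `[0%R, t]) = expo `]-oo, 0%R[ + expo `[0%R, t].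
  apply: measureU => //; apply/seteqP; split=> // x /=.
  by rewrite !in_itv /= => -[x0 /andP[]]; rewrite leNgt x0.
rewrite tE expoU expo_neg expo_c add0e.
by rewrite mulNr -!EFinB; congr EFin; ring.
Qed.

Variable mu : probability R R.
Hypothesis lmu : exponential_law mu.

Lemma exponential_law_ray (t : R) : mu `]t, +oo[ = expo `]t, +oo[.
Proof.
have ray t' : (0 <= t')%R -> mu `]t', +oo[ = (expR (- (rate * t')))%:E.
  by move=> t0; rewrite -lmu //; congr (mu _); apply/seteqP; split => x /=; rewrite in_itv /= andbT.
have [t0|t0] := leP 0%R t; first by rewrite ray // expo_ray.
(* For [t < 0], both laws already put all their mass on the positive half-line. *)
have one (m : probability R R) : m `]0%R, +oo[ = 1 -> m `]t, +oo[ = 1.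
  move=> m1; apply/eqP; rewrite eq_le probability_le1 // andTb -m1.
  apply: le_measure; rewrite ?inE // => x /=; rewrite !in_itv /= !andbT.
  exact: lt_trans.
transitivity (1 : \bar R); first by apply: one; rewrite ray // mulr0 oppr0 expR0.
by apply/esym/(one expo); rewrite expo_ray // mulr0 oppr0 expR0.
Qed.

(** The tails determine the law, because the open upper rays are a pi-system generating the Borel
    sets. This gives [mu] a density. *)
Lemma exponential_lawE (D : set R) : measurable D -> mu D = expo D.
Proof.
move=> mD.
refine (@g_sigma_algebra_measure_unique _ R R (@RGenOInfty.G R) _
  (fun k => `](- k%:R)%R, +oo[) _ _ mu expo _ _ _ D _) => //.
- by move=> _ [x ->].
- by move=> k; exists (- k%:R)%R.
- apply/seteqP; split => // x _; exists (Num.truncn `|x|).+1 => //=.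
  rewrite in_itv /= andbT ltrNl.
  by apply: le_lt_trans (ler_norm _) _; rewrite normrN; exact: truncnS_gt.
- move=> _ _ [x ->] [y ->]; exists (Num.max x y).
  by apply/seteqP; split => z /=; rewrite !in_itv /= !andbT gt_max => /andP.
- by move=> _ [x ->]; exact: exponential_law_ray.
- by move=> k; apply: le_lt_trans (probability_le1 _ _) _; rewrite ?ltry.
- by move: (mD : (@ocitv R).-sigma.-measurable D); rewrite RGenOInfty.measurableE.
Qed.

Lemma exponential_law_set1 (x : R) : mu [set x] = 0.
Proof. by rewrite exponential_lawE // expoE integral_set1. Qed.

(* The identity E[h(X)] = E[h'(X)] / rate, for the function h vanishing at 0
   whose derivative is the indicator function of [D]. *)
Lemma exponential_law_stein (D : set R) : measurable D ->
  (forall s, D s -> (0 < s)%R) ->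
  rate%:E * \int[mu]_x lebesgue_measure (D `&` [set s | (s < x)%R]) = mu D.
Proof.
move=> mD D0.
pose A : set (R * measurableTypeR R) := [set z | (z.2 < z.1)%R] `&` [set z | D z.2].
have mA : measurable A.
  apply: measurableI.
    have := measurable_fun_ltr
      (@measurable_snd _ _ R (measurableTypeR R)
        : measurable_fun setT (snd : R * measurableTypeR R -> R))
      (@measurable_fst _ _ R (measurableTypeR R)).
    by move=> /(_ measurableT [set true]); rewrite setTI; apply.
  by rewrite -[X in measurable X]setTI; exact: measurable_snd.
(* Tonelli turns the expected length into the integral over [s] in [D] of the tail at [s]; the rate
   times this tail is the density of the law. *)
transitivity (rate%:E * \int[lebesgue_measure]_s mu (ysection A s)).
  congr (_ * _).
  transitivity (\int[mu]_x lebesgue_measure (xsection A x)).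
    apply: eq_integral => x _; congr (lebesgue_measure _).
    by apply/seteqP; split => s; rewrite /xsection /= inE => -[].
  have := @indic_fubini_tonelli _ _ _ _ R mu (@lebesgue_measure R) A mA.
  by rewrite indic_fubini_tonelli_FE // indic_fubini_tonelli_GE.
have mpdf := measurable_exponential_pdf rate.
rewrite exponential_lawE // expoE [in RHS]integral_mkcond.
have mY : measurable_fun setT (fun s => mu (ysection A s)) by exact: measurable_fun_ysection.
rewrite -ge0_integralZl ?lee_fin ?ltW //.
apply: eq_integral => s _; rewrite patchE; case: ifPn => sD.
  have s0 : (0 < s)%R by apply: D0; rewrite inE in sD.
  rewrite exponential_pdfE ?ltW // EFinM mulNr -lmu ?ltW //; congr (_ * mu _).
  apply/seteqP; split => x; rewrite /ysection /= inE; first by case.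
  by move=> h; split => //=; rewrite inE in sD.
rewrite (_ : ysection A s = set0) ?measure0 ?mule0 //.
apply/seteqP; split => // x; rewrite /ysection /= inE => -[_ /= Ds].
by case/negP: sD; rewrite inE.
Qed.

End ExponentialLaw.

Lemma measurable_set_ler (R : realType) d (T : measurableType d) (f g : T -> R) :
  measurable_fun setT f -> measurable_fun setT g ->
  measurable [set x | f x <= g x]%classic.
Proof.
by move=> mf mg; have := measurable_fun_le measurableT mf mg; rewrite setTI.
Qed.

Lemma measurable_set_ltr (R : realType) d (T : measurableType d) (f g : T -> R) :
  measurable_fun setT f -> measurable_fun setT g ->
  measurable [set x | f x < g x]%classic.
Proof.
move=> mf mg; rewrite (_ : [set _ | _] = ~` [set x | g x <= f x])%classic.
  exact/measurableC/measurable_set_ler.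
by apply/seteqP; split => x /=; rewrite ltNge => /negP.
Qed.

Section ResampledStein.
Local Open Scope ereal_scope.
Local Open Scope classical_set_scope.
Variables (R : realType) (I : finType) (P : probability (vect R I) R) (p : I).
Variables (rate : R) (mu : probability R R).
Hypotheses (rate_gt0 : (0 < rate)%R) (lmu : exponential_law rate mu).
Hypothesis rP : resampled P mu p.

Lemma updK (a : vect R I) (s t : R) : upd (upd a p s) p t = upd a p t.
Proof. by apply/funext => q; rewrite /upd; case: (q == p). Qed.

Lemma upd_at (a : vect R I) (s : R) : upd a p s p = s.
Proof. by rewrite /upd eqxx. Qed.

Lemma measurable_fun_lower (E : set (vect R I)) : measurable E ->
  measurable_fun [set: vect R I]
    (fun a => lebesgue_measure [set s | E (upd a p s) /\ (s < a p)%R]).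
Proof.
move=> mE.
pose A : set (vect R I * measurableTypeR R) :=
  (fun z => updp p (z.1, borel_id z.2)) @^-1` E `&` [set z | (z.2 < z.1 p)%R].
have mA : measurable A.
  apply: measurableI.
    rewrite -[X in measurable X]setTI.
    have m2 : measurable_fun setT (fun z : vect R I * measurableTypeR R => (z.1, borel_id z.2)).
      apply/prod_measurable_funP; split; first exact: measurable_fst.
      exact: measurableT_comp (@measurable_borel_id R) measurable_snd.
    exact: (measurableT_comp (measurable_updp p) m2).
  have m1 : measurable_fun setT (fun z : vect R I * measurableTypeR R => borel_id z.2).
    exact: measurableT_comp (@measurable_borel_id R) measurable_snd.
  have m2 : measurable_fun setT (fun z : vect R I * measurableTypeR R => z.1 p).
    exact: (measurableT_comp (measurable_coord p) measurable_fst).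
  exact: measurable_set_ltr m1 m2.
rewrite (_ : (fun a => _) = (fun a => lebesgue_measure (xsection A a))).
  exact: measurable_fun_xsection.
by apply/funext => a; congr (lebesgue_measure _); apply/seteqP; split => s;
  rewrite /xsection /= inE.
Qed.

(** With the other coordinates fixed, this is [exponential_law_stein] for the slice of [E] in
    coordinate [p]; resampling that coordinate turns both sides into iterated integrals. Only the
    part of the slice below the current entry is measured, and that is the length found in
    [pivot_lower]. *)
Lemma resampled_stein (E : set (vect R I)) : measurable E ->
  (forall a, E a -> (0 < a p)%R) ->
  rate%:E * \int[P]_a lebesgue_measure [set s | E (upd a p s) /\ (s < a p)%R] = P E.
Proof.
move=> mE E0.
have mES a : measurable [set s : R | E (upd a p s)].
  rewrite -[X in measurable X]setTI.
  have m : measurable_fun setT (fun s : R => updp p (a, s)).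
    by apply: measurableT_comp (measurable_updp p) _; exact: measurable_fun_pair.
  exact: m.
have mlow := measurable_fun_lower mE.
rewrite (integral_resampled rP mlow); last by move=> a; exact: measure_ge0.
under eq_integral do under eq_integral do rewrite upd_at.
transitivity (\int[P]_a mu [set s | E (upd a p s)]); last first.
  have mI : measurable_fun [set: vect R I] (fun a => (\1_E a : R)%:E).
    by apply/measurable_EFinP; exact: measurable_indic.
  have I0 a : 0 <= (\1_E a : R)%:E by rewrite lee_fin.
  transitivity (\int[P]_a (\1_E a : R)%:E); last by rewrite integral_indic // setIT.
  rewrite (integral_resampled rP mI I0); apply: eq_integral => a _.
  transitivity (\int[mu]_s (\1_[set s | E (upd a p s)] s : R)%:E).
    by rewrite integral_indic // setIT.
  by apply: eq_integral => s _; rewrite !indicE; congr (_%:R)%:E; apply/idP/idP; rewrite !inE.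
have slice a : rate%:E * \int[mu]_x lebesgue_measure
    [set s | E (upd (upd a p x) p s) /\ (s < x)%R] = mu [set s | E (upd a p s)].
  rewrite -(exponential_law_stein rate_gt0 lmu (mES a)); last first.
    by move=> s /= /E0; rewrite upd_at.
  congr (_ * _); apply: eq_integral => x _; congr (lebesgue_measure _).
  by apply/seteqP; split => s /=; rewrite updK.
have mslice : measurable_fun [set: vect R I] (fun a => \int[mu]_x lebesgue_measure
    [set s | E (upd (upd a p x) p s) /\ (s < x)%R]).
  pose f (z : vect R I * R) := lebesgue_measure
    [set s | E (upd (updp p z) p s) /\ (s < updp p z p)%R].
  have mf : measurable_fun setT f.
    exact: (measurableT_comp mlow (measurable_updp p)).
  have f0 z : 0 <= f z by exact: measure_ge0.
  rewrite (_ : (fun a => _) = fubini_F mu f); first exact: measurable_fun_fubini_tonelli_F.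
  apply/funext => a; apply: eq_integral => x _; rewrite /f /updp /=.
  by rewrite upd_at.
rewrite -ge0_integralZl ?lee_fin ?ltW //; last first.
  by move=> a _; apply: integral_ge0 => x _; exact: measure_ge0.
by apply: eq_integral => a _; exact: slice.
Qed.

End ResampledStein.

Section IndependentFamily.
Local Open Scope ereal_scope.
Local Open Scope classical_set_scope.
Variables (R : realType) (I : finType) (d : measure_display) (T : measurableType d).
Variables (P : probability T R) (X : I -> {RV P >-> R}).

Definition family (w : T) : vect R I := fun i => X i w.

Lemma measurable_family : measurable_fun setT family.
Proof. by apply: measurable_into => i; exact: measurable_funPT. Qed.

HB.instance Definition _ := isMeasurableFun.Build _ _ _ _ family measurable_family.

Definition joint_law : probability (vect R I) R := distribution P family.

Variables (D : {set I}) (c : I -> R).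
Hypothesis indep : mutually_independent D X.
Hypothesis const : forall i, i \notin D -> forall w, X i w = c i.

Lemma joint_law_box (A : I -> set R) : (forall i, measurable (A i)) ->
  joint_law [set a | forall i, A i (a i)] =
  if `[< forall i, i \notin D -> A i (c i) >]
  then \prod_(i in D) P (X i @^-1` A i) else 0.
Proof.
move=> mA; rewrite /joint_law /distribution /pushforward.
case: asboolP => [AC|AC].
  rewrite -indep //; congr (P _); apply/seteqP; split => w /= h i; first by move=> _; exact: h.
  have [iD|iD] := boolP (i \in D); first exact: h.
  by rewrite /family const //; exact: AC.
rewrite -(measure0 P); congr (P _); apply/seteqP; split => // w /= h.
by apply: AC => i iD; rewrite -(const iD w); exact: h.
Qed.

Lemma resampled_joint_law p : p \in D ->
  resampled joint_law (distribution P (X p)) p.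
Proof.
move=> pD E mE.
pose m2 : probability (vect R I) R :=
  distribution (joint_law \x distribution P (X p)) (@updp R I p).
rewrite -[RHS]/(m2 E).
have mb : @boxes R I `<=` (measurable : set (set (vect R I))) by move=> _ [A mA ->]; exact: measurable_box.
have bT : @boxes R I setT by exists (fun=> setT) => //; apply/seteqP; split.
apply: (@g_sigma_algebra_measure_unique _ R (vect R I) (@boxes R I) mb (fun=> setT)) => //.
- by apply/seteqP; split => // x _; exists 0%N.
- move=> _ _ [A mA ->] [B mB ->]; exists (fun i => A i `&` B i).
    by move=> i; exact: measurableI.
  by apply/seteqP; split => a /= => [[h1 h2] i|h]; [split; [exact: h1|exact: h2]|split => i; case: (h i)].
- move=> _ [A mA ->].
  (* After resampling, the constraint at [p] bears on the fresh value only, so the old value at [p]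
     is left free. *)
  pose A' i := if i == p then setT else A i.
  have mA' i : measurable (A' i) by rewrite /A'; case: ifP.
  have m2E : m2 [set a | forall i, A i (a i)] =
      joint_law [set a | forall i, A' i (a i)] * distribution P (X p) (A p).
    rewrite -product_measure1E //; last exact: measurable_box.
    rewrite /m2 /pushforward /=; congr (product_measure1 _ _ _).
    apply/seteqP; split => -[a s] /=.
      move=> h; split=> [i|]; last by have := h p; rewrite /updp /upd eqxx.
      by rewrite /A'; case: (eqVneq i p) => // ip; have := h i; rewrite /updp /upd (negPf ip).
    move=> [h1 h2] i; rewrite /updp /upd; case: (eqVneq i p) => [->//|ip].
    by have := h1 i; rewrite /A' (negPf ip).
  rewrite joint_law_box // in m2E.
  apply: etrans (joint_law_box mA) _; apply: etrans (esym m2E).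
  have -> : `[< forall i, i \notin D -> A' i (c i) >] = `[< forall i, i \notin D -> A i (c i) >].
    apply: asbool_equiv_eq; split => h i iD; have := h i iD; rewrite /A';
      by have -> : (i == p) = false by apply: contraNF iD => /eqP->.
  case: ifP => _; last by rewrite mul0e.
  rewrite (bigD1 p) //= [in RHS](bigD1 p) //= /A' eqxx preimage_setT probability_setT mul1e.
  rewrite muleC; congr (_ * _); apply: eq_bigr => i /andP[_ /negPf ip].
  by rewrite ip.
- by move=> _; apply: le_lt_trans (probability_le1 _ _) _; rewrite ?ltry.
Qed.

End IndependentFamily.

Lemma measurable_fun_bigmin (R : realType) d (T : measurableType d) (K : Type)
    (s : seq K) (P : pred K) (f0 : T -> R) (F : K -> T -> R) :
  measurable_fun setT f0 -> (forall i, measurable_fun setT (F i)) ->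
  measurable_fun setT (fun x => \big[Num.min/f0 x]_(i <- s | P i) F i x).
Proof.
move=> mf0 mF; elim: s => [|i s IH].
  by rewrite (_ : (fun x => _) = f0) //; apply/funext => x; rewrite big_nil.
case Pi : (P i); last first.
  rewrite (_ : (fun x => _) = (fun x => \big[Num.min/f0 x]_(j <- s | P j) F j x)) //.
  by apply/funext => x; rewrite big_cons Pi.
rewrite (_ : (fun x => _) =
    (fun x => Num.min (F i x) (\big[Num.min/f0 x]_(j <- s | P j) F j x))).
  exact: measurable_minr.
by apply/funext => x; rewrite big_cons Pi.
Qed.

(** * The events of the chain: stages and pivots *)

Section PivotIdentity.
Local Open Scope ereal_scope.
Local Open Scope classical_set_scope.
Variables (R : realType) (I J : finType) (Z : {set I * J}).
Local Notation mat := (vect R (I * J)%type).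
Local Notation colT := [set: J]%SET.
Implicit Types (Q : {set I}) (B : {set J}).

Lemma measurable_total (S : {set I * J}) :
  measurable_fun [set: mat] (fun a => total a S).
Proof.
rewrite (_ : (fun a => _) = (fun a : mat => (\sum_(p <- enum S) a p)%R)); last first.
  by apply/funext => a; rewrite /total big_enum.
by apply: measurable_sum => p; exact: measurable_coord.
Qed.

Lemma measurable_vmin k X Y : measurable_fun [set: mat] (fun a => vmin a k X Y).
Proof.
apply: measurable_fun_bigmin => [|S]; exact: measurable_total.
Qed.

Lemma measurable_forall_set (K : finType) d (T : measurableType d) (F : K -> set T) :
  (forall i, measurable (F i)) -> measurable [set x | forall i, F i x].
Proof.
move=> mF; rewrite (_ : [set _ | _] = \bigcap_(i in [set: K]) F i).
  by apply: fin_bigcap_measurable => // i _; exact: mF.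
by apply/seteqP; split => x /= h i => [_|]; exact: h.
Qed.

Lemma measurable_zeros_exactly : measurable [set a : mat | zeros_exactly Z a].
Proof.
rewrite (_ : [set _ | _] = [set a : mat | forall p,
    (if p \in Z then [set a : mat | a p == 0%R] else [set a : mat | (0 < a p)%R]) a]).
  apply: measurable_forall_set => p; case: ifP => _.
    rewrite (_ : [set _ | _] = (fun a : mat => a p) @^-1` [set 0%R]).
      by rewrite -[X in measurable X]setTI; exact: measurable_coord.
    by apply/seteqP; split => a /=; [move/eqP|move=> ->].
  by apply: measurable_set_ltr => //; exact: measurable_coord.
apply/seteqP; split => a /=.
  by move=> /forallP h p; have := h p; case: ifP.
by move=> h; apply/forallP => p; have := h p; case: ifP.
Qed.

Lemma measurable_settled Q B : measurable [set a : mat | settled Z Q B a].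
Proof.
rewrite (_ : [set _ | _] = [set a : mat | forall S,
    (if adm #|B| (Q :\: outer_rows Z Q B)%SET colT S && (cls S != B)
     then [set a : mat | (vmin a (rk Z Q B) Q colT < total a S)%R] else setT) a]).
  apply: measurable_forall_set => S; case: ifP => // _.
  by apply: measurable_set_ltr; [exact: measurable_vmin|exact: measurable_total].
apply/seteqP; split => a /=.
  move=> /settledP h S; case: ifP => //= /andP[aS /eqP cS].
  by rewrite ltNge; apply/negP => /(h _ aS).
move=> h; apply/settledP => S aS tS; have := h S; rewrite aS /=.
by case: eqVneq => //= _; rewrite ltNge tS.
Qed.

Definition stage Q B : set mat := [set a | zeros_exactly Z a && settled Z Q B a].

(** For [i] among the inner rows and [d] outside [B], [next_le] makes the inequality an equality:
    the optimum of the next size is reached through the entry [(i, d)]. *)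
Definition pivot Q B i d : set mat := [set a | stage Q B a /\
  (vmin a #|B| ((Q :\: outer_rows Z Q B) :\ i)%SET B + a (i, d)
     <= vmin a (rk Z Q B).+1 Q colT)%R].

Lemma measurable_stage Q B : measurable (stage Q B).
Proof.
rewrite (_ : stage Q B = [set a | zeros_exactly Z a] `&` [set a | settled Z Q B a]).
  by apply: measurableI; [exact: measurable_zeros_exactly|exact: measurable_settled].
by apply/seteqP; split => a /= => [/andP[]|[h1 h2]] //; exact/andP.
Qed.

Lemma measurable_pivot Q B i d : measurable (pivot Q B i d).
Proof.
apply: measurableI; first exact: measurable_stage.
apply: measurable_set_ler; last exact: measurable_vmin.
by apply: measurable_funD; [exact: measurable_vmin|exact: measurable_coord].
Qed.

Lemma measurable_threshold Q k i : measurable_fun [set: mat] (fun a => threshold Q a k i).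
Proof. by apply: measurable_funB; exact: measurable_vmin. Qed.

End PivotIdentity.

Section PivotFiber.
Local Open Scope ereal_scope.
Local Open Scope classical_set_scope.
Variables (R : realType) (I J : finType) (Z : {set I * J}).
Local Notation mat := (vect R (I * J)%type).
Local Notation colT := [set: J]%SET.
Variables (Q : {set I}) (B : {set J}) (i : I) (d : J) (a : mat).
Local Notation L := (Q :\: outer_rows Z Q B)%SET.
Local Notation r := (rk Z Q B).
Local Notation p := (i, d).
Hypotheses (fB : flat Z Q B) (rQ : (r < #|Q|)%N) (rJ : (r < #|colT|)%N).
Hypotheses (iL : i \in L) (dB : d \notin B) (ga : zeros_exactly Z a).

Let pZ : p \notin Z.
Proof.
move: iL; rewrite finset.in_setD => /andP[iU iQ]; apply: contra iU => h.
by apply/outer_rowsP; split => //; exists d.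
Qed.

Let upd_off s q : q != p -> upd a p s q = a q.
Proof. by rewrite /upd => /negPf ->. Qed.

Let zeros_upd s : zeros_exactly Z (upd a p s) = (0 < s)%R.
Proof.
case/zeros_exactlyP: ga => a0 a1; apply/idP/idP => [/zeros_exactlyP[_]/(_ p pZ)|s0].
  by rewrite upd_at.
apply/zeros_exactlyP; split => q qZ.
  by rewrite upd_off ?a0 //; apply: contraNneq pZ => <-.
by case: (eqVneq q p) => [->|qp]; [rewrite upd_at|rewrite upd_off // a1].
Qed.

Lemma le_vmin (a1 a2 : mat) k (X : {set I}) (Y : {set J}) : (k <= #|X|)%N -> (k <= #|Y|)%N ->
  (forall q, (a1 q <= a2 q)%R) -> (vmin a1 k X Y <= vmin a2 k X Y)%R.
Proof.
move=> kX kY h; have [S aS <-] := vmin_attained a2 kX kY.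
by apply: le_trans (vmin_le a1 aS) _; apply: ler_sum.
Qed.

Let phi_upd s : vmin (upd a p s) #|B| (L :\ i)%SET B = vmin a #|B| (L :\ i)%SET B.
Proof.
apply: eq_vmin => // [j e _ eB|]; last exact: le_bLD.
by apply: upd_off; apply: contraNneq dB => -[_ <-].
Qed.

Lemma lebesgue_lower_itv (t v c : R) : (v <= c)%R ->
  lebesgue_measure [set s : R | [/\ (t < s)%R, (s <= v)%R & (s < c)%R]] =
  (Num.max 0 (v - t)%R)%:E.
Proof.
move=> vc; have max_if (b : bool) :
    lebesgue_measure [set` Interval (BRight t) (BSide b v)] = (Num.max 0 (v - t)%R)%:E.
  rewrite lebesgue_measure_itv /= lte_fin; case: ltP => tv.
    by rewrite -EFinB maxEle ltW // subr_gt0.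
  by rewrite maxElt ltNge subr_le0 tv.
move: vc; rewrite le_eqVlt => /orP[/eqP vc|vc].
  rewrite -(max_if true); congr (lebesgue_measure _).
  apply/seteqP; split => s /=; rewrite in_itv /=; first by case=> -> _; rewrite vc => ->.
  by move=> /andP[-> sv]; split; rewrite // -?vc // ltW.
rewrite -(max_if false); congr (lebesgue_measure _).
apply/seteqP; split => s /=; rewrite in_itv /=; first by case=> -> ->.
by move=> /andP[-> sv]; split => //; exact: le_lt_trans vc.
Qed.

(** Lower the entry [(i, d)] of [a] to [s]. By [settled_entry] settledness is an upward half-line,
    so it cannot hold at [s] and fail at [a]. If it holds at [a], the favourable [s] lie above the
    threshold and at most at [V - phi]. This bound does not exceed [a p], so the condition [s < a p]
    removes at most one point. *)
Lemma pivot_lower :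
  lebesgue_measure [set s | pivot Z Q B i d (upd a p s) /\ (s < a p)%R] =
  (if settled Z Q B a then threshold Q a r.+1 i - threshold Q a r i else 0)%:E.
Proof.
have [rQ' rJ'] := (ltnW rQ, ltnW rJ).
case: ifPn => [sa|sa]; last first.
  apply: etrans (measure0 lebesgue_measure); congr (lebesgue_measure _).
  apply/seteqP; split => // s /= -[[/andP[gs ss] _] sap]; case/negP: sa.
  have := settled_lt fB rQ' rJ' gs ss iL dB; rewrite upd_at => ts.
  rewrite (settled_entry fB gs ga rQ' rJ' iL dB _ ss) ?(lt_trans ts) // => q qp.
  exact: upd_off.
rewrite (threshold_step fB rQ' rJ' ga sa rQ rJ iL).
set phi := vmin a #|B| _ B; set V := vmin a r.+1 Q _; set t := (X in (_ - _ - X)%R).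
have t0 : (0 <= t)%R.
  rewrite subr_ge0 -subn1 -(cards1 i); apply: vmin_del_rows => //.
    exact: zeros_exactly_ge0 ga.
  exact: le_bL.
have Vp : (V <= phi + a p)%R := next_le fB ga rQ iL dB.
rewrite -(@lebesgue_lower_itv t (V - phi)%R (a p)); last by rewrite lerBlDl.
congr (lebesgue_measure _); apply/seteqP; split => s /=.
  move=> [[/andP[gs ss] hs] sap]; split => //.
    by have := ss; rewrite (settled_entry fB ga gs rQ' rJ' iL dB _ sa) ?upd_at // => q /upd_off ->.
  (* Lowering an entry does not increase the optimal cost, so [V] still bounds it. *)
  rewrite lerBrDl; move: hs; rewrite phi_upd upd_at => /le_trans; apply.
  apply: le_vmin => // q; case: (eqVneq q p) => [->|/upd_off ->] //.
  by rewrite upd_at ltW.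
move=> [ts sV sap]; split => //.
have gs : zeros_exactly Z (upd a p s) by rewrite zeros_upd (le_lt_trans t0).
have ss : settled Z Q B (upd a p s).
  by rewrite (settled_entry fB ga gs rQ' rJ' iL dB _ sa) ?upd_at // => q /upd_off ->.
split; first by rewrite /stage /= gs.
rewrite phi_upd upd_at -/phi.
(* The new optimum is reached either at [p] itself or at an unchanged entry; in the latter case it
   costs at least [V], hence at least [phi + s]. *)
have [i' [d' [i'L d'B <-]]] := next_attained fB rQ' rJ' gs ss rQ rJ.
have phi_upd' : vmin (upd a p s) #|B| (L :\ i')%SET B = vmin a #|B| (L :\ i')%SET B.
  apply: eq_vmin => // [j e _ eB|]; last exact: le_bLD.
  by apply: upd_off; apply: contraNneq dB => -[_ <-].
rewrite phi_upd'; case: (eqVneq (i', d') p) => [[-> ->]|ne]; first by rewrite upd_at.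
rewrite upd_off //; apply: le_trans (next_le fB ga rQ i'L d'B).
by rewrite -/V -lerBrDl.
Qed.

End PivotFiber.

(** * The chain of settled flats *)

Section GenericMatrix.
Local Open Scope ereal_scope.
Local Open Scope classical_set_scope.
Variables (R : realType) (I J : finType) (Z : {set I * J}).
Local Notation mat := (vect R (I * J)%type).
Local Notation colT := [set: J]%SET.
Implicit Types (Q : {set I}) (B : {set J}) (p q : I * J).
Local Notation U Q B := (outer_rows Z Q B).
Local Notation L Q B := (Q :\: outer_rows Z Q B)%SET.

Definition tie Q B p q : set mat := [set a |
  (vmin a #|B| (L Q B :\ p.1)%SET B + a p = vmin a #|B| (L Q B :\ q.1)%SET B + a q)%R].

Definition competing Q B p q : bool :=
  [&& flat Z Q B, (rk Z Q B < #|Q|)%N, p.1 \in L Q B, p.2 \notin B,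
      q.1 \in L Q B & p != q].

(** Ties are excluded for all [Q] and [B] at once, so that one null set serves the whole recursion
    on the rows. *)
Definition generic : set mat := [set a | zeros_exactly Z a /\
  forall x : {set I} * {set J} * (I * J) * (I * J),
    (if competing x.1.1.1 x.1.1.2 x.1.2 x.2 then ~` tie x.1.1.1 x.1.1.2 x.1.2 x.2
     else setT) a].

Lemma genericP a : generic a -> zeros_exactly Z a /\
  forall Q B p q, competing Q B p q -> ~ tie Q B p q a.
Proof.
move=> [ga h]; split=> // Q B p q cpq.
by have := h (Q, B, p, q); rewrite /= cpq.
Qed.

Lemma measurable_tie Q B p q : measurable (tie Q B p q).
Proof.
rewrite (_ : tie Q B p q = [set a : mat |
    (vmin a #|B| (L Q B :\ p.1)%SET B + a p <= vmin a #|B| (L Q B :\ q.1)%SET B + a q)%R]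
  `&` [set a : mat |
    (vmin a #|B| (L Q B :\ q.1)%SET B + a q <= vmin a #|B| (L Q B :\ p.1)%SET B + a p)%R]).
  by apply: measurableI; apply: measurable_set_ler; apply: measurable_funD;
    (exact: measurable_vmin || exact: measurable_coord).
apply/seteqP; split => a /=; first by move=> ->.
by move=> [h1 h2]; apply/eqP; rewrite eq_le h1 h2.
Qed.

Lemma measurable_generic : measurable generic.
Proof.
apply: measurableI; first exact: measurable_zeros_exactly.
apply: measurable_forall_set => x; case: ifP => // _.
by apply: measurableC; exact: measurable_tie.
Qed.

Variables (P : probability mat R) (wR : I -> R) (wC : J -> R).
Hypothesis wR_gt0 : forall i, (0 < wR i)%R.
Hypothesis wC_gt0 : forall j, (0 < wC j)%R.
Hypothesis P_zeros : P [set a | zeros_exactly Z a] = 1.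
Hypothesis P_entry : forall p, p \notin Z -> exists2 mu : probability R R,
  exponential_law (wR p.1 * wC p.2)%R mu & resampled P mu p.

Lemma inner_notin_zeros Q B p : p.1 \in L Q B -> p.2 \notin B -> p \notin Z.
Proof.
case: p => i d /= iL dB; move: iL; rewrite finset.in_setD /= => /andP[/negP iU iQ]; apply/negP => h.
by apply: iU; apply/outer_rowsP; split => //; exists d.
Qed.

(** Neither minimum reads the entry [p], whose column is outside [B]. Once the other entries are
    fixed, a tie prescribes the value at [p], and a point has measure zero. *)
Lemma tie_null Q B p q : competing Q B p q -> P (tie Q B p q) = 0.
Proof.
case/and5P => fB rQ pL pB /andP[qL pq].
have pZ := inner_notin_zeros pL pB.
have [mu lmu rP] := P_entry pZ.
have rate_gt0 : (0 < wR p.1 * wC p.2)%R by rewrite mulr_gt0.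
rewrite rP; last exact: measurable_tie.
rewrite /= /product_measure1; apply: integral0_eq => a _ /=.
pose c := (vmin a #|B| (L Q B :\ q.1)%SET B + a q - vmin a #|B| (L Q B :\ p.1)%SET B)%R.
rewrite (_ : xsection _ a = [set c]); first exact: exponential_law_set1 lmu _.
have vE s i : i \in L Q B ->
    vmin (upd a p s) #|B| (L Q B :\ i)%SET B = vmin a #|B| (L Q B :\ i)%SET B.
  move=> iL; apply: eq_vmin => // [j e _ eB|]; last exact: (le_bLD fB rQ iL).
  rewrite /upd; case: eqP => // e'; by move: pB; rewrite -e' /= eB.
apply/seteqP; split => s; rewrite /xsection /= inE /tie /= /updp /= !vE // upd_at;
  rewrite /upd eq_sym (negPf pq) /c.
  by move=> <-; rewrite addrAC subrr add0r.
by move=> ->; rewrite addrC subrK.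
Qed.

Lemma generic_ae : {ae P, forall a, generic a}.
Proof.
have null_ae (A : set mat) : measurable A -> P A = 0 -> {ae P, forall a, (~` A) a}.
  by move=> mA A0; exists A; split => // a /= /contrapT.
have az : {ae P, forall a, zeros_exactly Z a}.
  have mz := @measurable_zeros_exactly R I J Z.
  rewrite -[X in {ae P, forall a, X a}]setCK.
  apply: null_ae; first exact: measurableC.
  by rewrite probability_setC // P_zeros subee.
apply: (@filterI _ _ (ae_filter_ringOfSetsType P)) => //.
pose F (x : {set I} * {set J} * (I * J) * (I * J)) : set mat :=
  if competing x.1.1.1 x.1.1.2 x.1.2 x.2 then ~` tie x.1.1.1 x.1.1.2 x.1.2 x.2 else setT.
apply: (@filter_forall _ _ F _ (ae_filter_ringOfSetsType P)) => x; rewrite /F.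
case: ifPn => [cx|_]; last exact: filterT.
exact: (null_ae _ (measurable_tie _ _ _ _) (tie_null cx)).
Qed.

Lemma generic_full : P (~` generic) = 0.
Proof.
apply/negligibleP; first by apply: measurableC; exact: measurable_generic.
exact: generic_ae.
Qed.

End GenericMatrix.

Section PivotUnique.
Local Open Scope classical_set_scope.
Variables (R : realType) (I J : finType) (Z : {set I * J}) (Q : {set I}).
Local Notation mat := (vect R (I * J)%type).
Local Notation colT := [set: J]%SET.
Local Notation L B := (Q :\: outer_rows Z Q B)%SET.
Local Notation rk := (rk Z Q).
Local Notation cl := (cl Z Q).
Local Notation flat := (flat Z Q).
Implicit Types (a : mat) (B : {set J}).

(** Existence is [next_attained] and uniqueness is the absence of ties. Uniqueness of the column is
    also the hypothesis that [settled_next] needs. *)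
Lemma generic_pivot a B : generic Z a -> flat B -> stage Z Q B a ->
  (rk B < #|Q|)%N -> (rk B < #|colT|)%N ->
  exists i d, [/\ i \in L B, d \notin B, pivot Z Q B i d a,
    forall i' d', i' \in L B -> d' \notin B -> pivot Z Q B i' d' a -> (i', d') = (i, d)
    & stage Z Q (cl (d |: B)%SET) a].
Proof.
move=> /genericP[ga nt] fB sBa rQ rJ; have /andP[_ sa] := sBa.
have [i [d [iL dB e]]] := next_attained fB (ltnW rQ) (ltnW rJ) ga sa rQ rJ.
have uniq_id i' d' : i' \in L B -> d' \notin B ->
    vmin a #|B| (L B :\ i')%SET B + a (i', d') <= vmin a (rk B).+1 Q colT -> (i', d') = (i, d).
  move=> iL' dB' h; apply/eqP; apply: contraT => ne; exfalso.
  apply: (nt Q B (i', d') (i, d)); first by rewrite /competing fB rQ iL' dB' iL ne.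
  rewrite /tie /= e; apply/eqP; rewrite eq_le h.
  exact: next_le.
exists i, d; split => //.
- by split => //; rewrite e.
- by move=> i' d' iL' dB' [_]; exact: uniq_id.
apply/andP; split => //; apply: settled_next => // i' d' iL' dB' h.
by have [] := uniq_id _ _ iL' dB' h.
Qed.

Lemma generic_settled a k : generic Z a -> (rk finset.set0 <= k)%N ->
  (k <= #|Q|)%N -> (k <= #|colT|)%N ->
  exists B, [/\ flat B, rk B = k & stage Z Q B a].
Proof.
move=> ga; have [gz _] := genericP ga.
elim: k => [|k IH] k0 kQ kJ.
  exists (cl finset.set0); split; [exact: flat_cl|by apply/eqP; rewrite rk_cl -leqn0|].
  by apply/andP; split => //; have [] := settled_cl0 Q gz.
move: k0; rewrite leq_eqVlt => /orP[/eqP k0|k0].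
  exists (cl finset.set0); split; [exact: flat_cl|by rewrite rk_cl|].
  by apply/andP; split => //; have [] := settled_cl0 Q gz.
have [B [fB rB sB]] := IH k0 (ltnW kQ) (ltnW kJ).
have := generic_pivot ga fB sB; rewrite rB => /(_ kQ kJ) [i [d [_ dB _ _ s']]].
by exists (cl (d |: B)%SET); split; [exact: flat_cl|rewrite rk_cl_setU1 // rB|].
Qed.

Lemma stage_unique a B B' : flat B -> flat B' -> stage Z Q B a -> stage Z Q B' a ->
  rk B = rk B' -> (rk B <= #|Q|)%N -> (rk B <= #|colT|)%N -> B = B'.
Proof.
move=> fB fB' /andP[ga sB] /andP[_ sB'] e rQ rJ.
exact: settled_unique fB fB' ga sB sB' e rQ rJ.
Qed.

Local Notation ind A a := ((a \in A)%:R : R).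

(** The exits from [B], in pointwise form: the stage is left through exactly one pivot. *)
Lemma stage_pivots a B : generic Z a -> flat B ->
  (rk B < #|Q|)%N -> (rk B < #|colT|)%N ->
  ind (stage Z Q B) a = \sum_(d in ~: B) \sum_(i in L B) ind (pivot Z Q B i d) a.
Proof.
move=> ga fB rQ rJ; have [sB|sB] := boolP (a \in stage Z Q B); last first.
  rewrite big1 // => d _; rewrite big1 // => i _.
  rewrite memNset => // -[/mem_set sB' _].
  by rewrite sB' in sB.
rewrite inE in sB.
have [i [d [iL dB piv uq _]]] := generic_pivot ga fB sB rQ rJ.
rewrite (bigD1 d) ?finset.in_setC //= (bigD1 i) //= mem_set //.
rewrite [X in _ + X + _]big1 ?addr0; last first.
  move=> i' /andP[iL' ne]; rewrite memNset // => /(uq _ _ iL' dB)[e].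
  by rewrite e eqxx in ne.
rewrite big1 ?addr0 // => d'.
rewrite finset.in_setC => /andP[dB' ne]; rewrite big1 // => i' iL'.
rewrite memNset // => /(uq _ _ iL' dB')[_ e].
by rewrite e eqxx in ne.
Qed.

(** The entries into [B'], in pointwise form: exactly one flat is settled one rank below, and the
    closure condition tells whether its only pivot leads to [B']. *)
Lemma stage_pred_pivots a B' : generic Z a -> flat B' -> (rk finset.set0 < rk B')%N ->
  (rk B' <= #|Q|)%N -> (rk B' <= #|colT|)%N ->
  ind (stage Z Q B') a = \sum_(B | flat B && ((rk B).+1 == rk B'))
     \sum_(d in ~: B | cl (d |: B)%SET == B') \sum_(i in L B) ind (pivot Z Q B i d) a.
Proof.
move=> ga fB' r0 rQ rJ.
case rk': (rk B') r0 rQ rJ => [//|k] r0 rQ rJ.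
have [B [fB rB sB]] := generic_settled ga r0 (ltnW rQ) (ltnW rJ).
rewrite (bigD1 B) /= ?fB ?rB //= [X in _ = _ + X]big1 ?addr0; last first.
  move=> B2 /andP[/andP[fB2 /eqP[rB2]] ne]; rewrite big1 // => d _; rewrite big1 // => i _.
  rewrite memNset // => -[sB2 _]; move: ne; rewrite -(stage_unique fB fB2 sB sB2) ?rB ?eqxx //.
  exact: ltnW.
  exact: ltnW.
have := generic_pivot ga fB sB; rewrite rB => /(_ rQ rJ) [i [d [iL dB piv uq s']]].
rewrite big_mkcondr (bigD1 d) ?finset.in_setC //= [X in _ = _ + X]big1 ?addr0; last first.
  move=> d'; rewrite finset.in_setC => /andP[dB' ne]; case: ifP => // _.
  rewrite big1 // => i' iL'; rewrite memNset // => /(uq _ _ iL' dB')[_ e].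
  by rewrite e eqxx in ne.
have -> : \sum_(i in L B) ind (pivot Z Q B i d) a = 1.
  rewrite (bigD1 i) //= mem_set // big1 ?addr0 // => i' /andP[iL' ne].
  rewrite memNset // => /(uq _ _ iL' dB)[e].
  by rewrite e eqxx in ne.
case: eqVneq => [<-|ne]; first by rewrite mem_set.
rewrite memNset // => sB'; move/eqP: ne; apply; apply: stage_unique s' sB' _ _ _ => //.
- exact: flat_cl.
- by rewrite rk_cl_setU1 // rB rk'.
- by rewrite rk_cl_setU1 // rB.
- by rewrite rk_cl_setU1 // rB.
Qed.

End PivotUnique.

Lemma integral_sum_cond d (T : measurableType d) (R : realType)
    (mu : {measure set T -> \bar R}) (D : set T) (K : finType) (c : pred K) (f : K -> T -> R) :
  measurable D -> (forall k, c k -> measurable_fun D (f k)) ->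
  (forall k x, c k -> D x -> 0 <= f k x) ->
  (\int[mu]_(x in D) (\sum_(k | c k) f k x)%:E =
   \sum_(k | c k) \int[mu]_(x in D) (f k x)%:E)%E.
Proof.
move=> mD mf f0.
pose f' k x : \bar R := (if c k then f k x else 0)%:E.
have mf' k : measurable_fun D (f' k).
  by rewrite /f'; case ck: (c k); [exact/measurable_EFinP/mf|exact: measurable_cst].
have f'0 k x : D x -> (0 <= f' k x)%E.
  by move=> Dx; rewrite /f'; case: ifP => [ck|_]; rewrite lee_fin // f0.
transitivity (\int[mu]_(x in D) \sum_(k <- index_enum K) f' k x)%E.
  by apply: eq_integral => x _; rewrite big_mkcond /= -sumEFin.
rewrite ge0_integral_sum // [RHS]big_mkcond; apply: eq_bigr => k _ /=.
by rewrite /f'; case: ifP => // _; rewrite integral0_eq.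
Qed.

(** * Slopes and the balance equations of the stages *)

Section Slopes.
Local Open Scope classical_set_scope.
Variables (R : realType) (I J : finType) (Z : {set I * J}).
Local Notation mat := (vect R (I * J)%type).
Local Notation colT := [set: J]%SET.
Local Notation L Q B := (Q :\: outer_rows Z Q B)%SET.
Local Notation rk := (rk Z).
Local Notation cl := (cl Z).
Local Notation flat := (flat Z).
Local Notation ind A a := ((a \in A)%:R : R).
Implicit Types (a : mat) (B : {set J}) (Q : {set I}).
Variables (wR : I -> R).
Hypothesis wR_gt0 : forall i, 0 < wR i.

(** The quantity [S_k(Q)] of the overview. *)
Definition slope Q k a : R := \sum_(i in Q) wR i * threshold Q a k i.

Lemma measurable_slope Q k : measurable_fun [set: mat] (slope Q k).
Proof.
rewrite (_ : slope Q k = fun a : mat => \sum_(i <- enum Q) wR i * threshold Q a k i); last first.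
  by apply/funext => a; rewrite /slope big_enum.
apply: measurable_sum => i; apply: measurable_funM; first exact: measurable_cst.
exact: measurable_threshold.
Qed.

Lemma threshold_step_ge0 Q B a i : flat Q B -> (rk Q B < #|Q|)%N -> (rk Q B < #|colT|)%N ->
  stage Z Q B a -> i \in L Q B -> 0 <= threshold Q a (rk Q B).+1 i - threshold Q a (rk Q B) i.
Proof.
move=> fB rQ rJ /andP[ga sa] iL.
by rewrite (threshold_step fB (ltnW rQ) (ltnW rJ) ga sa rQ rJ iL) le_max lexx.
Qed.

Lemma slope_step Q B a : flat Q B -> (rk Q B < #|Q|)%N -> (rk Q B < #|colT|)%N ->
  ind (stage Z Q B) a * (slope Q (rk Q B).+1 a - slope Q (rk Q B) a) =
  \sum_(i in L Q B) wR i *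
    (ind (stage Z Q B) a * (threshold Q a (rk Q B).+1 i - threshold Q a (rk Q B) i)).
Proof.
move=> fB rQ rJ; have [|_] := boolP (a \in stage Z Q B); last first.
  by rewrite mul0r big1 // => i _; rewrite mul0r mulr0.
rewrite inE => /andP[ga sa]; rewrite mul1r /slope -sumrB (bigID (mem (L Q B))) /=.
rewrite [X in _ + X]big1 ?addr0; last first.
  move=> i /andP[iQ]; rewrite finset.in_setD iQ andbT negbK => iU.
  by rewrite -mulrBr (threshold_outer fB (ltnW rQ) (ltnW rJ) ga sa rQ rJ iU) mulr0.
apply: eq_big => [i|i _]; last by rewrite -mulrBr [1 * _]mul1r.
by rewrite finset.in_setD andbCA andbb.
Qed.

Lemma slope_step_ge0 Q B a : flat Q B -> (rk Q B < #|Q|)%N -> (rk Q B < #|colT|)%N ->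
  0 <= ind (stage Z Q B) a * (slope Q (rk Q B).+1 a - slope Q (rk Q B) a).
Proof.
move=> fB rQ rJ; rewrite slope_step //; apply: sumr_ge0 => i iL.
apply: mulr_ge0; first exact: ltW.
have [|_] := boolP (a \in stage Z Q B); last by rewrite mul0r.
by rewrite inE mul1r => sa; exact: threshold_step_ge0.
Qed.

Lemma le_vmin_card a k l Q : zeros_exactly Z a -> (k <= l)%N ->
  (l <= #|Q|)%N -> (l <= #|colT|)%N -> vmin a k Q colT <= vmin a l Q colT.
Proof.
move=> ga; elim: l => [|l IH]; first by rewrite leqn0 => /eqP ->.
rewrite leq_eqVlt => /orP[/eqP -> //|kl] lQ lJ.
apply: le_trans (IH kl (ltnW lQ) (ltnW lJ)) _.
have /card_gt0P[i iQ] : (0 < #|Q|)%N by exact: leq_trans lQ.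
apply: le_trans (vmin_pred ga i lQ lJ); apply: le_vminS => //.
- exact: subsetDl.
- by move: lQ; rewrite (cardsD1 i) iQ.
- exact: ltnW.
Qed.

Lemma slope_zeros Q k a : zeros_exactly Z a -> (k <= rk Q finset.set0)%N ->
  (rk Q finset.set0 <= #|Q|)%N -> (rk Q finset.set0 <= #|colT|)%N -> slope Q k a = 0.
Proof.
move=> ga k0 rQ rJ; have a_ge0 := zeros_exactly_ge0 ga.
have [_ V0] := settled_cl0 Q ga.
have Vk : vmin a k Q colT = 0.
  by apply/eqP; rewrite eq_le vmin_ge0 // andbT -V0 le_vmin_card.
apply: big1 => i iQ; rewrite /threshold Vk sub0r.
suff -> : vmin a k.-1 (Q :\ i)%SET colT = 0 by rewrite oppr0 mulr0.
apply/eqP; rewrite eq_le vmin_ge0 // andbT -Vk (vmin_pred ga) //; exact: leq_trans k0 _.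
Qed.

(** A telescoping sum over the levels below [k]. From level [rk Q set0] on, each level has exactly
    one settled flat, to which its increment is charged; up to that level all costs, hence all
    slopes, are 0. *)
Lemma slope_sum Q k a : generic Z a -> (k <= #|Q|)%N -> (k <= #|colT|)%N ->
  (rk Q finset.set0 <= #|Q|)%N -> (rk Q finset.set0 <= #|colT|)%N ->
  slope Q k a = \sum_(B | flat Q B && (rk Q B < k)%N)
    ind (stage Z Q B) a * (slope Q (rk Q B).+1 a - slope Q (rk Q B) a).
Proof.
move=> ga kQ kJ r0Q r0J; have [gz _] := genericP ga.
elim: k kQ kJ => [|k IH] kQ kJ.
  by rewrite slope_zeros // big1 // => B; rewrite andbF.
have [k0|k0] := leqP k.+1 (rk Q finset.set0).
  rewrite slope_zeros // big_pred0 // => B; apply/negbTE; rewrite negb_and -leqNgt orbC.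
  by rewrite (leq_trans k0) // rkS // finset.sub0set.
rewrite -[LHS](subrK (slope Q k a)) [X in _ + X = _]IH ?(ltnW kQ) ?(ltnW kJ) //.
have [B0 [fB0 rB0 sB0]] := generic_settled ga (k0 : (_ <= k)%N) (ltnW kQ) (ltnW kJ).
rewrite [RHS](bigD1 B0) /= ?fB0 ?rB0 ?ltnSn //= mem_set // mul1r; congr (_ + _).
rewrite [RHS](bigID (fun B => rk Q B == k)) /= [X in _ = X + _]big1 ?add0r; last first.
  move=> B /andP[/andP[/andP[fB _] ne] /eqP rB]; rewrite memNset ?mul0r // => sB.
  move: ne; rewrite (stage_unique fB fB0 sB sB0) ?rB ?eqxx //; exact: ltnW.
apply: eq_bigl => B; rewrite ltnS; case: flat => //=.
case: (ltngtP (rk Q B) k) => [lt| |] /=; rewrite ?andbF // andbT.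
by apply/esym; apply: contraTneq lt => ->; rewrite rB0 ltnn.
Qed.

End Slopes.

Section StageRates.
Local Open Scope classical_set_scope.
Local Open Scope ereal_scope.
Variables (R : realType) (I J : finType) (Z : {set I * J}).
Local Notation mat := (vect R (I * J)%type).
Local Notation colT := [set: J]%SET.
Local Notation L Q B := (Q :\: outer_rows Z Q B)%SET.
Local Notation rk := (rk Z).
Local Notation cl := (cl Z).
Local Notation flat := (flat Z).
Local Notation ind A a := ((a \in A)%:R : R).
Local Notation generic := (@generic R I J Z).
Implicit Types (a : mat) (B : {set J}) (Q : {set I}).
Variables (P : probability mat R) (wR : I -> R) (wC : J -> R).
Hypothesis wR_gt0 : forall i, (0 < wR i)%R.
Hypothesis wC_gt0 : forall j, (0 < wC j)%R.
Hypothesis P_zeros : P [set a | zeros_exactly Z a] = 1.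
Hypothesis P_entry : forall p, p \notin Z -> exists2 mu : probability R R,
  exponential_law (wR p.1 * wC p.2)%R mu & resampled P mu p.

Let mG : measurable generic := measurable_generic Z.

Lemma prob_generic (A : set mat) : measurable A ->
  P A = \int[P]_(a in generic) (ind A a)%:E.
Proof.
move=> mA; under eq_integral do rewrite -indicE.
rewrite integral_indic //; apply/eqP; rewrite eq_le; apply/andP; split; last first.
  by apply: le_measure; rewrite ?inE //; exact: measurableI.
have mGC : measurable (~` generic) := measurableC mG.
have h : A `<=` (A `&` generic) `|` ~` generic.
  by move=> a Aa; have [ga|nga] := pselect (generic a); [left|right].
apply: le_trans (le_measure _ _ _ h) _; rewrite ?inE //.
  by apply: measurableU => //; exact: measurableI.
apply: le_trans (measureU2 _ _ _) _ => //; first exact: measurableI.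
by rewrite [X in _ + X](generic_full wR_gt0 wC_gt0 P_zeros P_entry) adde0.
Qed.

Lemma measurable_ind (A D : set mat) : measurable A ->
  measurable_fun D (fun a => ind A a).
Proof.
move=> mA; rewrite (_ : (fun a => _) = \1_A); first exact: measurable_indic.
by apply/funext => a; rewrite indicE.
Qed.

Variable Q : {set I}.

(** [resampled_stein] for the pivot event, whose slice below the entry has the length given by
    [pivot_lower]. *)
Lemma pivot_prob B i d : flat Q B -> (rk Q B < #|Q|)%N -> (rk Q B < #|colT|)%N ->
  i \in L Q B -> d \notin B ->
  (wR i * wC d)%:E * \int[P]_(a in generic) (ind (stage Z Q B) a *
     (threshold Q a (rk Q B).+1 i - threshold Q a (rk Q B) i))%:E = P (pivot Z Q B i d).
Proof.
move=> fB rQ rJ iL dB.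
have pZ : (i, d) \notin Z by exact: (@inner_notin_zeros _ _ _ Q B (i, d)).
have [mu lmu rP] := P_entry pZ.
rewrite -(resampled_stein (mulr_gt0 (wR_gt0 i) (wC_gt0 d)) lmu rP).
- congr (_ * _).
  rewrite [RHS](@ge0_negligible_integral _ _ _ P setT (~` generic)) //.
  + rewrite setTD setCK; apply: eq_integral => a; rewrite inE => ga.
    have [gz _] := genericP ga.
    rewrite pivot_lower //; congr (_%:E); case: ifP => sa.
      by rewrite mem_set ?mul1r // /stage /= gz.
    by rewrite memNset ?mul0r // /stage /= sa andbF.
  + exact: measurableC.
  + exact: (measurable_fun_lower (i, d) (measurable_pivot Z Q B i d)).
  + exact: (generic_full wR_gt0 wC_gt0 P_zeros P_entry).
- exact: measurable_pivot.
- by move=> a [/andP[/zeros_exactlyP[_ h] _] _]; exact: h.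
Qed.

Let gain B : \bar R := \int[P]_(a in generic) (ind (stage Z Q B) a *
  (slope wR Q (rk Q B).+1 a - slope wR Q (rk Q B) a))%:E.

Let gain_ge0 B : flat Q B -> (rk Q B < #|Q|)%N -> (rk Q B < #|colT|)%N -> 0 <= gain B.
Proof.
move=> fB rQ rJ; apply: integral_ge0 => a _; rewrite lee_fin; exact: slope_step_ge0.
Qed.

Let measurable_gain B D : measurable_fun D (fun a : mat => ind (stage Z Q B) a *
  (slope wR Q (rk Q B).+1 a - slope wR Q (rk Q B) a))%R.
Proof.
apply: measurable_funM; first by apply: measurable_ind; exact: measurable_stage.
apply: (@measurable_funS _ _ _ _ setT) => //.
by apply: measurable_funB; exact: measurable_slope.
Qed.

(** The integrand in [pivot_prob] does not mention [d]. Summed over the rows with the weights [wR],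
    it becomes the increment of the slope, and the column survives only as the factor [wC d]. *)
Lemma gain_pivots B d : flat Q B -> (rk Q B < #|Q|)%N -> (rk Q B < #|colT|)%N -> d \notin B ->
  (wC d)%:E * gain B = \sum_(i in L Q B) P (pivot Z Q B i d).
Proof.
move=> fB rQ rJ dB.
have mstep i : measurable_fun generic (fun a : mat => ind (stage Z Q B) a *
    (threshold Q a (rk Q B).+1 i - threshold Q a (rk Q B) i))%R.
  apply: measurable_funM; first by apply: measurable_ind; exact: measurable_stage.
  apply: (@measurable_funS _ _ _ _ setT) => //.
  by apply: measurable_funB; exact: measurable_threshold.
have step0 i a : i \in L Q B -> (0 <= ind (stage Z Q B) a *
    (threshold Q a (rk Q B).+1 i - threshold Q a (rk Q B) i))%R.
  move=> iL; have [|_] := boolP (a \in stage Z Q B); last by rewrite mul0r.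
  by rewrite inE mul1r => sa; exact: threshold_step_ge0.
rewrite /gain; under eq_integral do rewrite slope_step //.
rewrite integral_sum_cond //; last 2 first.
- by move=> i _; apply: measurable_funM => //; exact: measurable_cst.
- by move=> i a iL _; apply: mulr_ge0; [exact: ltW|exact: step0].
rewrite ge0_sume_distrr; last first.
  move=> i iL; apply: integral_ge0 => a _; rewrite lee_fin mulr_ge0 ?step0 //; exact: ltW.
apply: eq_bigr => i iL; rewrite -pivot_prob // EFinM [(wR i)%:E * _]muleC -muleA; congr (_ * _).
rewrite -ge0_integralZl //.
- exact/measurable_EFinP.
- by move=> a _; rewrite lee_fin step0.
- by rewrite lee_fin ltW.
Qed.

Lemma prob_stage B : flat Q B -> (rk Q B < #|Q|)%N -> (rk Q B < #|colT|)%N ->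
  P (stage Z Q B) = (\sum_(d in ~: B) wC d)%:E * gain B.
Proof.
move=> fB rQ rJ; rewrite -sumEFin ge0_sume_distrl; last by move=> d _; rewrite lee_fin ltW.
under eq_bigr => d dB.
  rewrite gain_pivots //; last by rewrite finset.in_setC in dB.
  over.
rewrite prob_generic; last exact: measurable_stage.
under eq_integral => a ga.
  rewrite inE in ga; rewrite stage_pivots //; over.
rewrite integral_sum_cond //.
- apply: eq_bigr => d dB; rewrite integral_sum_cond //.
  + by apply: eq_bigr => i iL; rewrite -prob_generic //; exact: measurable_pivot.
  + by move=> i _; apply: measurable_ind; exact: measurable_pivot.
- move=> d _; rewrite (_ : (fun a => _) = fun a : mat => (\sum_(i <- enum (L Q B)) ind (pivot Z Q B i d) a)%R).
    by apply: measurable_sum => i; apply: measurable_ind; exact: measurable_pivot.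
  by apply/funext => a; rewrite big_enum.
- by move=> d a _ _; apply: sumr_ge0.
Qed.

Lemma prob_stage_pred B' : flat Q B' -> (rk Q finset.set0 < rk Q B')%N ->
  (rk Q B' <= #|Q|)%N -> (rk Q B' <= #|colT|)%N ->
  P (stage Z Q B') = \sum_(B | flat Q B && ((rk Q B).+1 == rk Q B'))
     \sum_(d in ~: B | cl Q (d |: B)%SET == B') (wC d)%:E * gain B.
Proof.
move=> fB' r0 rQ rJ.
rewrite prob_generic; last exact: measurable_stage.
under eq_integral => a ga.
  rewrite inE in ga; rewrite stage_pred_pivots //; over.
have mi B d : measurable_fun generic (fun a : mat => \sum_(i in L Q B) ind (pivot Z Q B i d) a)%R.
  rewrite (_ : (fun a => _) = fun a : mat => (\sum_(i <- enum (L Q B)) ind (pivot Z Q B i d) a)%R).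
    by apply: measurable_sum => i; apply: measurable_ind; exact: measurable_pivot.
  by apply/funext => a; rewrite big_enum.
rewrite integral_sum_cond //; last 2 first.
- move=> B _; rewrite (_ : (fun a => _) = fun a : mat => (\sum_(d <- enum [pred d in ~: B | cl Q (d |: B)%SET == B'])
    \sum_(i in L Q B) ind (pivot Z Q B i d) a)%R).
    by apply: measurable_sum => i; exact: mi.
  by apply/funext => a; rewrite big_enum.
- by move=> B a _ _; apply: sumr_ge0 => d _; apply: sumr_ge0.
apply: eq_bigr => B /andP[fB /eqP rB]; rewrite integral_sum_cond //; last first.
  by move=> d a _ _; apply: sumr_ge0.
apply: eq_bigr => d /andP[dB _]; rewrite integral_sum_cond //; last first.
  by move=> i _; apply: measurable_ind; exact: measurable_pivot.
rewrite gain_pivots ?rB //; last by rewrite finset.in_setC in dB.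
by apply: eq_bigr => i iL; rewrite -prob_generic //; exact: measurable_pivot.
Qed.

(** The mean time at [B] of a chain that visits [B] with the probability of its stage and leaves it
    at the total rate of the columns outside. *)
Definition stage_rate B : R := (fine (P (stage Z Q B)) / \sum_(d in ~: B) wC d)%R.

Lemma sum_wC_gt0 B : (rk Q B < #|colT|)%N -> (0 < \sum_(d in ~: B) wC d)%R.
Proof.
move=> rJ; have [d dB] : exists d, d \notin B.
  apply/existsP; rewrite -negb_forall; apply/negP => /forallP allB.
  have [W _ e] := rk_attained Z Q B.
  have BT : B = colT by apply/setP => d; rewrite allB finset.in_setT.
  by move: rJ; rewrite e BT finset.setTU ltnNge leq_addl.
rewrite (bigD1 d) ?finset.in_setC //=; apply: ltr_wpDr => //.
by apply: sumr_ge0 => d' _; exact: ltW.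
Qed.

(** The gain is an integral that might be infinite a priori; in [prob_stage] its product with a
    positive rate is a probability, which excludes this. *)
Lemma gainE B : flat Q B -> (rk Q B < #|Q|)%N -> (rk Q B < #|colT|)%N ->
  gain B = (stage_rate B)%:E.
Proof.
move=> fB rQ rJ; have w0 := sum_wC_gt0 rJ; have g0 := gain_ge0 fB rQ rJ.
have := prob_stage fB rQ rJ; rewrite /stage_rate.
have : P (stage Z Q B) \is a fin_num by apply: fin_num_measure; exact: measurable_stage.
move: g0; case: (gain B) => [x| |] // g0 fP pE.
- by rewrite pE -EFinM /= mulrAC mulfV ?mul1r // lt0r_neq0.
- by move: fP; rewrite pE gt0_muley ?lte_fin.
Qed.

Lemma rk0_le_rows : (rk Q finset.set0 <= #|Q|)%N.
Proof.
apply: leq_trans (rk_le Z _ (finset.sub0set Q)) _; rewrite finset.setD0 finset.set0U.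
suff -> : nbr Z finset.set0 = finset.set0 by rewrite finset.cards0 addn0.
apply/setP => d; rewrite finset.in_set0; apply/negbTE/negP => /nbrP[i].
by rewrite finset.in_set0.
Qed.

Lemma rk0_le_cols : (rk Q finset.set0 <= #|colT|)%N.
Proof.
apply: leq_trans (rk_le Z _ (subxx Q)) _; rewrite finset.setDv finset.cards0 add0n.
exact/subset_leq_card/finset.subsetT.
Qed.

Lemma stage_rate_cl0 : (rk Q finset.set0 < #|colT|)%N ->
  ((\sum_(d in ~: cl Q finset.set0) wC d) * stage_rate (cl Q finset.set0) = 1)%R.
Proof.
rewrite -(rk_cl Z Q finset.set0) => rJ; rewrite mulrC mulfVK ?lt0r_neq0 ?sum_wC_gt0 //.
suff -> : P (stage Z Q (cl Q finset.set0)) = 1 by [].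
apply/eqP; rewrite eq_le; apply/andP; split.
  by apply: probability_le1; exact: measurable_stage.
rewrite -[X in (X <= _)%E]P_zeros.
apply: le_measure; rewrite ?inE; [exact: measurable_zeros_exactly|exact: measurable_stage|].
by move=> a /= ga; rewrite /stage /= ga; have [] := settled_cl0 Q ga.
Qed.

Lemma stage_rate_rec B' : flat Q B' -> (rk Q finset.set0 < rk Q B')%N ->
  (rk Q B' < #|Q|)%N -> (rk Q B' < #|colT|)%N ->
  ((\sum_(d in ~: B') wC d) * stage_rate B' =
   \sum_(B | flat Q B && ((rk Q B).+1 == rk Q B'))
     \sum_(d in ~: B | cl Q (d |: B)%SET == B') wC d * stage_rate B)%R.
Proof.
move=> fB' r0 rQ rJ; apply: EFin_inj; rewrite EFinM -gainE // -prob_stage //.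
rewrite (prob_stage_pred fB' r0 (ltnW rQ) (ltnW rJ)) -sumEFin; apply: eq_bigr => B /andP[fB /eqP rB].
rewrite -sumEFin; apply: eq_bigr => d _; rewrite EFinM gainE //.
  by apply: leq_trans (ltnW rQ); rewrite rB.
by apply: leq_trans (ltnW rJ); rewrite rB.
Qed.

Lemma expected_slope_stages k : (k <= #|Q|)%N -> (k <= #|colT|)%N ->
  \int[P]_(a in generic) (slope wR Q k a)%:E =
  (\sum_(B | flat Q B && (rk Q B < k)%N) stage_rate B)%:E.
Proof.
move=> kQ kJ; under eq_integral => a ga.
  rewrite inE in ga; rewrite (slope_sum wR ga kQ kJ rk0_le_rows rk0_le_cols); over.
rewrite integral_sum_cond //.
  rewrite -sumEFin; apply: eq_bigr => B /andP[fB rB].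
  by apply: gainE => //; exact: leq_trans rB _.
move=> B a /andP[fB rB] _; apply: slope_step_ge0 => //; exact: leq_trans rB _.
Qed.

End StageRates.

(** * Urns *)

Section OccupationWeights.
Local Open Scope classical_set_scope.
Variables (R : realType) (K : finType) (w : K -> R).
Hypothesis w_gt0 : forall i, 0 < w i.
Implicit Types (Q X Y : {set K}).
Local Notation ray := (`[0%R, +oo[ : set R).

(* The probability that, among the independent clocks of [Q], those that have rung by time
   [x] are exactly the clocks of [X]. *)
Definition occ Q X (x : R) : R :=
  \prod_(i in Q) (if i \in X then 1 - expR (- (w i * x)) else expR (- (w i * x))).

Lemma occ_ge0 Q X x : 0 <= x -> 0 <= occ Q X x.
Proof.
move=> x0; apply: prodr_ge0 => i _; case: ifP => _; last exact: expR_ge0.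
by rewrite subr_ge0 expR_le1 oppr_le0 mulr_ge0 // ltW.
Qed.

Lemma measurable_occ Q X D : measurable D -> measurable_fun D (occ Q X).
Proof.
move=> mD; apply: (@measurable_funS _ _ _ _ setT) => //.
rewrite (_ : occ Q X = fun x => \prod_(i <- enum Q)
   (if i \in X then 1 - expR (- (w i * x)) else expR (- (w i * x)))); last first.
  by apply/funext => x; rewrite big_enum.
have me i : measurable_fun setT (fun x : R => expR (- (w i * x))).
  apply: measurableT_comp => //; apply: measurable_funN.
  by apply: measurable_funM => //; exact: measurable_cst.
apply: measurable_prod => i _; case: (i \in X) => //.
by apply: measurable_funB => //; exact: measurable_cst.
Qed.

Lemma occ_split Q X c x : c \in Q -> c \notin X ->
  occ Q X x + occ Q (c |: X)%SET x = occ (Q :\ c)%SET X x.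
Proof.
move=> cQ cX; rewrite /occ (bigD1 c) //= (negPf cX) [in X in _ + X](bigD1 c) //=.
rewrite finset.in_setU1 eqxx /=.
have qE (F : K -> R) : \prod_(i in Q | i != c) F i = \prod_(i in (Q :\ c)%SET) F i.
  by apply: eq_bigl => i; rewrite finset.in_setD1 andbC.
rewrite !qE [X in _ + _ * X](_ : _ = \prod_(i in (Q :\ c)%SET)
   (if i \in X then 1 - expR (- (w i * x)) else expR (- (w i * x)))).
  by rewrite -mulrDl addrC subrK mul1r.
by apply: eq_bigr => i; rewrite finset.in_setD1 finset.in_setU1 => /andP[/negPf -> _].
Qed.

Lemma occ0 Q x : occ Q finset.set0 x = expR (- ((\sum_(i in Q) w i) * x)).
Proof.
rewrite mulr_suml -sumrN expR_sum; apply: eq_bigr => i _.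
by rewrite finset.in_set0.
Qed.

(** The normalisation of the exponential density replaces the computation of an antiderivative. *)
Lemma integral_expR_ray (c : R) : 0 < c ->
  (\int[lebesgue_measure]_(x in ray) (expR (- (c * x)))%:E = c^-1%:E)%E.
Proof.
move=> c0; set X := integral _ _ _.
have cX : (c%:E * X = 1)%E.
  have mE : measurable_fun ray (fun x : R => (expR (- (c * x)))%:E).
    apply/measurable_EFinP; apply: (@measurable_funS _ _ _ _ setT) => //.
    apply: measurableT_comp => //; apply: measurable_funN.
    by apply: measurable_funM => //; exact: measurable_cst.
  rewrite /X -ge0_integralZl ?lee_fin ?ltW //.
  rewrite -(integral_exponential_pdf c0) integral_mkcond; apply: eq_integral => x _.
  by rewrite /exponential_pdf /patch; case: ifP => // _; rewrite -EFinM mulNr.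
have X0 : (0 <= X)%E by apply: integral_ge0 => x _; rewrite lee_fin expR_ge0.
move: X cX X0 => [x| |] //; last by rewrite gt0_muley.
by rewrite -EFinM => -[cx] _; congr EFin; rewrite -[RHS]mulr1 -cx mulKf // lt0r_neq0.
Qed.

(* The expected time spent at [X]; the integral is infinite, and the junk value 0, for [X = Q]. *)
Definition weight Q X : R := fine (\int[lebesgue_measure]_(x in ray) (occ Q X x)%:E)%E.

Lemma sum_w_gt0 Q : Q != finset.set0 -> 0 < \sum_(i in Q) w i.
Proof.
case/finset.set0Pn => i iQ; rewrite (bigD1 i) //=; apply: ltr_wpDr => //.
by apply: sumr_ge0 => j _; exact: ltW.
Qed.

Let occ_int Q X : \bar R := (\int[lebesgue_measure]_(x in ray) (occ Q X x)%:E)%E.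

Let occ_int_ge0 Q X : (0 <= occ_int Q X)%E.
Proof.
by apply: integral_ge0 => x /=; rewrite in_itv /= andbT lee_fin => /occ_ge0.
Qed.

Let occ_int_split Q X c : c \in Q -> c \notin X ->
  (occ_int Q X + occ_int Q (c |: X)%SET = occ_int (Q :\ c)%SET X)%E.
Proof.
move=> cQ cX; rewrite /occ_int -ge0_integralD //.
- by apply: eq_integral => x _; rewrite -EFinD occ_split.
- by move=> x /=; rewrite in_itv /= andbT lee_fin => /occ_ge0.
- by apply/measurable_EFinP; exact: measurable_occ.
- by move=> x /=; rewrite in_itv /= andbT lee_fin => /occ_ge0.
- by apply/measurable_EFinP; exact: measurable_occ.
Qed.

(** Forgetting a clock of [X] can only increase the integral. The induction ends at the empty set,
    where the rate is a sum over at least one clock because [X] is proper in [Q]. *)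
Lemma occ_integral Q X : X \proper Q -> (\int[lebesgue_measure]_(x in ray) (occ Q X x)%:E = (weight Q X)%:E)%E.
Proof.
move=> XQ; rewrite fineK // -/(occ_int Q X) ge0_fin_numE //.
have [n] := ubnP #|X|; elim: n => // n IH in Q X XQ *; rewrite ltnS => Xn.
have [->|[c cX]] := set_0Vmem X.
  rewrite /occ_int; under eq_integral do rewrite occ0.
  rewrite integral_expR_ray ?ltry // sum_w_gt0 //; apply: contraTneq XQ => ->.
  by rewrite fintype.properE finset.sub0set andbF.
have cQ : c \in Q by apply: (fintype.subsetP (fintype.proper_sub XQ)).
have XE : X = (c |: (X :\ c))%SET by rewrite finset.setD1K.
rewrite XE; apply: le_lt_trans (_ : occ_int (Q :\ c)%SET (X :\ c)%SET < _)%E.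
  by rewrite -(@occ_int_split Q (X :\ c)%SET c) ?finset.setD11 // leeDr.
apply: IH; last by move: Xn; rewrite (cardsD1 c X) cX.
rewrite finset.properEcard finset.setSD ?fintype.proper_sub //=.
by have := fintype.proper_card XQ; rewrite (cardsD1 c X) (cardsD1 c Q) cX cQ.
Qed.

Lemma weight_ge0 Q X : 0 <= weight Q X.
Proof. exact/fine_ge0/occ_int_ge0. Qed.

Lemma weight0 Q : Q != finset.set0 -> weight Q finset.set0 = (\sum_(i in Q) w i)^-1.
Proof.
move=> Q0; rewrite /weight; under eq_integral do rewrite occ0.
by rewrite integral_expR_ray // sum_w_gt0.
Qed.

Lemma weight_split Q X c : c \in Q -> c \notin X -> (c |: X)%SET \proper Q ->
  weight (Q :\ c)%SET X = weight Q X + weight Q (c |: X)%SET.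
Proof.
move=> cQ cX XQ.
have XQ' : X \proper Q by apply: fintype.sub_proper_trans XQ; exact: finset.subsetUr.
have XQc : X \proper (Q :\ c)%SET.
  rewrite finset.properEcard finset.subsetD1 fintype.proper_sub //= cX.
  by have := fintype.proper_card XQ; rewrite finset.cardsU1 cX (cardsD1 c Q) cQ.
apply: EFin_inj; rewrite EFinD -!occ_integral //.
by apply/esym; exact: occ_int_split.
Qed.

(* The two sides differ by the integral of the derivative of [occ Q X]; the induction on [X]
   avoids differentiating the product. *)
Lemma weight_balance Q X : X \proper Q ->
  (\sum_(i in (Q :\: X)%SET) w i) * weight Q X =
  (X == finset.set0)%:R + \sum_(c in X) w c * weight Q (X :\ c)%SET.
Proof.
have [n] := ubnP #|X|; elim: n => // n IH in Q X *; rewrite ltnS => Xn XQ.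
have [X0|[c cX]] := set_0Vmem X.
  have Q0 : Q != finset.set0 by apply: contraTneq XQ => ->; rewrite fintype.properE finset.sub0set andbF.
  rewrite X0 eqxx big_set0 addr0 finset.setD0 weight0 // mulfV // lt0r_neq0 //.
  exact: sum_w_gt0.
have cQ : c \in Q by apply: (fintype.subsetP (fintype.proper_sub XQ)).
have [Y YE] : exists Y, Y = (X :\ c)%SET by exists (X :\ c)%SET.
have cY : c \notin Y by rewrite YE finset.setD11.
have XE : X = (c |: Y)%SET by rewrite YE finset.setD1K.
have Yn : (#|Y| < n)%N by move: Xn; rewrite YE (cardsD1 c X) cX.
have YQ : Y \proper Q by rewrite YE; apply: fintype.sub_proper_trans XQ; exact: finset.subsetDl.
have YQc : Y \proper (Q :\ c)%SET.
  rewrite YE finset.properEcard finset.setSD ?fintype.proper_sub //=.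
  by have := fintype.proper_card XQ; rewrite (cardsD1 c X) (cardsD1 c Q) cX cQ.
have -> : (X == finset.set0) = false by apply/eqP => X0; rewrite X0 finset.in_set0 in cX.
(* The balances of [Y] in [Q :\ c] and in [Q] are subtracted; their initial terms cancel, and the
   clock [c], present in the second only, produces the term [w c * weight Q Y]. *)
have gX : weight Q X = weight (Q :\ c)%SET Y - weight Q Y.
  by rewrite (weight_split cQ cY) -?XE // addrAC subrr add0r.
have setE : (Q :\: X = (Q :\ c) :\: Y)%SET.
  apply/setP => i; rewrite XE !finset.in_setD !finset.in_setU1 finset.in_set1 negb_or.
  by case: (i == c); case: (i \in Y); case: (i \in Q).
have sumE : \sum_(i in (Q :\: Y)%SET) w i = w c + \sum_(i in ((Q :\ c) :\: Y)%SET) w i.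
  rewrite (bigD1 c) /=; last by rewrite finset.in_setD cY cQ.
  by congr (_ + _); apply: eq_bigl => i; rewrite !finset.in_setD finset.in_set1;
    case: (i == c); case: (i \in Y); case: (i \in Q).
have := IH _ _ Yn YQ; have := IH _ _ Yn YQc; rewrite sumE => e1 e2.
rewrite (bigD1 c cX) /= gX setE mulrBr e1.
have -> : (\sum_(i in ((Q :\ c) :\: Y)%SET) w i) * weight Q Y =
  (Y == finset.set0)%:R + \sum_(d in Y) w d * weight Q (Y :\ d)%SET - w c * weight Q Y.
  by rewrite -e2 mulrDl addrAC subrr add0r.
have -> : \sum_(d in X | d != c) w d * weight Q (X :\ d)%SET =
    \sum_(d in Y) w d * (weight (Q :\ c)%SET (Y :\ d)%SET - weight Q (Y :\ d)%SET).
  apply: eq_big => [d|d /andP[dX dc]]; first by rewrite YE finset.in_setD1 andbC.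
  congr (_ * _).
  have XdE : (X :\ d = c |: (Y :\ d))%SET.
    apply/setP => i; rewrite YE !finset.in_setU1 !finset.in_setD1.
    by case: (eqVneq i c) => [->|] //=; rewrite eq_sym dc cX.
  have cYd : c \notin (Y :\ d)%SET by rewrite YE !finset.in_setD1 eqxx !andbF.
  rewrite (weight_split cQ cYd) -?XdE; first by rewrite addrAC subrr add0r.
  by apply: fintype.sub_proper_trans XQ; exact: finset.subsetDl.
under [X in _ = _ + (_ + X)]eq_bigr do rewrite mulrBr.
rewrite sumrB -YE; ring.
Qed.

End OccupationWeights.

(** * Closures of the column urn *)

Section ClosureWeights.
Variables (R : realType) (I J : finType) (Z : {set I * J}) (Q : {set I}) (wC : J -> R).
Hypothesis wC_gt0 : forall j, 0 < wC j.
Local Notation colT := [set: J]%SET.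
Local Notation rk := (rk Z Q).
Local Notation cl := (cl Z Q).
Local Notation flat := (flat Z Q).
Local Notation g := (weight wC colT).
Implicit Types (B X Y : {set J}).

(** The expected time during which the closure of the column urn equals [B]. *)
Definition closure_weight B : R := \sum_(Y : {set J} | cl Y == B) g Y.

Lemma proper_colT B : (rk B < #|colT|)%N -> B \proper colT.
Proof.
move=> rB; rewrite finset.properT; apply: contraTneq rB => ->.
have [W _ ->] := rk_attained Z Q colT.
by rewrite finset.setTU -leqNgt leq_addl.
Qed.

Lemma big_fibers (A K : finType) (P : pred A) (f : K -> A) (F : A -> K -> R) :
  \sum_(x | P x) \sum_(k | f k == x) F x k = \sum_(k | P (f k)) F (f k) k.
Proof.
rewrite [RHS](partition_big f P) //=; apply: eq_bigr => x Px.
apply: eq_big => [k|k /eqP -> //]; case: eqP => [->|]; first by rewrite Px.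
by rewrite andbF.
Qed.

Lemma closure_weight_reindex B' :
  \sum_(Y : {set J} | cl Y == B') \sum_(c in Y) wC c * g (Y :\ c)%SET =
  \sum_(X : {set J}) \sum_(c | (c \notin X) && (cl (c |: X)%SET == B')) wC c * g X.
Proof.
rewrite !pair_big_dep /=.
rewrite (reindex_onto (fun p : {set J} * J => (p.2 |: p.1, p.2)%SET)
   (fun p : {set J} * J => (p.1 :\ p.2, p.2)%SET)) /=; last first.
  by case=> Y c /= /andP[_ cY]; rewrite finset.setD1K.
apply: eq_big => [[X c] /=|[X c] /= /andP[_ /eqP[->]] //].
rewrite finset.in_setU1 eqxx /= andbT andbC; congr (_ && _).
apply/eqP/idP => [[<-]|cX]; first by rewrite finset.setD11.
by rewrite finset.setU1K.
Qed.

(** [weight_balance] summed over the sets with closure [B']. A move of the urn between two such sets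
    is counted once as an exit and once as an entry, and cancels. *)
Lemma closure_weight_rec B' : flat B' -> (rk B' < #|colT|)%N ->
  (\sum_(d in ~: B') wC d) * closure_weight B' = (cl finset.set0 == B')%:R +
   \sum_(B | flat B && ((rk B).+1 == rk B'))
     \sum_(d in ~: B | cl (d |: B)%SET == B') wC d * closure_weight B.
Proof.
move=> fB' rJ; have B'T := proper_colT rJ.
(* The urn leaves [Y] at the rate of [~: Y]; the share of [B' :\: Y] keeps the closure unchanged and
   is subtracted on the right. *)
have term Y : cl Y == B' -> (\sum_(d in ~: B') wC d) * g Y = (Y == finset.set0)%:R +
    \sum_(c in Y) wC c * g (Y :\ c)%SET - \sum_(c in (B' :\: Y)%SET) wC c * g Y.
  move=> /eqP cY; have YB : Y \subset B' by rewrite -cY sub_cl.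
  have := weight_balance wC_gt0 (fintype.sub_proper_trans YB B'T) => <-.
  rewrite -mulr_suml -mulrBl; congr (_ * _).
  rewrite [X in _ = X - _](bigID (mem B')) /= [X in X + _ - _](_ : _ =
    \sum_(c in (B' :\: Y)%SET) wC c); last first.
    by apply: eq_bigl => d; rewrite !finset.in_setD finset.in_setT andbT.
  rewrite addrAC subrr add0r.
  apply: eq_bigl => d; rewrite finset.in_setD finset.in_setT finset.in_setC andbT.
  case dB: (d \in B'); rewrite ?andbF // andbT; apply/esym.
  by apply: contraFN dB => /(fintype.subsetP YB).
rewrite /closure_weight mulr_sumr (eq_bigr _ (fun Y cY => term Y cY)) sumrB big_split /=.
rewrite -addrA; congr (_ + _).
  rewrite big_mkcond (bigD1 finset.set0) //= eqxx big1 ?addr0; first by case: eqP.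
  by move=> Y /negPf ->; rewrite if_same.
rewrite closure_weight_reindex (bigID (fun X => cl X == B')) /= addrAC -[RHS]add0r.
congr (_ + _).
  apply/eqP; rewrite subr_eq0; apply/eqP; apply: eq_bigr => X /eqP cX.
  apply: eq_bigl => c; rewrite finset.in_setD; case: (boolP (c \in X)) => //= ncX.
  apply/eqP/idP => [<-|cB]; last by rewrite cl_setU1_in ?cX.
  by apply: (fintype.subsetP (sub_cl _ _ _)); rewrite finset.setU11.
transitivity (\sum_(B | flat B && ((rk B).+1 == rk B'))
   \sum_(X | cl X == B) \sum_(d in ~: B | cl (d |: B)%SET == B') wC d * g X); last first.
  apply: eq_bigr => B _; rewrite exchange_big /=; apply: eq_bigr => d _.
  by rewrite mulr_sumr.
rewrite (big_fibers (fun B => flat B && ((rk B).+1 == rk B')) cl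
  (fun B X => \sum_(d in ~: B | cl (d |: B)%SET == B') wC d * g X)).
rewrite [LHS]big_mkcond [RHS]big_mkcond; apply: eq_bigr => X _.
have [cX|ncX] := eqVneq (cl X) B'.
  by rewrite cX (gtn_eqF (ltnSn _)) andbF.
have predE c : (c \notin X) && (cl (c |: X)%SET == B') =
    (c \in ~: cl X)%SET && (cl (c |: cl X)%SET == B').
  rewrite finset.in_setC cl_setU1_cl; have [cX|cX] := boolP (c \in cl X).
    by rewrite cl_setU1_in // (negPf ncX) andbF.
  by congr (_ && _); apply: contraNN cX; exact: (fintype.subsetP (sub_cl _ _ _)).
transitivity (\sum_(c | (c \in ~: cl X)%SET && (cl (c |: cl X)%SET == B')) wC c * g X).
  exact: eq_bigl.
case: ifPn => // nf.
(* A column outside a flat raises the rank by exactly one, so [B'] is entered only from flats one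
   rank below. *)
apply: big_pred0 => c; apply: contraNF nf => /andP[]; rewrite finset.in_setC => cX /eqP <-.
by rewrite flat_cl rk_cl_setU1 ?flat_cl // eqxx.
Qed.

Lemma sum_closure_weight k : \sum_(B | flat B && (rk B < k)%N) closure_weight B =
  \sum_(Y : {set J} | (rk Y < k)%N) g Y.
Proof.
by rewrite big_fibers; apply: eq_bigl => Y; rewrite flat_cl rk_cl.
Qed.

End ClosureWeights.

Section ExpectedSlope.
Local Open Scope classical_set_scope.
Variables (R : realType) (I J : finType) (Z : {set I * J}).
Local Notation mat := (vect R (I * J)%type).
Local Notation colT := [set: J]%SET.
Local Notation rk := (rk Z).
Local Notation cl := (cl Z).
Local Notation flat := (flat Z).
Variables (P : probability mat R) (wR : I -> R) (wC : J -> R).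
Hypothesis wR_gt0 : forall i, 0 < wR i.
Hypothesis wC_gt0 : forall j, 0 < wC j.
Hypothesis P_zeros : P [set a | zeros_exactly Z a] = 1%E.
Hypothesis P_entry : forall p, p \notin Z -> exists2 mu : probability R R,
  exponential_law (wR p.1 * wC p.2) mu & resampled P mu p.

(** Both sides obey the same recursion on the rank, with the positive factor of the exit rate on the
    left. *)
Lemma stage_rateE (Q : {set I}) (B : {set J}) : flat Q B -> (rk Q B < #|Q|)%N ->
  (rk Q B < #|colT|)%N -> stage_rate Z P wC Q B = closure_weight Z Q wC B.
Proof.
have [n] := ubnP (rk Q B); elim: n => // n IH in B *; rewrite ltnS => Bn fB rQ rJ.
have w0 := sum_wC_gt0 wC_gt0 rJ.
apply: (mulfI (lt0r_neq0 w0)); rewrite closure_weight_rec //.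
have : (rk Q finset.set0 <= rk Q B)%N by apply: rkS; exact: finset.sub0set.
rewrite leq_eqVlt => /orP[/eqP r0|r0].
  (* The closure of the empty set lies in every flat, and a further column would raise the rank; so
     it is the only flat of minimal rank. The term 1 is its initial mass. *)
  have BE : cl Q finset.set0 = B.
    have sB : cl Q finset.set0 \subset B by rewrite -(cl_id fB) cl_sub // finset.sub0set.
    apply/eqP; rewrite finset.eqEsubset sB /=; apply/fintype.subsetP => d dB.
    apply: contraT => dc.
    have : (rk Q (d |: cl Q finset.set0)%SET <= rk Q B)%N.
      by apply: rkS; rewrite finset.subUset finset.sub1set dB.
    by rewrite (flatP _ _ _ (flat_cl _ _ _) d dc) rk_cl r0 ltnn.
  rewrite BE eqxx [X in _ = _ + X]big_pred0.
    by rewrite addr0 -BE (stage_rate_cl0 wC_gt0 P_zeros) // r0.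
  move=> B0; apply/negP => /andP[_ /eqP e].
  have : (rk Q finset.set0 <= rk Q B0)%N by apply: rkS; exact: finset.sub0set.
  by rewrite r0 -e ltnn.
have -> : (cl Q finset.set0 == B) = false.
  by apply: contraTF r0 => /eqP <-; rewrite rk_cl ltnn.
rewrite (stage_rate_rec wR_gt0 wC_gt0 P_zeros P_entry fB r0 rQ rJ) add0r.
apply: eq_bigr => B0 /andP[fB0 /eqP e]; apply: eq_bigr => d _.
by rewrite IH // e ?(leq_trans _ Bn) // ltnW.
Qed.

Lemma expected_slope (Q : {set I}) k : (k <= #|Q|)%N -> (k <= #|colT|)%N ->
  (\int[P]_(a in @generic R I J Z) (slope wR Q k a)%:E =
   (\sum_(Y : {set J} | (rk Q Y < k)%N) weight wC colT Y)%:E)%E.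
Proof.
move=> kQ kJ; rewrite (expected_slope_stages wR_gt0 wC_gt0 P_zeros P_entry kQ kJ).
rewrite -sum_closure_weight; congr EFin; apply: eq_bigr => B /andP[fB rB].
by apply: stage_rateE => //; exact: leq_trans rB _.
Qed.

End ExpectedSlope.

(** * Partial covers and the recursion on the rows *)

Lemma superset_card (K : finType) (A : {set K}) n : (#|A| <= n)%N -> (n <= #|K|)%N ->
  exists2 B : {set K}, A \subset B & #|B| = n.
Proof.
elim: n => [|n IH] An nK.
  by exists A => //; apply/eqP; rewrite -leqn0.
move: An; rewrite leq_eqVlt => /orP[/eqP An|An]; first by exists A.
have [B AB Bn] := IH An (ltnW nK).
have [c cB] : exists c, c \notin B.
  apply/existsP; rewrite -negb_forall; apply/negP => /forallP allB.
  by move: nK; rewrite -Bn -cardsT ltnNge subset_leq_card //; apply/fintype.subsetP => x _; exact: allB.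
exists (c |: B)%SET; last by rewrite finset.cardsU1 cB Bn.
exact/(fintype.subset_trans AB)/finset.subsetUr.
Qed.

(** The rows missing from a cover that contains [X] are a candidate for the minimum in [rk].
    Conversely, an optimal [W] gives the cover [(~: W, Y :|: nbr Z W)], which is padded with rows to
    exactly [l] files; [l <= m] leaves room for them. *)
Lemma partial_coversP (m n l : nat) (Z : {set 'I_m * 'I_n}) (X : {set 'I_m}) (Y : {set 'I_n}) :
  (l <= m)%N ->
  ((X, Y) \in partial_covers l Z) = (#|X| + rk Z (~: X)%SET Y <= l)%N.
Proof.
move=> lm; rewrite finset.inE; apply/existsP/idP => /= [[[A B] /= /and3P[/andP[/= cov /eqP AB] XA YB]]|].
  have CA : (~: A)%SET \subset (~: X)%SET by rewrite finset.setCS.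
  have := rk_le Z Y CA; rewrite -(leq_add2l #|X|) => /leq_trans; apply.
  rewrite -AB addnA leq_add //.
    rewrite -(cardsID X A) finset.setDE finset.setCK (finset.setIidPr XA) leq_add2l.
    by rewrite finset.setIC -finset.setDE.
  apply: subset_leq_card; rewrite finset.subUset YB; apply/fintype.subsetP => d /nbrP[i].
  rewrite finset.in_setC => iA idZ; move/forall_inP: cov => /(_ _ idZ) /=.
  by rewrite (negPf iA).
have [W WX ->] := rk_attained Z (~: X)%SET Y; set B := (Y :|: _)%SET; rewrite addnA => h.
have nB i d : i \in W -> (i, d) \in Z -> d \in B.
  by move=> iW idZ; rewrite finset.in_setU; apply/orP; right; apply/nbrP; exists i.
have XW : X \subset (~: W)%SET by rewrite -finset.setCS finset.setCK.
have cW : (#|X| + #|~: X :\: W| = #|~: W|)%N.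
  rewrite -(cardsID X (~: W)) (finset.setIidPr XW); congr (_ + #|pred_of_set _|)%N.
  by rewrite !finset.setDE finset.setIC.
rewrite cW in h.
have h1 : (#|~: W| <= l - #|B|)%N by rewrite leq_subRL 1?addnC // (leq_trans _ h) // leq_addl.
have h2 : (l - #|B| <= #|'I_m|)%N by rewrite card_ord (leq_trans (leq_subr _ _)).
have [A WA Al] := superset_card h1 h2.
exists (A, B); apply/and3P; split => /=; last 2 first.
- exact: fintype.subset_trans WA.
- exact: finset.subsetUl.
apply/andP; split => /=; last by rewrite Al subnK // (leq_trans _ h) // leq_addl.
apply/forall_inP => -[i d] idZ /=; have [//|iA] := boolP (i \in A).
apply: nB idZ; apply: contraNT iA => iW.
by apply: (fintype.subsetP WA); rewrite finset.in_setC.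
Qed.

Section Unrolling.
Variables (R : realType) (K : finType) (w : K -> R).
Hypothesis w_gt0 : forall i, 0 < w i.
Implicit Types (Q X : {set K}).

(** First-step analysis of the urn: the first clock of [Q] rings after mean time [1 / w(Q)], it is
    [i] with probability [w i / w(Q)], and the others start afresh. The proof expresses the weights
    of [Q :\ i] by those of [Q] with [weight_split] and collects them with [weight_balance]. *)
Lemma weight_unroll Q k (f : {set K} -> R) : (k < #|Q|)%N ->
  f finset.set0 + \sum_(i in Q) w i *
    \sum_(X : {set K} | (X \subset (Q :\ i)%SET) && (#|X| < k)%N)
       weight w (Q :\ i)%SET X * f (i |: X)%SET =
  (\sum_(i in Q) w i) * \sum_(X : {set K} | (X \subset Q) && (#|X| < k.+1)%N) weight w Q X * f X.
Proof.
move=> kQ.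
have properX X : X \subset Q -> (#|X| < k.+1)%N -> X \proper Q.
  by move=> XQ Xk; rewrite finset.properEcard XQ (leq_trans Xk).
have -> : \sum_(i in Q) w i *
    \sum_(X : {set K} | (X \subset (Q :\ i)%SET) && (#|X| < k)%N)
       weight w (Q :\ i)%SET X * f (i |: X)%SET =
  \sum_(X : {set K} | (X \subset Q) && (#|X| < k.+1)%N)
    \sum_(i in X) w i * (weight w Q (X :\ i)%SET + weight w Q X) * f X.
  under eq_bigr do rewrite mulr_sumr.
  rewrite !pair_big_dep /=.
  rewrite (reindex_onto (fun p : {set K} * K => (p.2, p.1 :\ p.2)%SET)
     (fun p : K * {set K} => (p.1 |: p.2, p.1)%SET)) /=; last first.
    move=> [i X] /= /and3P[iQ]; rewrite finset.subsetD1 => /andP[_ iX] _.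
    by rewrite finset.setU1K.
  apply: eq_big => [[X i] /=|[X i] /= /andP[/and3P[iQ XQ Xk] /eqP[XE]]].
    apply/idP/idP => [/andP[/and3P[iQ XQ Xk] /eqP[XE]]|/andP[/andP[XQ Xk] iX]].
      have iX : i \in X by rewrite -XE finset.setU11.
      rewrite iX andbT -XE finset.subUset finset.sub1set iQ.
      rewrite (fintype.subset_trans XQ) ?finset.subD1set //= finset.cardsU1.
      by rewrite finset.setD11 ltnS.
    rewrite (fintype.subsetP XQ) //= finset.setSD //= finset.setD1K // eqxx andbT.
    by move: Xk; rewrite (cardsD1 i X) iX ltnS.
  have iX : i \in X by rewrite -XE finset.setU11.
  rewrite XE mulrA; congr (_ * _ * _); rewrite -[in RHS]XE.
  rewrite (@weight_split _ _ _ w_gt0 Q _ i) ?finset.setD11 ?XE //.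
  apply: properX.
    rewrite -XE finset.subUset finset.sub1set iQ.
    by rewrite (fintype.subset_trans XQ) ?finset.subD1set.
  by rewrite -XE finset.cardsU1 finset.setD11 ltnS.
have -> : \sum_(X : {set K} | (X \subset Q) && (#|X| < k.+1)%N)
    \sum_(i in X) w i * (weight w Q (X :\ i)%SET + weight w Q X) * f X =
  \sum_(X : {set K} | (X \subset Q) && (#|X| < k.+1)%N)
    ((\sum_(i in Q) w i) * (weight w Q X * f X) - (X == finset.set0)%:R * f X).
  apply: eq_bigr => X /andP[XQ Xk].
  have := weight_balance w_gt0 (properX X XQ Xk) => bal.
  have -> : \sum_(i in Q) w i = \sum_(i in X) w i + \sum_(i in (Q :\: X)%SET) w i.
    rewrite (bigID (mem X)) /=; congr (_ + _); apply: eq_bigl => i.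
      by case iX: (i \in X); rewrite ?andbF // (fintype.subsetP XQ).
    by rewrite finset.in_setD andbC.
  rewrite -mulr_suml; under eq_bigr do rewrite mulrDr.
  rewrite big_split /= -mulr_suml mulrA -mulrBl; congr (_ * _).
  by rewrite mulrDl bal; ring.
rewrite sumrB mulr_sumr addrCA -[RHS]addr0; congr (_ + _).
rewrite (bigD1 finset.set0) /=; last by rewrite finset.sub0set finset.cards0.
rewrite eqxx mul1r big1 ?addr0 ?subrr // => X /andP[_ /negPf ->].
by rewrite mul0r.
Qed.

End Unrolling.

(** * Expectations *)

Section ExpectedMinimum.
Local Open Scope classical_set_scope.
Variables (R : realType) (I J : finType) (Z : {set I * J}).
Local Notation mat := (vect R (I * J)%type).
Local Notation colT := [set: J]%SET.
Local Notation generic := (@generic R I J Z).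
Variables (P : probability mat R) (wR : I -> R) (wC : J -> R).
Hypothesis wR_gt0 : forall i, 0 < wR i.
Hypothesis wC_gt0 : forall j, 0 < wC j.
Hypothesis P_zeros : P [set a | zeros_exactly Z a] = 1%E.
Hypothesis P_entry : forall p, p \notin Z -> exists2 mu : probability R R,
  exponential_law (wR p.1 * wC p.2) mu & resampled P mu p.

Lemma slope_vmin (Q : {set I}) k a : (\sum_(i in Q) wR i) * vmin a k Q colT =
  slope wR Q k a + \sum_(i in Q) wR i * vmin a k.-1 (Q :\ i)%SET colT.
Proof.
by rewrite mulr_suml -big_split /=; apply: eq_bigr => i _; rewrite -mulrDr subrK.
Qed.

Lemma slope_ge0 (Q : {set I}) k a : generic a -> (k <= #|Q|)%N -> (k <= #|colT|)%N ->
  0 <= slope wR Q k a.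
Proof.
move=> ga kQ kJ; rewrite (slope_sum wR ga kQ kJ (rk0_le_rows _ _) (rk0_le_cols _ _)).
apply: sumr_ge0 => B /andP[fB rB].
by apply: slope_step_ge0 => //; exact: leq_trans rB _.
Qed.

Lemma expected_vmin (Q : {set I}) k : (k <= #|Q|)%N -> (k <= #|colT|)%N ->
  (\int[P]_(a in generic) (vmin a k Q colT)%:E =
   (\sum_(X : {set I} | (X \subset Q) && (#|X| < k)%N) weight wR Q X *
     \sum_(Y : {set J} | (rk Z (Q :\: X)%SET Y < k - #|X|)%N) weight wC colT Y)%:E)%E.
Proof.
elim: k Q => [|k IH] Q kQ kJ.
  rewrite big_pred0 => [|X]; last by rewrite andbF.
  by apply: integral0_eq => a _; rewrite vmin0.
(* The expected slope of the rows [Q :\: X] at level [k.+1 - #|X|]. The induction hypothesis for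
   [Q :\ i] and [k] involves the same [f], at the sets [i |: X]. *)
pose f (X : {set I}) := \sum_(Y : {set J} | (rk Z (Q :\: X)%SET Y < k.+1 - #|X|)%N) weight wC colT Y.
have w0 : 0 < \sum_(i in Q) wR i.
  by apply: sum_w_gt0 => //; rewrite -finset.card_gt0 (leq_trans _ kQ).
have mV l X : measurable_fun generic (fun a : mat => (vmin a l X colT)%:E).
  by apply/measurable_EFinP; apply: (@measurable_funS _ _ _ _ setT) => //; exact: measurable_vmin.
have V0 l X a : generic a -> (0 <= (vmin a l X colT)%:E)%E.
  by case/genericP => /zeros_exactly_ge0 a0 _; rewrite lee_fin vmin_ge0.
have mS : measurable_fun generic (fun a : mat => (slope wR Q k.+1 a)%:E).
  by apply/measurable_EFinP; apply: (@measurable_funS _ _ _ _ setT) => //; exact: measurable_slope.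
have mG : measurable generic := measurable_generic Z.
have key : ((\sum_(i in Q) wR i)%:E * \int[P]_(a in generic) (vmin a k.+1 Q colT)%:E =
  ((\sum_(i in Q) wR i) * \sum_(X : {set I} | (X \subset Q) && (#|X| < k.+1)%N) weight wR Q X * f X)%:E)%E.
  rewrite -(weight_unroll wR_gt0 f kQ) -ge0_integralZl ?lee_fin ?ltW //; last by move=> a; exact: V0.
  under eq_integral do rewrite -EFinM slope_vmin EFinD.
  rewrite ge0_integralD //; last 3 first.
  - by move=> a ga; rewrite lee_fin slope_ge0.
  - move=> a ga; rewrite lee_fin; apply: sumr_ge0 => i _.
    by apply: mulr_ge0; [exact: ltW|rewrite -lee_fin; exact: V0].
  - apply/measurable_EFinP.
    rewrite (_ : (fun a => _) = fun a : mat => \sum_(i <- enum Q) wR i * vmin a k.+1.-1 (Q :\ i)%SET colT).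
      apply: measurable_sum => i; apply: measurable_funM; first exact: measurable_cst.
      by apply/measurable_EFinP; exact: mV.
    by apply/funext => a; rewrite big_enum.
  rewrite (expected_slope wR_gt0 wC_gt0 P_zeros P_entry kQ kJ) EFinD; congr (_ + _)%E.
    by rewrite /f finset.setD0 finset.cards0 subn0.
  rewrite integral_sum_cond //; last 2 first.
  - move=> i _; apply: measurable_funM; first exact: measurable_cst.
    by apply/measurable_EFinP; exact: mV.
  - by move=> i a _ ga; apply: mulr_ge0; [exact: ltW|rewrite -lee_fin; exact: V0].
  rewrite -sumEFin; apply: eq_bigr => i iQ; under eq_integral do rewrite EFinM.
  rewrite ge0_integralZl ?lee_fin ?ltW //; last by move=> a; exact: V0.
  have kQi : (k <= #|Q :\ i|)%N by move: kQ; rewrite (cardsD1 i Q) iQ.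
  rewrite IH ?(ltnW kJ) // EFinM; congr (_ * _%:E)%E; apply: eq_bigr => X /andP[XQ Xk].
  have iX : i \notin X by move: XQ; rewrite finset.subsetD1 => /andP[].
  by rewrite /f finset.cardsU1 iX add1n subSS finset.setDDl.
have wE := lt0r_neq0 w0.
(* The right side of [key] is finite, which excludes an infinite expectation before the positive
   factor is cancelled. *)
move: key; rewrite -/f; set V := integral _ _ _; case: V => [v| |].
- by rewrite -EFinM => -[/(mulfI wE) ->].
- by rewrite gt0_muley ?lte_fin.
- by rewrite gt0_muleNy ?lte_fin.
Qed.

End ExpectedMinimum.

Lemma prob_sum d (T : measurableType d) (R : realType) (P : probability T R) (K : finType)
    (c : pred K) (A : set T) (F : K -> set T) :
  measurable A -> (forall k, measurable (F k)) ->
  (forall x, (x \in A)%:R = \sum_(k | c k) (x \in F k)%:R :> R) ->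
  (P A = \sum_(k | c k) P (F k))%E.
Proof.
move=> mA mF AF.
have ind_m (B : set T) : measurable B -> measurable_fun setT (fun x : T => (x \in B)%:R : R).
  move=> mB; rewrite (_ : (fun x => _) = \1_B); first exact: measurable_indic.
  by apply/funext => x; rewrite indicE.
have pE (B : set T) : measurable B -> P B = (\int[P]_x ((x \in B)%:R : R)%:E)%E.
  move=> mB; have := @integral_indic _ _ _ P setT measurableT B mB; rewrite setIT => <-.
  by apply: eq_integral => x _; rewrite indicE.
rewrite pE //; under eq_integral do rewrite AF.
rewrite integral_sum_cond //; last by move=> k _; exact: ind_m.
by apply: eq_bigr => k _; rewrite -pE.
Qed.

Lemma measurable_exists_set (K : finType) d (T : measurableType d) (F : K -> set T) :
  (forall k, measurable (F k)) -> measurable [set x | exists k, F k x]%classic.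
Proof.
move=> mF; rewrite (_ : [set _ | _] = ~` [set x | forall k, (~` F k) x])%classic.
  by apply: measurableC; apply: measurable_forall_set => k; exact: measurableC.
apply/seteqP; split => x /=; first by move=> [k Fk] /(_ k).
by move=> /existsNP[k /contrapT Fk]; exists k.
Qed.

(** * The expected area of the urn process *)

Section UrnExpectation.
Local Open Scope classical_set_scope.
Local Open Scope ereal_scope.
Variables (R : realType) (d : measure_display) (T : measurableType d) (P : probability T R).
Local Notation ray := (`[0%R, +oo[ : set R).
Local Notation leb := (@lebesgue_measure R).

Section OneSide.
Variables (m : nat) (wt : 'I_m -> R) (tau : 'I_m -> {RV P >-> R}).
Local Notation rowT := [set: 'I_m]%SET.

Definition urn_box (X : {set 'I_m}) (x : R) (i : 'I_m) : set R :=
  if i \in X then [set t | (t <= x)%R] else [set t | (x < t)%R].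

Lemma measurable_urn_box X x i : measurable (urn_box X x i).
Proof.
rewrite /urn_box; case: ifP => _.
  by rewrite (_ : [set t | _] = `]-oo, x]) //; apply/seteqP; split => t; rewrite /= in_itv.
by rewrite (_ : [set t | _] = `]x, +oo[) //; apply/seteqP; split => t; rewrite /= in_itv /= andbT.
Qed.

Lemma urnE X x w : (urn (fun i => tau i w) x = X) <-> (forall i, urn_box X x i (tau i w)).
Proof.
split=> [<- i|h].
  by rewrite /urn_box /urn finset.inE; case: ifP => //= /negbT; rewrite -ltNge.
apply/setP => i; have := h i; rewrite /urn_box /urn finset.inE; case: (i \in X) => //=.
by rewrite ltNge => /negbTE.
Qed.

Hypothesis wt_gt0 : forall i, (0 < wt i)%R.
Hypothesis htau : urn_times wt tau.

Lemma urn_prob X x : (0 <= x)%R ->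
  P [set w | forall i, urn_box X x i (tau i w)] = (occ wt rowT X x)%:E.
Proof.
case: htau => te ti x0.
rewrite (_ : [set w | _] = [set w | forall i, i \in rowT -> urn_box X x i (tau i w)]).
  rewrite ti //; last by move=> i; exact: measurable_urn_box.
  rewrite -prodEFin; apply: eq_bigr => i _.
  have pe : P [set w | (x < tau i w)%R] = (expR (- (wt i * x)))%:E by exact: te.
  rewrite /urn_box; case: ifP => _ //.
  have mt : measurable [set w | (x < tau i w)%R].
    by apply: measurable_set_ltr; [exact: measurable_cst|exact: measurable_funPT].
  rewrite (_ : _ @^-1` _ = ~` [set w | (x < tau i w)%R]).
    by rewrite probability_setC // pe EFinB.
  by apply/seteqP; split => w /=; [rewrite leNgt => /negP|move/negP; rewrite -leNgt].
by apply/seteqP; split => w /= h i; [move=> _|]; apply: h; rewrite ?finset.in_setT.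
Qed.

End OneSide.

Variables (m n : nat) (wR : 'I_m -> R) (wC : 'I_n -> R).
Hypothesis wR_gt0 : forall i, (0 < wR i)%R.
Hypothesis wC_gt0 : forall j, (0 < wC j)%R.
Variables (tau : 'I_m -> {RV P >-> R}) (sigma : 'I_n -> {RV P >-> R}).
Hypotheses (htau : urn_times wR tau) (hsigma : urn_times wC sigma).
Hypothesis htausigma : independent_vectors tau sigma.
Variable F : {set {set 'I_m} * {set 'I_n}}.
Hypothesis F_proper : forall G, G \in F -> G.1 \proper [set: 'I_m]%SET /\ G.2 \proper [set: 'I_n]%SET.

Let event (w : T) (x y : R) : Prop := [/\ (0 <= x)%R, (0 <= y)%R &
  (urn (fun i => tau i w) x, urn (fun j => sigma j w) y) \in F].

Lemma event_prob x y : (0 <= x)%R -> (0 <= y)%R -> P [set w | event w x y] =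
  (\sum_(G in F) occ wR [set: 'I_m]%SET G.1 x * occ wC [set: 'I_n]%SET G.2 y)%:E.
Proof.
move=> x0 y0.
pose EX (X : {set 'I_m}) := [set w | forall i, urn_box X x i (tau i w)].
pose EY (Y : {set 'I_n}) := [set w | forall j, urn_box Y y j (sigma j w)].
have mbox (K : nat) (t : 'I_K -> {RV P >-> R}) (X : {set 'I_K}) (z : R) :
    measurable [set w | forall i, urn_box X z i (t i w)].
  apply: measurable_forall_set => i; rewrite -[X in measurable X]setTI.
  by apply: (measurable_funPT (t i)) => //; exact: measurable_urn_box.
have mE G : measurable (EX G.1 `&` EY G.2) by apply: measurableI; exact: mbox.
have pE G : P (EX G.1 `&` EY G.2) =
    (occ wR [set: 'I_m]%SET G.1 x * occ wC [set: 'I_n]%SET G.2 y)%:E.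
  rewrite htausigma; [|by move=> i; exact: measurable_urn_box..].
  by rewrite (urn_prob htau) // (urn_prob hsigma) // EFinM.
rewrite -sumEFin -(eq_bigr _ (fun G _ => pE G)).
have eventE w : event w x y <-> exists2 G, G \in F & (EX G.1 `&` EY G.2) w.
  split=> [[_ _ h]|[[X Y] GF [/urnE /= eX /urnE /= eY]]]; last by split; rewrite // eX eY.
  by exists (urn (fun i => tau i w) x, urn (fun j => sigma j w) y) => //; split; apply/urnE.
apply: prob_sum => // [|w].
  rewrite (_ : [set w | _] = [set w | exists G, (if G \in F then EX G.1 `&` EY G.2 else set0) w]).
    by apply: measurable_exists_set => G; case: (G \in F); [exact: mE|exact: measurable0].
  apply/seteqP; split => w /=.
    by move=> /eventE[G GF hG]; exists G; rewrite GF.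
  by case=> G; case: ifP => // GF hG; apply/eventE; exists G.
have [ew|ne] := pselect (event w x y); last first.
  rewrite memNset // big1 // => G GF; rewrite memNset // => hG.
  by apply: ne; apply/eventE; exists G.
rewrite mem_set //; have [[X Y] GF hG] := (eventE w).1 ew.
rewrite (bigD1 (X, Y)) //= mem_set // big1 ?addr0 // => -[X' Y'] /andP[_ ne].
rewrite memNset // => -[/= /urnE eX /urnE eY]; case: hG => /= /urnE hX /urnE hY.
by move: ne; rewrite -eX -eY hX hY eqxx.
Qed.

Lemma measurable_event d' (S : measurableType d') (W : S -> T) (X Y : S -> R) :
  measurable_fun setT W -> measurable_fun setT X -> measurable_fun setT Y ->
  measurable [set z | event (W z) (X z) (Y z)].
Proof.
move=> mW mX mY.
have mb (K : nat) (t : 'I_K -> {RV P >-> R}) (V : {set 'I_K}) (h : S -> R) :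
    measurable_fun setT h -> measurable [set z | forall i, urn_box V (h z) i (t i (W z))].
  move=> mh; apply: measurable_forall_set => i.
  have mt : measurable_fun setT (fun z => t i (W z)).
    by apply: measurableT_comp => //; exact: measurable_funPT.
  by rewrite /urn_box; case: (i \in V); [exact: measurable_set_ler|exact: measurable_set_ltr].
rewrite (_ : [set z | _] = [set z | (0 <= X z)%R] `&` ([set z | (0 <= Y z)%R] `&`
    [set z | exists G, (if G \in F then [set z | forall i, urn_box G.1 (X z) i (tau i (W z))] `&`
       [set z | forall j, urn_box G.2 (Y z) j (sigma j (W z))] else set0) z])).
  apply: measurableI; first by apply: measurable_set_ler => //; exact: measurable_cst.
  apply: measurableI; first by apply: measurable_set_ler => //; exact: measurable_cst.
  apply: measurable_exists_set => G; case: (G \in F); last exact: measurable0.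
  by apply: measurableI; exact: mb.
apply/seteqP; split => z /=.
  move=> [x0 y0 h]; do 2!split => //.
  exists (urn (fun i => tau i (W z)) (X z), urn (fun j => sigma j (W z)) (Y z)).
  by rewrite h; split => /=; apply/urnE.
move=> [x0 [y0 [[V V'] ]]]; case: ifP => // GF [/urnE eX /urnE eY].
by split => //; rewrite eX eY.
Qed.

(** Tonelli moves the expectation inside the area integral, where [event_prob] factors the
    integrand. As both parts of each member of [F] are proper, every occupation integral is finite
    and [weight] is its true value. *)
Lemma expected_urn_area :
  \int[P]_w urn_area (urn (fun i => tau i w)) (urn (fun j => sigma j w)) F =
  (\sum_(G in F) weight wR [set: 'I_m]%SET G.1 * weight wC [set: 'I_n]%SET G.2)%:E.
Proof.
pose B := measurableTypeR R.
pose A3 : set ((T * B) * B) := [set z | event z.1.1 (borel_id z.1.2) (borel_id z.2)].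
have mA3 : measurable A3.
  apply: measurable_event.
  - exact: measurableT_comp measurable_fst measurable_fst.
  - exact: measurableT_comp (@measurable_borel_id R) (measurableT_comp measurable_snd measurable_fst).
  - exact: measurableT_comp (@measurable_borel_id R) measurable_snd.
pose f (z : T * B) := leb (xsection A3 z).
have mf : measurable_fun setT f by exact: measurable_fun_xsection.
transitivity (\int[P]_w \int[leb]_x f (w, x)).
  apply: eq_integral => w _; rewrite /urn_area /product_measure1.
  by apply: eq_integral.
rewrite fubini_tonelli //.
transitivity (\int[leb]_x \int[leb]_y P [set w | event w x y]).
  apply: eq_integral => x _.
  pose A2 : set (T * B) := [set z | event z.1 x (borel_id z.2)].
  have mA2 : measurable A2.
    apply: measurable_event; [exact: measurable_fst|exact: measurable_cst|].
    exact: measurableT_comp (@measurable_borel_id R) measurable_snd.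
  have := @indic_fubini_tonelli _ _ _ _ _ P leb A2 mA2.
  rewrite indic_fubini_tonelli_FE // indic_fubini_tonelli_GE // => e.
  rewrite [LHS]e; apply: eq_integral => y _; congr (P _).
  by apply/seteqP; split => w; rewrite /ysection /= !inE.
transitivity (\int[leb]_(x in ray) \int[leb]_(y in ray)
    (\sum_(G in F) occ wR [set: 'I_m]%SET G.1 x * occ wC [set: 'I_n]%SET G.2 y)%:E).
  rewrite [RHS]integral_mkcond; apply: eq_integral => x _; rewrite patchE.
  have [x0|x0] := leP 0%R x; last first.
    rewrite memNset; last by rewrite /= in_itv /= andbT leNgt x0.
    rewrite integral0_eq // => y _; rewrite -[RHS](measure0 P); congr (P _).
    by apply/seteqP; split => // w []; rewrite leNgt x0.
  rewrite mem_set; last by rewrite /= in_itv /= andbT.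
  rewrite [RHS]integral_mkcond; apply: eq_integral => y _; rewrite patchE.
  have [y0|y0] := leP 0%R y.
    by rewrite mem_set; [exact: event_prob|rewrite /= in_itv /= andbT].
  rewrite memNset; last by rewrite /= in_itv /= andbT leNgt y0.
  by rewrite -[RHS](measure0 P); congr (P _); apply/seteqP; split => // w []; rewrite [(0 <= y)%R]leNgt y0.
have occ0' G x y : (0 <= x)%R -> (0 <= y)%R ->
  (0 <= occ wR [set: 'I_m]%SET G.1 x * occ wC [set: 'I_n]%SET G.2 y)%R.
  by move=> x0 y0; apply: mulr_ge0; exact: occ_ge0.
transitivity (\int[leb]_(x in ray)
    (\sum_(G in F) occ wR [set: 'I_m]%SET G.1 x * weight wC [set: 'I_n]%SET G.2)%:E).
  apply: eq_integral => x; rewrite inE /= in_itv /= andbT => x0.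
  rewrite integral_sum_cond //; last 2 first.
  - move=> G _; apply: measurable_funM; first exact: measurable_cst.
    exact: measurable_occ.
  - by move=> G y _ /=; rewrite in_itv /= andbT; exact: occ0'.
  rewrite -sumEFin; apply: eq_bigr => G GF; under eq_integral do rewrite EFinM.
  rewrite ge0_integralZl ?lee_fin ?occ_ge0 //.
  - by rewrite (occ_integral wC_gt0) ?EFinM //; have [] := F_proper GF.
  - by apply/measurable_EFinP; exact: measurable_occ.
  - by move=> y /=; rewrite in_itv /= andbT lee_fin; exact: occ_ge0.
rewrite integral_sum_cond //; last 2 first.
- move=> G _; apply: measurable_funM; last exact: measurable_cst.
  exact: measurable_occ.
- move=> G x _ /=; rewrite in_itv /= andbT => x0; apply: mulr_ge0; [exact: occ_ge0|exact: weight_ge0].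
rewrite -sumEFin; apply: eq_bigr => G GF; under eq_integral do rewrite EFinM.
rewrite ge0_integralZr ?lee_fin ?weight_ge0 //.
- by rewrite (occ_integral wR_gt0) ?EFinM //; have [] := F_proper GF.
- by apply/measurable_EFinP; exact: measurable_occ.
- by move=> y /=; rewrite in_itv /= andbT lee_fin; exact: occ_ge0.
Qed.

End UrnExpectation.

Lemma min_assignment_vmin (R : realType) (m n k : nat) (A : 'I_m * 'I_n -> R) :
  (k <= minn m n)%N ->
  min_assignment k A = vmin A k [set: 'I_m]%SET [set: 'I_n]%SET.
Proof.
rewrite leq_min => /andP[km kn].
have aE S : assignment k S = adm k [set: 'I_m]%SET [set: 'I_n]%SET S.
  by rewrite /assignment /adm !finset.subsetT !andbT andbC.
rewrite /min_assignment; set E := (X in inf X).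
have [S aS vS] : exists2 S, adm k [set: 'I_m]%SET [set: 'I_n]%SET S &
    total A S = vmin A k [set: 'I_m]%SET [set: 'I_n]%SET.
  by apply: vmin_attained; rewrite finset.cardsT card_ord.
have vE : E (vmin A k [set: 'I_m]%SET [set: 'I_n]%SET) by exists S; rewrite //= aE.
have lE : lbound E (vmin A k [set: 'I_m]%SET [set: 'I_n]%SET).
  by move=> _ [S' /= aS' <-]; apply: vmin_le; rewrite -aE.
apply/eqP; rewrite eq_le; apply/andP; split.
  by apply: ge_inf => //; exists (vmin A k [set: 'I_m]%SET [set: 'I_n]%SET).
by apply: lb_le_inf => //; exists (vmin A k [set: 'I_m]%SET [set: 'I_n]%SET).
Qed.

Lemma sum_partial_covers (R : realType) (m n k : nat) (Z : {set 'I_m * 'I_n})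
    (F : {set 'I_m} -> R) (G : {set 'I_n} -> R) : (0 < k)%N -> (k <= m)%N ->
  \sum_(X : {set 'I_m} | (X \subset [set: 'I_m]%SET) && (#|X| < k)%N) F X *
     (\sum_(Y : {set 'I_n} | (rk Z ([set: 'I_m] :\: X)%SET Y < k - #|X|)%N) G Y) =
  \sum_(H in partial_covers k.-1 Z) F H.1 * G H.2.
Proof.
move=> k0 km; under eq_bigr do rewrite mulr_sumr.
rewrite pair_big_dep /=; apply: eq_bigl => -[X Y] /=.
rewrite partial_coversP; last by apply: leq_trans km; exact: leq_pred.
rewrite finset.subsetT finset.setTD /=; case: k k0 {km} => // k _ /=.
rewrite ltnS; have [Xk|Xk] := leqP #|X| k; first by rewrite subSn // ltnS leq_subRL.
by apply/esym/negbTE; rewrite -ltnNge; exact: leq_trans (leq_addr _ _).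
Qed.

(** * From the standard matrix to its joint law *)

Section StandardMatrix.
Local Open Scope classical_set_scope.
Local Open Scope ereal_scope.
Variables (R : realType) (d : measure_display) (T : measurableType d) (P : probability T R).
Variables (m n : nat) (wR : 'I_m -> R) (wC : 'I_n -> R) (Z : {set 'I_m * 'I_n}).
Variable (M : 'I_m * 'I_n -> {RV P >-> R}).
Hypothesis hM : standard_matrix wR wC Z M.

Lemma standard_matrix_entry p : p \notin Z -> exists2 mu : probability R R,
  exponential_law (wR p.1 * wC p.2)%R mu & resampled (joint_law M) mu p.
Proof.
case: hM => MZ Mi Me pZ; exists (distribution P (M p)); first exact: Me.
apply: (@resampled_joint_law _ _ _ _ P M (~: Z)%SET (fun=> 0%R)) => //.
  by move=> i; rewrite finset.in_setC negbK => iZ w; exact: MZ.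
by rewrite finset.in_setC.
Qed.

Lemma standard_matrix_zeros : joint_law M [set a | zeros_exactly Z a] = 1.
Proof.
case: hM => MZ Mi Me.
transitivity (P [set w | forall p, p \in (~: Z)%SET -> [set x : R | (0 < x)%R] (M p w)]).
  congr (P _); apply/seteqP; split => w /=.
    by move=> /zeros_exactlyP[_ h] p; rewrite finset.in_setC; exact: h.
  move=> h; apply/zeros_exactlyP; split => p pZ; first exact: MZ.
  by apply: h; rewrite finset.in_setC.
rewrite (Mi _ (fun=> [set x : R | (0 < x)%R])) //.
  apply: big1 => p; rewrite finset.in_setC => pZ.
  by have := Me p pZ 0%R (lexx _); rewrite mulr0 oppr0 expR0.
move=> _; rewrite (_ : [set x | _] = `]0%R, +oo[) //.
by apply/seteqP; split => x; rewrite /= in_itv /= andbT.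
Qed.

Hypothesis wR_gt0 : forall i, (0 < wR i)%R.
Hypothesis wC_gt0 : forall j, (0 < wC j)%R.

Lemma expected_min_assignment k : (k <= minn m n)%N ->
  'E_P[fun w => min_assignment k (fun p => M p w)] =
  \int[joint_law M]_(a in generic Z) (vmin a k [set: 'I_m]%SET [set: 'I_n]%SET)%:E.
Proof.
move=> kmn; rewrite unlock.
pose v (a : vect R ('I_m * 'I_n)%type) := vmin a k [set: 'I_m]%SET [set: 'I_n]%SET.
have mv : measurable_fun setT v by exact: measurable_vmin.
(* Off the generic event the minimum may be negative; truncating it at 0 gives a nonnegative
   function, almost surely equal to it, whose integral can be transported to the joint law. *)
pose f a := (Num.max 0 (v a))%:E.
have mf : measurable_fun setT f.
  by apply/measurable_EFinP; apply: measurable_maxr => //; exact: measurable_cst.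
have f0 a : 0 <= f a by rewrite lee_fin le_max lexx.
have fam : measurable_fun setT (family M) := measurable_family M.
have gG : P (family M @^-1` (~` generic Z)) = 0.
  exact: (generic_full wR_gt0 wC_gt0 standard_matrix_zeros standard_matrix_entry).
have fv a : generic Z a -> f a = (v a)%:E.
  by case/genericP => /zeros_exactly_ge0 a0 _; rewrite /f max_r // vmin_ge0.
transitivity (\int[P]_w f (family M w)).
  apply: ae_eq_integral => //.
  - apply/measurable_EFinP; rewrite (_ : (fun w => _) = v \o family M); first exact: measurableT_comp.
    by apply/funext => w; rewrite /= (min_assignment_vmin _ kmn).
  - exact: measurableT_comp mf fam.
  - exists (family M @^-1` (~` generic Z)); split => //.
      by rewrite -[X in measurable X]setTI; apply: fam => //; apply: measurableC; exact: measurable_generic.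
    move=> w /= h gw; apply: h => _; rewrite (fv _ gw).
    by rewrite (min_assignment_vmin _ kmn).
rewrite -(ge0_integral_distribution (family M) mf f0) -/(joint_law M).
rewrite (@ge0_negligible_integral _ _ _ (joint_law M) setT (~` generic Z)) //.
  by rewrite setTD setCK; apply: eq_integral => a; rewrite inE => /fv.
by apply: measurableC; exact: measurable_generic.
Qed.

End StandardMatrix.

Theorem mainTheorem3 (R : realType) (d : measure_display)
    (T : measurableType d) (P : probability T R)
    (m n k : nat) (hk0 : (0 < k)%N) (hk : (k <= minn m n)%N)
    (wR : 'I_m -> R) (wC : 'I_n -> R)
    (hwR : forall i, 0 < wR i) (hwC : forall j, 0 < wC j)
    (Z : {set 'I_m * 'I_n}) (M : 'I_m * 'I_n -> {RV P >-> R})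
    (hM : standard_matrix wR wC Z M)
    (tau : 'I_m -> {RV P >-> R}) (sigma : 'I_n -> {RV P >-> R})
    (htau : urn_times wR tau) (hsigma : urn_times wC sigma)
    (htausigma : independent_vectors tau sigma)
    (hMurn : independent_vectors M (sum_family tau sigma)) :
  ('E_P[fun w => min_assignment k (fun p => M p w)] =
   \int[P]_w urn_area (urn (fun i => tau i w)) (urn (fun j => sigma j w))
                      (partial_covers k.-1 Z))%E.
Proof.
rewrite (expected_min_assignment hM hwR hwC hk); move: (hk); rewrite leq_min => /andP[km kn].
rewrite (expected_vmin hwR hwC (standard_matrix_zeros hM) (standard_matrix_entry hM));
  rewrite ?finset.cardsT ?card_ord //.
rewrite (expected_urn_area hwR hwC htau hsigma htausigma).
  by congr EFin; exact: sum_partial_covers.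
(* The properness required of the family: a partial cover has at most [k.-1] files, fewer than the
   rows and fewer than the columns. The columns [Y] are counted in the rank. *)
move=> -[X Y]; rewrite partial_coversP; last by apply: leq_trans km; exact: leq_pred.
move=> h; have l1 : (k.-1 < k)%N by rewrite prednK.
have rY : (#|Y| <= rk Z (~: X)%SET Y)%N.
  have [W _ ->] := rk_attained Z (~: X)%SET Y.
  by rewrite (leq_trans _ (leq_addl _ _)) // subset_leq_card // finset.subsetUl.
have nT (K : nat) (V : {set 'I_K}) : (#|V| < K)%N -> V \proper [set: 'I_K]%SET.
  by move=> VK; rewrite finset.properEcard finset.subsetT finset.cardsT card_ord.
split; apply: nT => /=.
  exact: leq_ltn_trans (leq_addr _ _) (leq_ltn_trans h (leq_trans l1 km)).
exact: leq_ltn_trans (leq_trans rY (leq_addl _ _)) (leq_ltn_trans h (leq_trans l1 kn)).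
Qed.
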